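(* Let $F$, $T$ and $V$ be Thompson's groups. (i) The only uniformly recurrent subgroups of $F$ are the normal subgroups (i.e. the singletons $\{N\}$ with $N$ a normal subgroup of $F$). The derived subgroup $[F,F]$ has no uniformly recurrent subgroups other than $1$ and $[F,F]$. (ii) The uniformly recurrent subgroups of $T$ are $1$, $T$ and the stabilizer URS $\mathcal{S}_T(\mathbb{S}^1)$ associated to its action on the circle $\mathbb{S}^1$. (iii) The uniformly recurrent subgroups of $V$ are $1$, $V$ and the stabilizer URS $\mathcal{S}_V(\mathcal{C})$ associated to its action on the Cantor set $\mathcal{C}$.
   Context: Thompson's group $T$ is the group of orientation preserving homeomorphisms of $\mathbb{S}^1=\mathbb{R}/\mathbb{Z}$ which are piecewise linear, with only finitely many breakpoints, all at dyadic rationals, slopes in $2^{\mathbb{Z}}$, and preserving the set of dyadic rationals (as is part of the usual definition). $F$ is the subgroup of $T$ stabilizing $0\in\mathbb{S}^1$. Let $\mathcal{C}=\{0,1\}^{\mathbb{N}}$ with the product topology, and for a finite binary word $w$ let $C_w$ be the cylinder of sequences with prefix $w$. $V$ is the group of homeomorphisms $g$ of $\mathcal{C}$ for which there exist cylinder partitions $\{C_{w_1},\dots,C_{w_n}\}$, $\{C_{z_1},\dots,C_{z_n}\}$ of $\mathcal{C}$ with $g(w_ix)=z_ix$ for every $i$ and every binary sequence $x$. For a countable group $G$, $\mathrm{Sub}(G)$ is the space of subgroups of $G$ with the topology induced from $\{0,1\}^G$, on which $G$ acts by conjugation. A uniformly recurrent subgroup (URS) of $G$ is a (non-empty) closed minimal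 $G$-invariant subset of $\mathrm{Sub}(G)$. For $N$ normal in $G$, the URS $\{N\}$ is denoted $N$; $1$ denotes $\{\{1\}\}$. For a minimal action of $G$ on a compact Hausdorff space $X$, with $X_0$ the set of continuity points of $x\mapsto G_x\in\mathrm{Sub}(G)$ ($G_x$ the stabilizer), the stabilizer URS $\mathcal{S}_G(X)$ is the closure of $\{G_x : x\in X_0\}$ in $\mathrm{Sub}(G)$; it is a URS, the unique one contained in the closure of $\{G_x:x\in X\}$. *)

(* Defs.v *)
From HB Require Import structures.
From mathcomp Require Import all_boot all_order all_algebra.
From mathcomp Require Import all_classical all_reals all_analysis.
From mathcomp Require Import ring.

Set Implicit Arguments.
Unset Strict Implicit.
Unset Printing Implicit Defensive.

Import Order.TTheory GRing.Theory Num.Theory.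
Import numFieldNormedType.Exports.

Local Open Scope classical_set_scope.
Local Open Scope group_scope.
Local Open Scope ring_scope.

Definition SubG (G : groupType) : Type :=
  [set S : prod_topology (fun _ : G => bool) | group_closed S].

HB.instance Definition _ (G : groupType) := SubType.on (SubG G).
HB.instance Definition _ (G : groupType) := Topological.on (SubG G).

Section SubTheory.
Variable G : groupType.
Implicit Types (H : SubG G) (g : G).

Definition mem_sub H : {pred G} := \val H.

Lemma mem_sub_closed H : group_closed (mem_sub H).
Proof. exact: (set_mem (valP H)). Qed.

Lemma subG_ext H H' : mem_sub H =i mem_sub H' -> H = H'.
Proof. by move=> e; apply/val_inj/funext => g; exact: e. Qed.

Definition mk_subG (P : set G) (cP : group_closed [pred g | `[< P g >]]) : SubG G :=
  exist _ (fun g => `[< P g >]) (mem_set cP).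

Lemma set_group_closed (P : set G) : P 1%g ->
  (forall x y, P x -> P y -> P (x / y)%g) -> group_closed [pred g | `[< P g >]].
Proof.
move=> P1 PF; split; first exact/asboolP.
by move=> x y /asboolP Px /asboolP Py; apply/asboolP/PF.
Qed.

Lemma mem_mkSub (P : set G) cP g : (g \in mem_sub (@mk_subG P cP)) = `[< P g >].
Proof. by []. Qed.

Lemma trivial_closed : group_closed [pred g : G | `[< [set 1%g] g >]].
Proof.
apply: set_group_closed => //= x y -> ->.
by rewrite invg1 mulg1.
Qed.
Definition trivial_sub : SubG G := mk_subG trivial_closed.

Lemma whole_closed : group_closed [pred g : G | `[< [set: G] g >]].
Proof. exact: set_group_closed. Qed.
Definition whole_sub : SubG G := mk_subG whole_closed.

Lemma sub_divg H x y : x \in mem_sub H -> y \in mem_sub H ->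
  (x / y)%g \in mem_sub H.
Proof. by move=> xH yH; case: (mem_sub_closed H) => _; exact. Qed.

Lemma generated_closed (A : set G) : group_closed
  [pred g : G | `[< [set g | forall H, (forall a, A a -> a \in mem_sub H) ->
     g \in mem_sub H] g >]].
Proof.
apply: set_group_closed => [H _ /=|x y /= Px Py H AH].
  by case: (mem_sub_closed H).
by apply: sub_divg; [exact: Px|exact: Py].
Qed.
Definition generated (A : set G) : SubG G := mk_subG (generated_closed A).

Definition derived_sub : SubG G :=
  generated [set [~ x, y]%g | x in [set: G] & y in [set: G]].

Lemma conj_sub_closed g H :
  group_closed [pred x : G | `[< [set x | (x ^ g)%g \in mem_sub H] x >]].
Proof.
apply: set_group_closed => [|x y] /=.
  by rewrite conj1g; case: (mem_sub_closed H).
by rewrite conjMg conjVg; exact: sub_divg.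
Qed.

(* [x ^ g] is g^-1 * x * g, so this is g H g^-1. *)
Definition conj_sub g H : SubG G := mk_subG (conj_sub_closed g H).

Definition normal_sub H : Prop := forall g, conj_sub g H = H.

Definition conj_invariant (U : set (SubG G)) : Prop :=
  forall g H, U H -> U (conj_sub g H).

Definition is_URS (U : set (SubG G)) : Prop :=
  [/\ U !=set0, closed U, conj_invariant U &
      forall W, W `<=` U -> W !=set0 -> closed W -> conj_invariant W -> W = U].

End SubTheory.

Definition subg (G : groupType) (H : SubG G) : Type := {x : G | x \in mem_sub H}.

HB.instance Definition _ (G : groupType) (H : SubG G) := SubChoice.on (subg H).
HB.instance Definition _ (G : groupType) (H : SubG G) :=
  SubChoice_isSubGroup.Build G (fun x => x \in mem_sub H) (subg H)
    (mem_sub_closed H).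

Definition subg_incl (G : groupType) (H : SubG G) : {multiplicative subg H -> G} :=
  (val : subg H -> G).

Record homeo (X : topologicalType) := Homeo {
  homeo_fun :> X -> X;
  homeo_inv : X -> X;
  homeoK : cancel homeo_fun homeo_inv;
  homeoVK : cancel homeo_inv homeo_fun;
  homeo_continuous : continuous homeo_fun;
  homeo_inv_continuous : continuous homeo_inv }.

Section HomeoGroup.
Variable X : topologicalType.
Implicit Types f g : homeo X.

Lemma homeoP f g : f =1 g -> f = g.
Proof.
case: f g => [f f' fK fVK cf cf'] [g g' gK gVK cg cg'] /= /funext efg.
subst g; have e : f' = g' by apply/funext => x; rewrite -[LHS]gK fVK.
by subst g'; congr Homeo; exact: Prop_irrelevance.
Qed.

HB.instance Definition _ := gen_eqMixin (homeo X).
HB.instance Definition _ := gen_choiceMixin (homeo X).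

Definition homeo_id : homeo X :=
  @Homeo X id id (fun _ => erefl) (fun _ => erefl)
    (fun _ => cvg_id) (fun _ => cvg_id).

Definition homeo_V f : homeo X :=
  Homeo (@homeoVK _ f) (@homeoK _ f) (@homeo_inv_continuous _ f)
    (@homeo_continuous _ f).

Lemma homeo_comp_continuous (f g : X -> X) :
  continuous f -> continuous g -> continuous (f \o g).
Proof. by move=> cf cg x; apply: continuous_comp; [exact: cg|exact: cf]. Qed.

Definition homeo_comp f g : homeo X :=
  Homeo (can_comp (@homeoK _ f) (@homeoK _ g))
    (can_comp (@homeoVK _ g) (@homeoVK _ f))
    (homeo_comp_continuous (@homeo_continuous _ f) (@homeo_continuous _ g))
    (homeo_comp_continuous (@homeo_inv_continuous _ g)
       (@homeo_inv_continuous _ f)).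

Lemma homeo_compA : associative homeo_comp.
Proof. by move=> f g h; exact: homeoP. Qed.
Lemma homeo_comp1f : left_id homeo_id homeo_comp.
Proof. by move=> f; exact: homeoP. Qed.
Lemma homeo_compf1 : right_id homeo_id homeo_comp.
Proof. by move=> f; exact: homeoP. Qed.
Lemma homeo_compVf : left_inverse homeo_id homeo_V homeo_comp.
Proof. by move=> f; apply: homeoP => x; exact: homeoK. Qed.
Lemma homeo_compfV : right_inverse homeo_id homeo_V homeo_comp.
Proof. by move=> f; apply: homeoP => x; exact: homeoVK. Qed.

HB.instance Definition _ := isGroup.Build (homeo X)
  homeo_compA homeo_comp1f homeo_compf1 homeo_compVf homeo_compfV.

Lemma homeoM f g x : (f * g)%g x = f (g x). Proof. by []. Qed.
Lemma homeo1 x : (1%g : homeo X) x = x. Proof. by []. Qed.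
Lemma homeoV f x : (f^-1)%g x = homeo_inv f x. Proof. by []. Qed.

End HomeoGroup.

(* An action of G on X by homeomorphisms is a morphism from G to [homeo X]. *)
Section Stabilizers.
Variables (G : groupType) (X : topologicalType).
Variable phi : {multiplicative G -> homeo X}.

Lemma stabilizer_closed x :
  group_closed [pred g : G | `[< [set g | phi g x = x] g >]].
Proof.
have phi1 : phi 1%g = 1%g.
  by apply: (@mulgI _ (phi 1%g)); rewrite -gmulfM !mulg1.
apply: set_group_closed => /= [|g h gx hx]; first by rewrite phi1.
rewrite gmulfM homeoM (_ : phi h^-1%g x = x) ?gx//.
by rewrite -[in LHS]hx -homeoM -gmulfM mulVg phi1.
Qed.
Definition stabilizer (x : X) : SubG G := mk_subG (stabilizer_closed x).

(* A URS when X is compact Hausdorff and the action is minimal. *)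
Definition stabilizer_URS : set (SubG G) :=
  closure [set stabilizer x | x in [set x | {for x, continuous stabilizer}]].

End Stabilizers.


Section Circle.
Local Open Scope quotient_scope.
Variable R : realType.

Definition circle_equiv (x y : R) : bool := (x - y) \is a Num.int.

Lemma circle_equiv_class : equiv_class_of circle_equiv.
Proof.
split=> [x|x y|y x z]; rewrite /circle_equiv ?subrr ?rpred0 //.
  by rewrite -opprB rpredN.
by move=> xy yz; rewrite -[x](subrK y) -addrA rpredD.
Qed.

Canonical circle_equiv_rel := EquivRelPack circle_equiv_class.

Definition circle : Type := quotient_topology {eq_quot circle_equiv}.

HB.instance Definition _ := Topological.on circle.
HB.instance Definition _ := Quotient.on circle.

Definition circle_pi (x : R) : circle := \pi_circle x.

Lemma circle_piP x y : circle_pi x = circle_pi y <-> (x - y) \is a Num.int.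
Proof.
rewrite -[_ \is a _]/(circle_equiv x y).
by split=> /eqmodP.
Qed.

Lemma circle_pi_surj p : exists x, circle_pi x = p.
Proof. by exists (repr p); rewrite /circle_pi reprK. Qed.

Definition dyadic : set R :=
  [set x | exists (m : int) (n : nat), x = m%:~R / 2 ^+ n].

Definition circle_dyadic : set circle := circle_pi @` dyadic.

(* A homeomorphism of R/Z preserves the orientation when it lifts to an
   increasing homeomorphism of R. *)
Definition orientation_preserving (g : homeo circle) : Prop :=
  exists h : homeo R, {homo h : x y / x < y} /\
    forall x, g (circle_pi x) = circle_pi (h x).

(* g has slope a at (the class of) x. *)
Definition affine_near (g : homeo circle) (x a : R) : Prop :=
  exists c, \forall y \near x, g (circle_pi y) = circle_pi (a * y + c).

(* Piecewise linear with slopes in 2^Z and finitely many breakpoints, all of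
   them dyadic: B is a finite set of dyadic points containing the breakpoints,
   possibly strictly. *)
Definition dyadic_PL (g : homeo circle) : Prop :=
  exists B : set circle, [/\ finite_set B, B `<=` circle_dyadic &
    forall x, ~ B (circle_pi x) -> exists k : int, affine_near g x (2 ^ k)].

Definition thompsonT_set : set (homeo circle) :=
  [set g | [/\ orientation_preserving g, dyadic_PL g &
               g @` circle_dyadic = circle_dyadic]].

Lemma affine_near_comp (f g : homeo circle) x y a b :
  g (circle_pi x) = circle_pi y -> affine_near g x a -> affine_near f y b ->
  affine_near (f * g)%g x (b * a).
Proof.
move=> gxy [c gc] [d fd].
have [n e] : exists n : int, y = a * x + c + n%:~R.
  have /circle_piP/intrP[n e] : circle_pi y = circle_pi (a * x + c).
    by rewrite -gxy; exact: (nbhs_singleton gc).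
  by exists n; rewrite -e addrC subrK.
exists (b * (c + n%:~R) + d).
have cl : {for x, continuous (fun z : R => a * z + c + n%:~R)}.
  apply: cvgD; last exact: cvg_cst.
  apply: cvgD; last exact: cvg_cst.
  by apply: cvgM; [exact: cvg_cst|exact: cvg_id].
have fd' : \forall z \near x, f (circle_pi (a * z + c + n%:~R)) =
    circle_pi (b * (a * z + c + n%:~R) + d).
  by apply: (cl (fun w => f (circle_pi w) = circle_pi (b * w + d))); rewrite -e.
near=> z.
rewrite homeoM (near gc z)//.
rewrite (_ : circle_pi (a * z + c) = circle_pi (a * z + c + n%:~R)); last first.
  by apply/circle_piP; rewrite opprD addrA subrr add0r rpredN intr_int.
rewrite (near fd' z)//; congr circle_pi.
by rewrite -[a * z + c + _]addrA mulrDr mulrA addrA.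
Unshelve. all: by end_near. Qed.

Lemma affine_near_inv (g : homeo circle) x y a : a != 0 ->
  g (circle_pi x) = circle_pi y -> affine_near g x a ->
  affine_near (g^-1)%g y a^-1.
Proof.
move=> a0 gxy [c gc].
have [n e] : exists n : int, y = a * x + c + n%:~R.
  have /circle_piP/intrP[n e] : circle_pi y = circle_pi (a * x + c).
    by rewrite -gxy; exact: (nbhs_singleton gc).
  by exists n; rewrite -e addrC subrK.
exists (a^-1 * (- (c + n%:~R))).
have cl : {for y, continuous (fun z : R => a^-1 * z + a^-1 * (- (c + n%:~R)))}.
  apply: cvgD; last exact: cvg_cst.
  by apply: cvgM; [exact: cvg_cst|exact: cvg_id].
have gc' : \forall z \near y,
    g (circle_pi (a^-1 * z + a^-1 * (- (c + n%:~R)))) =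
    circle_pi (a * (a^-1 * z + a^-1 * (- (c + n%:~R))) + c).
  apply: (cl (fun w => g (circle_pi w) = circle_pi (a * w + c))).
  suff -> : a^-1 * y + a^-1 * (- (c + n%:~R)) = x by [].
  by rewrite e -mulrDr -(addrA (a * x)) addrK mulKf.
near=> z.
rewrite homeoV; apply: (can_inj (@homeoK _ g)); rewrite homeoVK (near gc' z)//.
apply/circle_piP.
rewrite -mulrDr mulVKf// (_ : _ - _ = n%:~R) ?intr_int//.
by ring.
Unshelve. all: by end_near. Qed.

Lemma thompsonT_mul f g : thompsonT_set f -> thompsonT_set g ->
  thompsonT_set (f * g)%g.
Proof.
move=> [[hf [hf_inc hfE]] [Bf [Bf_fin BfD fBf]] fD].
move=> [[hg [hg_inc hgE]] [Bg [Bg_fin BgD gBg]] gD].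
split.
- exists (hf * hg)%g; split=> [x y xy|x].
    by rewrite !homeoM; exact/hf_inc/hg_inc.
  by rewrite !homeoM hgE hfE.
- exists (Bg `|` homeo_inv g @` Bf); split.
  + by rewrite finite_setU; split => //; exact: finite_image.
  + rewrite subUset; split => // _ [p /BfD + <-].
    by rewrite -[in X in X -> _]gD => -[q Dq <-]; rewrite homeoK.
  + move=> x /not_orP[/gBg[k gk] nBf].
    have [y xy] := circle_pi_surj (g (circle_pi x)).
    have [|l fl] := fBf y.
      rewrite xy => Bfy; apply: nBf.
      by exists (g (circle_pi x)) => //; rewrite homeoK.
    exists (l + k); rewrite expfzDr ?pnatr_eq0//.
    exact: affine_near_comp gk fl.
- by rewrite -[RHS]fD -[in RHS]gD [RHS](image_comp g f).
Qed.

Lemma thompsonT_inv g : thompsonT_set g -> thompsonT_set (g^-1)%g.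
Proof.
move=> [[h [h_inc hE]] [B [B_fin BD gB]] gD].
split.
- exists (h^-1)%g; split=> [x y xy|x].
    rewrite !homeoV ltNge; apply/negP => le.
    have : h (homeo_inv h y) <= h (homeo_inv h x).
      by move: le; rewrite !le_eqVlt => /predU1P[->|/h_inc ->]; rewrite ?eqxx ?orbT.
    by rewrite !homeoVK leNgt xy.
  rewrite !homeoV; apply: (can_inj (@homeoK _ g)).
  by rewrite hE !homeoVK.
- exists (g @` B); split.
  + exact: finite_image.
  + by rewrite -[X in _ `<=` X]gD; exact: image_subset.
  + move=> y nB; have [x xy] := circle_pi_surj (homeo_inv g (circle_pi y)).
    have gxy : g (circle_pi x) = circle_pi y by rewrite xy homeoVK.
    have [|k gk] := gB x; first by move=> Bx; apply: nB; exists (circle_pi x).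
    exists (- k); rewrite -invr_expz.
    by apply: affine_near_inv gxy gk; rewrite expfz_neq0// pnatr_eq0.
- rewrite -[in LHS]gD [LHS](image_comp g (homeo_inv g)).
  by rewrite (_ : _ \o _ = id) ?image_id//; apply/funext => p; exact: homeoK.
Qed.

Lemma thompsonT_closed : group_closed [pred g | `[< thompsonT_set g >]].
Proof.
apply: set_group_closed; last first.
  by move=> f g Tf Tg; apply: thompsonT_mul => //; exact: thompsonT_inv.
split.
- by exists 1%g; split.
- exists set0; split => // x _; exists 0, 0.
  by apply: (@filterE _ (nbhs x)) => y; rewrite expr0z mul1r addr0.
- by rewrite image_id.
Qed.

Definition thompsonT : groupType := subg (mk_subG thompsonT_closed).

Definition thompsonT_act : {multiplicative thompsonT -> homeo circle} :=
  subg_incl (mk_subG thompsonT_closed).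

Definition thompsonF : groupType :=
  subg (stabilizer thompsonT_act (circle_pi 0)).

Definition derivedF : groupType := subg (derived_sub thompsonF).

End Circle.

Definition prepend (w : seq bool) (x : cantor_space) : cantor_space :=
  fun i => if (i < size w)%N then nth false w i else x (i - size w)%N.

Definition cylinder (w : seq bool) : set cantor_space :=
  [set x | forall i, (i < size w)%N -> x i = nth false w i].

Definition cylinder_partition n (w : 'I_n -> seq bool) : Prop :=
  partition [set: 'I_n] (fun i => cylinder (w i)) [set: cantor_space].

Definition thompsonV_set : set (homeo cantor_space) :=
  [set g | exists n (w z : 'I_n -> seq bool),
     [/\ cylinder_partition w, cylinder_partition z &
         forall i x, g (prepend (w i) x) = prepend (z i) x]].

Lemma prepend_cat u v x : prepend (u ++ v) x = prepend u (prepend v x).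
Proof.
apply/funext => i; rewrite /prepend size_cat nth_cat.
have [iu|ui] := ltnP i (size u); first by rewrite ltn_addr.
by rewrite ltn_subLR// subnDA.
Qed.

Lemma prepend_inj w : injective (prepend w).
Proof.
move=> x y /(congr1 (fun f : cantor_space => fun i => f (i + size w)%N)) e.
apply/funext => i; move: e => /(congr1 (@^~ i)); rewrite /prepend /=.
by rewrite ltnNge leq_addl addnK.
Qed.

Lemma prepend_cylinder w x : cylinder w (prepend w x).
Proof. by move=> i iw; rewrite /prepend iw. Qed.

Lemma cylinderP w x : cylinder w x -> prepend w (fun i => x (i + size w)%N) = x.
Proof.
move=> wx; apply/funext => i; rewrite /prepend; case: ltnP => [/wx //|wi].
by rewrite subnK.
Qed.

(* A uniform version of membership in [thompsonV_set], convenient for products: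
   g replaces every prefix of length N. *)
Definition depth (g : homeo cantor_space) (N : nat) : Prop :=
  forall w : seq bool, size w = N -> exists z, forall x,
    g (prepend w x) = prepend z x.

Lemma cylinder_mkseq x N : cylinder (mkseq x N) x.
Proof. by move=> i; rewrite size_mkseq => iN; rewrite nth_mkseq. Qed.

Lemma depth_partition n (w : 'I_n -> seq bool) : cylinder_partition w ->
  exists N, forall u, size u = N -> exists i v, u = w i ++ v.
Proof.
move=> [cov _ _]; exists (\max_(i < n) size (w i))%N => u uN.
have [i _ wi] : cover [set: 'I_n] (fun i => cylinder (w i))
    (prepend u (fun=> false)) by rewrite cov.
have iu : (size (w i) <= size u)%N by rewrite uN; exact: leq_bigmax.
exists i, (drop (size (w i)) u); rewrite -[LHS](cat_take_drop (size (w i))).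
congr cat; apply: (@eq_from_nth _ false) => [|j].
  by rewrite size_takel.
rewrite size_takel// => ji; rewrite nth_take// -wi//.
by rewrite /prepend (leq_trans ji).
Qed.

Lemma thompsonV_depth g : thompsonV_set g <-> exists N, depth g N.
Proof.
split=> [[n [w [z [/depth_partition[N wN] _ gE]]]]|[N gN]].
  exists N => u /wN[i [v ->]]; exists (z i ++ v) => x.
  by rewrite !prepend_cat gE.
have /choice[z zE] (t : N.-tuple bool) := gN t (size_tuple t).
pose w (i : 'I_#|{: N.-tuple bool}|) : seq bool := enum_val i.
have sw i : size (w i) = N by rewrite size_tuple.
have wcov x : exists i, cylinder (w i) x.
  exists (enum_rank (mktuple (fun i : 'I_N => x i))).
  move=> j; rewrite sw => jN; rewrite /w enum_rankK.
  by rewrite (nth_map (Ordinal jN)) ?size_enum_ord// nth_enum_ord.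
have winj i j x : cylinder (w i) x -> cylinder (w j) x -> i = j.
  move=> wi wj; apply/enum_val_inj/val_inj/(@eq_from_nth _ false) => [|k kN].
    by rewrite !size_tuple.
  by rewrite -wi// -wj// sw -(sw i).
have gE i x : g (prepend (w i) x) = prepend (z (enum_val i)) x by exact: zE.
have gcyl i x : cylinder (z (enum_val i)) (g x) -> cylinder (w i) x.
  move=> /cylinderP; rewrite -gE => /(can_inj (@homeoK _ g)) <-.
  exact: prepend_cylinder.
exists #|{: N.-tuple bool}|, w, (fun i => z (enum_val i)); split => //.
- split=> [|i j _ _ [x [wi wj]]|i _].
  + by rewrite -subTset => x _; have [i] := wcov x; exists i.
  + exact: winj wi wj.
  + by exists (prepend (w i) (fun=> false)); exact: prepend_cylinder.
- split=> [|i j _ _ [x []]|i _].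
  + rewrite -subTset => x _; have [i wi] := wcov (homeo_inv g x); exists i => //.
    rewrite -[x](@homeoVK _ g) -(cylinderP wi) gE; exact: prepend_cylinder.
  + by rewrite -[x](@homeoVK _ g) => /gcyl wi /gcyl wj; exact: winj wi wj.
  + by exists (prepend (z (enum_val i)) (fun=> false)); exact: prepend_cylinder.
Qed.

Lemma thompsonV_mul f g : thompsonV_set f -> thompsonV_set g ->
  thompsonV_set (f * g)%g.
Proof.
move=> /thompsonV_depth[M fM] /thompsonV_depth[N gN].
apply/thompsonV_depth; exists (N + M)%N => u uNM.
have [|z zE] := gN (take N u); first by rewrite size_takel// uNM leq_addr.
pose v := z ++ drop N u.
have Mv : (M <= size v)%N.
  by rewrite size_cat size_drop uNM addKn leq_addl.
have [|z' z'E] := fM (take M v); first by rewrite size_takel.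
exists (z' ++ drop M v) => x; rewrite homeoM.
rewrite -[in LHS](cat_take_drop N u) prepend_cat zE -prepend_cat -/v.
by rewrite -[in LHS](cat_take_drop M v) !prepend_cat z'E.
Qed.

Lemma thompsonV_inv g : thompsonV_set g -> thompsonV_set (g^-1)%g.
Proof.
move=> [n [w [z [wp zp gE]]]]; exists n, z, w; split => // i x.
by rewrite homeoV -gE homeoK.
Qed.

Lemma thompsonV_closed : group_closed [pred g | `[< thompsonV_set g >]].
Proof.
apply: set_group_closed; last first.
  by move=> f g Vf Vg; apply: thompsonV_mul => //; exact: thompsonV_inv.
by apply/thompsonV_depth; exists 0%N => w _; exists w.
Qed.

Definition thompsonV : groupType := subg (mk_subG thompsonV_closed).

Definition thompsonV_act : {multiplicative thompsonV -> homeo cantor_space} :=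
  subg_incl (mk_subG thompsonV_closed).

(* Main.v *)
Require Import Defs.
From HB Require Import structures.
From mathcomp Require Import all_boot all_order all_algebra.
From mathcomp Require Import all_classical all_reals all_analysis.
From mathcomp Require Import lra ring zify.

(** All four classifications rest on one dichotomy for a group [G] acting
    faithfully by homeomorphisms on a space with a base point [x0]. Assume that
    the complement of any neighbourhood of [x0] can be moved into any nonempty
    open set by an element trivial near [x0] ([expanding]), and that the elements
    trivial near [x0] form a perfect group ([locally_perfect]). Then every URS of
    [G] other than the trivial one has a member that contains all the elements
    trivial near [x0] ([URS_contains_locally_trivial]).

    A URS without the trivial subgroup is uniformly nontrivial: a finite set [P]
    of nontrivial elements meets all conjugates of its members [K]
    ([URS_confined]). Colour each [h] of [G] by a [g] in [P] such that [g ^ h] is in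
    [K], and let [h] run over the products of elements placed in disjoint small
    open sets. A counting argument ([avoiding_transversal]) yields words of the
    same colour that vary essentially freely in one of these sets, and a
    commutator of quotients of the resulting members of [K] is a conjugate of
    [[~ a, b]] for arbitrary [a] and [b] from a finite set of elements trivial near
    [x0] ([conj_diff_commutator], [confined_contains_commutators]). Compactness
    of the space of subgroups gives a member of the URS containing all such
    commutators, and perfectness concludes.

    What happens next depends on the group. The elements of [T] and [V] are
    products of two elements trivial on nonempty open sets; hence such a member
    [K] is everything if it moves [x0] ([whole_of_moves]). Otherwise it lies
    between the group of elements trivial near [x0] and the stabilizer of [x0], and
    then minimality of the action forces the URS to contain the stabilizers of
    all continuity points ([URS_classification]). In [F] commutators are trivial
    near the base point, so [K] contains the derived subgroup and is normal; in
    the derived subgroup of [F] all elements are trivial near the base point, so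
    [K] is everything.

    The assumptions are verified with binary words. An element of [V] or [T]
    maps all sufficiently small cylinders, or dyadic intervals, canonically to
    cylinders, or dyadic intervals. The interplay of an element with two finite
    binary trees is the same for both groups ([carry_trees]), and rotations
    bring trees to a normal form ([carries_to_comb]). Perfectness therefore
    reduces to showing that rotations are products of commutators: in [V] they
    are products of swaps of cylinders, and a swap is a commutator
    ([swap_in_commutators]); in [T] this follows from the pentagon relation
    ([rotation_commutator]). *)

Set Implicit Arguments.
Unset Strict Implicit.
Unset Printing Implicit Defensive.

Import Order.TTheory GRing.Theory Num.Theory.
Import numFieldNormedType.Exports.

Local Open Scope classical_set_scope.
Local Open Scope group_scope.

(** * The topology on the space of subgroups *)

Section SubGTopology.
Variable G : groupType.
Implicit Types (H K : SubG G) (g : G) (U : set (SubG G)).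

Lemma mem_sub1 H : 1 \in mem_sub H.
Proof. by case: (mem_sub_closed H). Qed.

Lemma mem_subV H g : g \in mem_sub H -> g^-1 \in mem_sub H.
Proof. by move=> gH; rewrite -div1g sub_divg// mem_sub1. Qed.

Lemma mem_subM H g k : g \in mem_sub H -> k \in mem_sub H ->
  g * k \in mem_sub H.
Proof. by move=> gH kH; rewrite -[k]invgK sub_divg// mem_subV. Qed.

Lemma mem_conj_sub g H x : (x \in mem_sub (conj_sub g H)) = (x ^ g \in mem_sub H).
Proof. by rewrite mem_mkSub asboolb. Qed.

Lemma SubG_cvgP (F : set_system (SubG G)) H : Filter F ->
  (F --> H) <-> (forall g, F [set K | (g \in mem_sub K) = (g \in mem_sub H)]).
Proof.
move=> FF; split=> [FH g|FH].
  apply: FH.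
  have cv : {for H, continuous (fun K : SubG G => \val K)}.
    exact: (@initial_continuous _ _ set_val).
  have cg := @proj_continuous G (fun=> bool) g (\val H).
  have := cvg_comp _ _ cv cg.
  move=> /(_ [set b | b = (g \in mem_sub H)]); apply.
  by rewrite nbhs_principalE.
move=> A [_ [[B oB <-] BH BA]].
apply: filterS BA _.
have : (fmap (fun K : SubG G => \val K) F) --> \val H.
  apply/cvg_sup => g C [_ [[b ob <-] bH bC]].
  apply: filterS bC _ => /=.
  change (F [set K | b (\val K g)]).
  by apply: filterS (FH g) => K /= e; rewrite (e : \val K g = \val H g).
by apply; apply: open_nbhs_nbhs.
Qed.

Lemma nbhs_mem_sub H g :
  nbhs H [set K | (g \in mem_sub K) = (g \in mem_sub H)].
Proof. by move: g; apply/(@SubG_cvgP (nbhs H)) => //; exact: cvg_id. Qed.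

Lemma nbhs_SubGP H (A : set (SubG G)) : nbhs H A <-> exists Q : seq G,
  forall K, {in Q, mem_sub K =i mem_sub H} -> A K.
Proof.
split=> [HA|[Q QA]]; last first.
  apply: filterS QA _ => /=; elim: Q => [|g Q IH].
    by apply: filterE => K g.
  apply: filterS2 (nbhs_mem_sub H g) IH => K gK QK k.
  by rewrite inE => /predU1P[->|/QK].
pose F : set_system (SubG G) := [set B | exists Q : seq G,
  forall K, {in Q, mem_sub K =i mem_sub H} -> B K].
have FF : Filter F.
  split=> [|B C [P PB] [Q QC]|B C BC [P PB]]; first by exists [::].
    exists (P ++ Q) => K PQK; split.
      by apply: PB => g gP; apply: PQK; rewrite mem_cat gP.
    by apply: QC => g gQ; apply: PQK; rewrite mem_cat gQ orbT.
  by exists P => K /PB /BC.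
suff : F --> H by apply.
by apply/SubG_cvgP => g; exists [:: g] => K; apply; rewrite inE.
Qed.

Lemma closed_SubGP U H : closed U ->
  (forall Q : seq G, exists2 K, U K & {in Q, mem_sub K =i mem_sub H}) -> U H.
Proof.
move=> cU UQ; apply: cU => A /nbhs_SubGP[Q QA].
by have [K UK /QA AK] := UQ Q; exists K.
Qed.

Lemma closure_SubGP U H : closure U H ->
  forall Q : seq G, exists2 K, U K & {in Q, mem_sub K =i mem_sub H}.
Proof.
move=> cUH Q; have [|K [UK KQ]] := cUH [set K | {in Q, mem_sub K =i mem_sub H}].
  by apply/nbhs_SubGP; exists Q.
by exists K.
Qed.

(** An ultrafilter of subgroups converges to the subgroup of the elements that
    belong to almost all of them. *)
Lemma SubG_compact : compact [set: SubG G].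
Proof.
rewrite compact_ultra => F UF _.
pose P := [set g : G | F [set K | g \in mem_sub K]].
have P1 : P 1 by apply: filterE => K; exact: mem_sub1.
have PF x y : P x -> P y -> P (x / y).
  by move=> Px Py; apply: filterS2 Px Py => K; exact: sub_divg.
exists (mk_subG (set_group_closed P1 PF)); split=> //.
apply/SubG_cvgP => g.
have [Fg|Fg] := in_ultra_setVsetC [set K : SubG G | g \in mem_sub K] UF.
  by apply: filterS (Fg) => K /= ->; rewrite mem_mkSub; apply/esym/asboolP.
apply: filterS (Fg) => K /= /negP/negbTE ->; rewrite mem_mkSub.
apply/esym/asboolPn => Pg.
have FI : F ([set K | g \in mem_sub K] `&` ~` [set K | g \in mem_sub K]).
  exact: filterI.
have [K' [/= gK gK']] := filter_ex FI.
exact: gK'.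
Qed.

(** The members containing larger and larger finite parts of [S] form a filter
    base, and a cluster point of it contains all of [S]. *)
Lemma closed_family_contains U (S : set G) : closed U ->
  (forall Q : seq G, (forall g, g \in Q -> S g) ->
     exists2 K, U K & forall g, g \in Q -> g \in mem_sub K) ->
  exists2 K, U K & forall g, S g -> g \in mem_sub K.
Proof.
move=> cU UQ.
pose A (Q : seq G) := [set K | U K /\ forall g, g \in Q -> g \in mem_sub K].
pose D := [set Q : seq G | forall g, g \in Q -> S g].
pose F := filter_from D A.
have FF : ProperFilter F.
  apply: filter_from_proper; first apply: filter_from_filter.
  - by exists [::].
  - move=> P Q DP DQ; exists (P ++ Q).
      by move=> g; rewrite mem_cat => /orP[/DP|/DQ].
    move=> K [UK PQK]; split; split=> // g gPQ; apply: PQK.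
      by rewrite mem_cat gPQ.
    by rewrite mem_cat gPQ orbT.
  - by move=> Q /UQ[K UK QK]; exists K.
have [K [_ FK]] := SubG_compact _ (filterT : F setT).
exists K => [|g Sg].
  apply: cU => B nB; have [|L [[UL _] BL]] := FK (A [::]) B _ nB.
    by exists [::].
  by exists L.
have [|L [[_ QL] /= <-]] := FK (A [:: g]) _ _ (nbhs_mem_sub K g).
  by exists [:: g] => // h; rewrite inE => /eqP ->.
by apply: QL; rewrite inE.
Qed.

Lemma closed_sub1 H : closed [set H].
Proof.
move=> K /closure_SubGP clK; apply: subG_ext => g.
by have [L -> ->] := clK [:: g]; rewrite // inE.
Qed.

Lemma normal_URS (N : SubG G) : normal_sub N -> is_URS [set N].
Proof.
move=> nN; split; first by exists N.
- exact: closed_sub1.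
- by move=> g H ->; exact: nN.
- move=> W WN [H WH] _ _; rewrite eqEsubset; split=> // K ->.
  by rewrite -(WN _ WH).
Qed.

Lemma URS_normal U (N : SubG G) : is_URS U -> normal_sub N -> U N -> U = [set N].
Proof.
move=> [_ _ _ minU] nN UN; apply/esym/minU; first by move=> _ ->.
- by exists N.
- exact: closed_sub1.
- by move=> g H ->; exact: nN.
Qed.

Lemma trivial_sub_normal : normal_sub (trivial_sub G).
Proof.
move=> g; apply: subG_ext => x; rewrite mem_conj_sub !mem_mkSub.
by apply/asboolP/asboolP => /= [/eqP|->]; rewrite ?conj1g// conjg_eq1 => /eqP.
Qed.

Lemma mem_whole_sub g : g \in mem_sub (whole_sub G).
Proof. by rewrite mem_mkSub; apply/asboolP. Qed.

Lemma whole_sub_normal : normal_sub (whole_sub G).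
Proof.
by move=> g; apply: subG_ext => x; rewrite mem_conj_sub !mem_whole_sub.
Qed.

(** Members of a closed family that avoids the trivial subgroup are uniformly
    nontrivial: a basic neighbourhood of the trivial subgroup excludes
    finitely many elements. *)
Lemma URS_confined U : is_URS U -> U <> [set trivial_sub G] ->
  exists P : seq G, (forall g, g \in P -> g <> 1) /\
    forall K, U K -> exists2 g, g \in P & g \in mem_sub K.
Proof.
move=> URSU nU.
have nU1 : ~ U (trivial_sub G).
  by move=> /(URS_normal URSU trivial_sub_normal).
apply: contrapT => nP; apply: nU1; case: URSU => _ cU _ _.
apply: (closed_SubGP cU) => Q; apply: contrapT => nK; apply: nP.
exists [seq g <- Q | g != 1]; split.
  by move=> g; rewrite mem_filter => /andP[/eqP].
move=> K UK; apply: contrapT => nKQ; apply: nK; exists K => // g gQ.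
rewrite mem_mkSub; apply/idP/asboolP => [gK|->]; last exact: mem_sub1.
apply: contrapT => g1; apply: nKQ; exists g => //.
by rewrite mem_filter gQ andbT; apply/eqP.
Qed.

End SubGTopology.

(** * Transversals and generic open sets *)

Section AvoidingTransversal.
Variables (n M : nat) (u : bool -> 'I_n -> 'I_M -> 'I_n -> 'I_M).

(** A uniformly random [t] satisfies one of the [2 * n * n] forbidden equations
    with probability at most [1 / M] each, since [t j] is independent of [t i]. Here
    [n] counts colours and [M] counts the positions available to each of them. *)
Lemma avoiding_transversal : (n * n * 2 < M)%N ->
  exists t : {ffun 'I_n -> 'I_M},
    forall b i j, j != i -> t j != u b i (t i) j.
Proof.
move=> nM.
pose bad (x : 'I_n * 'I_n * bool) := [set t : {ffun 'I_n -> 'I_M} |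
  (x.1.2 != x.1.1) && (t x.1.2 == u x.2 x.1.1 (t x.1.1) x.1.2)]%SET.
pose T := #|{ffun 'I_n -> 'I_M}|.
have T0 : (0 < T)%N.
  apply/card_gt0P; have M0 : (0 < M)%N by apply: leq_ltn_trans nM.
  by exists [ffun=> Ordinal M0].
have badM x : (#|bad x| * M <= T)%N.
  case: x => -[i j] b; rewrite -[M in (_ * M)%N]card_ord -cardsT -cardsX.
  pose upd (p : {ffun 'I_n -> 'I_M} * 'I_M) :=
    [ffun k => if k == j then p.2 else p.1 k].
  rewrite -(@card_in_imset _ _ upd); first exact: max_card.
  move=> [t s] [t' s'] /setXP[/= + _] /setXP[/= + _].
  rewrite !inE /= => /andP[ji /eqP tj] /andP[_ /eqP t'j] /ffunP e.
  have tt' k : k != j -> t k = t' k.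
    by move=> kj; have := e k; rewrite !ffunE (negbTE kj).
  have -> : s = s' by have := e j; rewrite !ffunE eqxx.
  congr pair; apply/ffunP => k; have [->|] := eqVneq k j; last exact: tt'.
  by rewrite tj t'j tt'// eq_sym.
have sumbad : ((\sum_x #|bad x|) * M <= n * n * 2 * T)%N.
  rewrite big_distrl /= (leq_trans (leq_sum _ (fun x _ => badM x)))//.
  by rewrite sum_nat_const !card_prod !card_ord card_bool.
have bad_lt : (\sum_x #|bad x| < T)%N.
  rewrite -(@ltn_pmul2r M) ?(leq_ltn_trans _ nM)//.
  by rewrite (leq_ltn_trans sumbad)// mulnC ltn_pmul2l.
have : ~~ ([set: {ffun 'I_n -> 'I_M}] \subset \bigcup_x bad x)%SET.
  apply/negP => /subset_leq_card; rewrite cardsT leqNgt => /negP; apply.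
  apply: leq_ltn_trans bad_lt.
  elim/big_ind2: _ => [|x1 x2 y1 y2 x12 y12|//]; first by rewrite cards0.
  by rewrite (leq_trans (leq_card_setU _ _))// leq_add.
move=> /subsetPn[t _ tbad]; exists t => b i j ji.
apply: contra tbad => tj; apply/bigcupP; exists (i, j, b) => //.
by rewrite inE /= ji.
Qed.

End AvoidingTransversal.

Definition no_isolated_point (X : topologicalType) :=
  forall (O : set X) x, open O -> O x -> exists2 y, O y & y != x.

Section GenericPoints.
Variable X : topologicalType.
Hypothesis hX : hausdorff_space X.
Hypothesis perfX : no_isolated_point X.
Implicit Types (O : set X) (g : homeo X).

Lemma separating_pair (x y : X) : x != y -> exists A B : set X,
  [/\ nbhs x A, nbhs y B & forall p, A p -> ~ B p].
Proof.
have := hX; rewrite open_hausdorff => /[apply] -[[A B] /= [xA yB] [oA oB AB]].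
exists A, B; split.
- by apply: open_nbhs_nbhs; split=> //; exact: set_mem.
- by apply: open_nbhs_nbhs; split=> //; exact: set_mem.
- move=> p Ap Bp; have : (A `&` B) p by [].
  by rewrite (eqP AB).
Qed.

Lemma open_moved g : open [set p | g p != p].
Proof.
rewrite openE => p /= gp; rewrite /interior.
have [A [B [nA nB AB]]] := separating_pair gp.
have cg : nbhs p (g @^-1` A) by apply: homeo_continuous.
by apply: filterS2 cg nB => q Aq Bq; apply/eqP => gq; apply: AB Aq _; rewrite gq.
Qed.

Lemma open_avoid O (zs : seq X) : open O -> O !=set0 ->
  exists2 x, O x & x \notin zs.
Proof.
have hX1 : accessible_space X by exact: hausdorff_accessible.
elim: zs O => [|z zs IH] O oO [x Ox]; first by exists x.
have oOz : open (O `\ z).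
  rewrite setDE; apply: openI => //; rewrite openC.
  exact: accessible_closed_set1.
have [y Oy yz] : exists2 y, O y & y != z.
  have [->|xz] := eqVneq z x; first exact: perfX.
  by exists x => //; rewrite eq_sym.
have [|w [Ow wz] wzs] := IH _ oOz; first by exists y; split=> //; exact/eqP.
by exists w => //; rewrite inE negb_or wzs andbT; apply/eqP.
Qed.

Lemma shrink_fixed_or_moved (gs : seq (homeo X)) O : open O -> O !=set0 ->
  exists W, [/\ open W, W !=set0, W `<=` O & forall g, g \in gs ->
    (forall p, W p -> g p = p) \/ (forall p, W p -> g p != p)].
Proof.
elim: gs O => [|g gs IH] O oO O0; first by exists O; split.
have [fixg|] := pselect (forall p, O p -> g p = p).
  have [W [oW W0 sO' Wgs]] := IH O oO O0; exists W; split=> // h.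
  rewrite inE => /predU1P[->|/Wgs//]; left=> p /sO'; exact: fixg.
move=> /existsNP[p /not_implyP[Op /eqP gp]].
have [||W [oW W0 sO' Wgs]] := IH (O `&` [set p | g p != p]).
- by apply: openI => //; exact: open_moved.
- by exists p.
exists W; split=> //; first by move=> q /sO'[].
move=> h; rewrite inE => /predU1P[->|/Wgs//]; right=> q /sO'[] //.
Qed.

(** Shrinking an open set on which [g] moves every point makes each member of
    [gs] either trivial on it or without fixed points in it. *)
Lemma generic_point (gs : seq (homeo X)) g (zs : seq X) : g <> 1 ->
  exists x, [/\ g x != x, x \notin zs & forall h, h \in gs ->
    h x = x -> \forall p \near x, h p = p].
Proof.
move=> g1; have [p gp] : exists p, g p != p.
  apply: contrapT => ng; apply: g1; apply: homeoP => p /=.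
  by apply: contrapT => /eqP gp; apply: ng; exists p.
have [||O [oO O0 sO Ogs]] := @shrink_fixed_or_moved gs [set p | g p != p].
- exact: open_moved.
- by exists p.
have [x Ox xzs] := open_avoid zs oO O0.
exists x; split=> //; first exact: sO.
move=> h /Ogs[fixh _|movh /eqP]; last by rewrite (negbTE (movh _ Ox)).
by apply: filterS fixh _; apply: open_nbhs_nbhs.
Qed.

(** The points are chosen one after the other, each outside the finite set of
    images and preimages of the earlier ones. *)
Lemma generic_points (I : finType) (gs : seq (homeo X)) (k : I -> homeo X) :
  (forall a, k a <> 1) -> exists x : I -> X,
    (forall a, k a (x a) != x a /\ forall h, h \in gs ->
        h (x a) = x a -> \forall p \near x a, h p = p) /\
    (forall a b, a != b -> x a != x b /\ forall h, h \in gs -> h (x a) != x b).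
Proof.
move=> k1.
suff [x [x1 x2]] : exists x : I -> X,
    (forall a, a \in enum I -> k a (x a) != x a /\ forall h, h \in gs ->
        h (x a) = x a -> \forall p \near x a, h p = p) /\
    (forall a b, a \in enum I -> b \in enum I ->
        a != b -> x a != x b /\ forall h, h \in gs -> h (x a) != x b).
  by exists x; split=> [a|a b ab]; [apply: x1|apply: x2]; rewrite ?mem_enum.
have : uniq (enum I) by exact: enum_uniq.
elim: (enum I) => [_|a s IH /= /andP[as_ /IH{IH}[x [x1 x2]]]].
  have [a0|nI] := pselect (exists a : I, True); last first.
    by exists (fun a => False_rect X (nI (ex_intro _ a Logic.I))); split.
  have [a _] := a0; have [x _] := @generic_point [::] (k a) [::] (k1 a).
  by exists (fun=> x); split.
pose zs := [seq x b | b <- s] ++ [seq (h : homeo X) (x b) | h <- gs, b <- s] ++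
  [seq homeo_inv h (x b) | h <- gs, b <- s].
have [y [ky yzs ygs]] := generic_point gs zs (k1 a).
have [yx yhx yhVx] : [/\ forall b, b \in s -> y != x b,
    forall (h : homeo X) b, h \in gs -> b \in s -> h (x b) != y &
    forall (h : homeo X) b, h \in gs -> b \in s -> h y != x b].
  move: yzs; rewrite !mem_cat !negb_or => /and3P[n1 n2 n3]; split.
  - by move=> b bs; apply: contra n1 => /eqP ->; exact: map_f.
  - by move=> h b hgs bs; apply: contra n2 => /eqP <-; exact: allpairs_f.
  - move=> h b hgs bs; apply: contra n3 => /eqP e.
    by apply/allpairsP; exists (h, b); split=> //=; rewrite -e homeoK.
exists (fun b => if b == a then y else x b); split.
  move=> b; rewrite inE; have [-> _|ba /= bs] := eqVneq b a; first by split.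
  exact: x1.
move=> b c; rewrite !inE.
have [->|ba] := eqVneq b a; have [->|ca] := eqVneq c a => //=.
- by move=> _ cs _; split; [exact: yx|move=> h hgs; exact: yhVx].
- by move=> bs _ _; split=> [|h hgs]; [rewrite eq_sym; exact: yx|exact: yhx].
- exact: x2.
Qed.

Lemma separating_nbhds (zs : seq X) : exists O : X -> set X,
  (forall z, nbhs z (O z)) /\
  (forall z z' p, z \in zs -> z' \in zs -> z != z' -> O z p -> ~ O z' p).
Proof.
have /choice[AB ABP] (zz : X * X) : exists AB : set X * set X,
    zz.1 != zz.2 -> [/\ nbhs zz.1 AB.1, nbhs zz.2 AB.2 &
      forall p, AB.1 p -> ~ AB.2 p].
  have [e|ne] := eqVneq zz.1 zz.2; first by exists (set0, set0).
  by have [A [B ABP]] := separating_pair ne; exists (A, B).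
exists (fun z => [set p | forall z', z' \in zs -> z' != z ->
  (AB (z, z')).1 p /\ (AB (z', z)).2 p]); split.
  move=> z; elim: zs => [|w zs IH]; first by apply: filterE.
  have [->|wz] := eqVneq w z.
    apply: filterS IH => p H z'; rewrite inE => /predU1P[->|/H//].
    by rewrite eqxx.
  have zw : z != w by rewrite eq_sym.
  have [n1 _ _] := ABP (z, w) zw; have [_ n2 _] := ABP (w, z) wz.
  apply: filterS3 IH n1 n2 => p H p1 p2 z'.
  by rewrite inE => /predU1P[->|/H].
move=> z z' p zzs z'zs zz' Hz Hz'.
have [|Ap _] := Hz z' z'zs; first by rewrite eq_sym.
have [_ Bp] := Hz' z zzs zz'.
by have [_ _] := ABP (z, z') zz'; apply; first exact: Ap.
Qed.

(** At generic points the alternative between being fixed and being moved is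
    stable, so continuity spreads it to small open sets around them. *)
Lemma generic_opens (I : finType) (gs : seq (homeo X)) (k : I -> homeo X) :
  (forall a, k a \in gs) -> (forall a, k a <> 1) ->
  exists U : I -> set X,
    [/\ forall a, open (U a) /\ U a !=set0,
        forall a b p, U a p -> U b p -> a = b,
        forall g a, g \in gs -> (forall p, U a p -> g p = p) \/
          (forall b p, U a p -> ~ U b (g p)) &
        forall a b p, U a p -> ~ U b (k a p)].
Proof.
move=> kgs k1; have [x [x1 x2]] := generic_points gs k1.
pose zs := [seq x a | a <- enum I] ++ [seq (h : homeo X) (x a) | h <- gs, a <- enum I].
have [ O [nO disjO]] := separating_nbhds zs.
have xzs a : x a \in zs by rewrite mem_cat map_f// mem_enum.
have gxzs (g : homeo X) a : g \in gs -> g (x a) \in zs.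
  move=> ggs; rewrite mem_cat; apply/orP; right.
  by apply: (allpairs_f (fun (g : homeo X) a => g (x a))); rewrite ?mem_enum.
pose N a := [set p | O (x a) p /\ forall g, g \in gs ->
  O (g (x a)) (g p) /\ (g (x a) = x a -> g p = p)].
have nN a : nbhs (x a) (N a).
  apply: filterI; first exact: nO.
  have [_ loc] := x1 a.
  have : {subset gs <= gs} by [].
  elim: {1 3}gs => [|g s IH sgs]; first by move=> _; apply: filterE.
  have ggs : g \in gs by apply: sgs; rewrite mem_head.
  have {}IH := IH (fun h hs => sgs h (mem_behead (s := g :: s) hs)).
  have n1 : nbhs (x a) (g @^-1` O (g (x a))).
    by apply: homeo_continuous; exact: nO.
  have n2 : \forall p \near x a, g (x a) = x a -> g p = p.
    have [e|ne] := eqVneq (g (x a)) (x a); last first.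
      by apply: filterE => p e; rewrite e eqxx in ne.
    by apply: filterS (loc g ggs e) => p.
  apply: filterS3 IH n1 n2 => p H p1 p2 h.
  by rewrite inE => /predU1P[->|/H].
have NE a p : (N a)^° p -> N a p by exact: interior_subset.
have moveN g a b p : g \in gs -> g (x a) != x a -> N a p -> ~ N b (g p).
  move=> ggs gxa [_ /(_ g ggs)[Op _]] [Ob _].
  apply: disjO Op Ob; rewrite ?gxzs//.
  by have [<-//|ab] := eqVneq a b; exact: (x2 a b ab).2.
exists (fun a => (N a)^°); split.
- by move=> a; split; [exact: open_interior|exists (x a); exact: nN].
- move=> a b p /NE[Oa _] /NE[Ob _]; apply: contrapT => /eqP ab.
  by apply: disjO Oa Ob; rewrite ?xzs//; exact: (x2 a b ab).1.
- move=> g a ggs; have [e|ne] := eqVneq (g (x a)) (x a).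
    by left=> p /NE[_ /(_ g ggs)[_]]; apply.
  by right=> b p /NE Na /NE; exact: moveN Na.
- by move=> a b p /NE Na /NE; apply: moveN Na; [exact: kgs|exact: (x1 a).1].
Qed.

End GenericPoints.

(** * Commutators of differences of conjugates *)

Section Supports.
Variables (G : groupType) (X : topologicalType).
Variable phi : {multiplicative G -> homeo X}.
Implicit Types (g h : G) (V : set X) (p : X).

Lemma actM g h p : phi (g * h) p = phi g (phi h p).
Proof. by rewrite gmulfM homeoM. Qed.

Lemma act1 p : phi 1 p = p.
Proof.
suff -> : phi 1 = 1 by [].
by apply: (@mulgI _ (phi 1)); rewrite -gmulfM !mulg1.
Qed.

Lemma actK g : cancel (phi g) (phi g^-1).
Proof. by move=> p; rewrite -actM mulVg act1. Qed.

Lemma actVK g : cancel (phi g^-1) (phi g).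
Proof. by move=> p; rewrite -actM mulgV act1. Qed.

Lemma act_inj g : injective (phi g).
Proof. exact: can_inj (actK g). Qed.

Lemma act_continuous g : continuous (phi g).
Proof. exact: homeo_continuous. Qed.

Definition supported g V := forall p, ~ V p -> phi g p = p.

Lemma supported1 V : supported 1 V.
Proof. by move=> p _; rewrite act1. Qed.

Lemma supportedM g h V : supported g V -> supported h V -> supported (g * h) V.
Proof. by move=> sg sh p Vp; rewrite actM sh// sg. Qed.

Lemma supportedV g V : supported g V -> supported g^-1 V.
Proof. by move=> sg p Vp; apply: (@act_inj g); rewrite actVK sg. Qed.

Lemma supported_stable g V p : supported g V -> V p -> V (phi g p).
Proof.
move=> sg Vp; apply: contrapT => nV; apply: (nV).
by have /act_inj -> := sg _ nV.
Qed.

Lemma supported_conj g c V W : supported g V -> (forall p, V p -> W (phi c p)) ->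
  supported (g ^ c^-1) W.
Proof.
move=> sg VW p Wp; rewrite conjgE invgK !actM sg ?actVK// => Vc.
by apply: Wp; have := VW _ Vc; rewrite actVK.
Qed.

Section DisjointProduct.
Variables (I : eqType) (h : I -> G) (V : I -> set X).
Hypothesis hV : forall i, supported (h i) (V i).

Lemma act_prod_off (s : seq I) p : (forall i, i \in s -> ~ V i p) ->
  phi (\prod_(i <- s) h i) p = p.
Proof.
elim: s => [|i s IH] Vp; first by rewrite big_nil act1.
rewrite big_cons actM IH ?hV//; first by apply: Vp; rewrite mem_head.
by move=> j js; apply: Vp; rewrite inE js orbT.
Qed.

Lemma act_prod_on (s : seq I) i p : uniq s -> i \in s ->
  (forall j q, j != i -> V i q -> ~ V j q) -> V i p ->
  phi (\prod_(j <- s) h j) p = phi (h i) p.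
Proof.
move=> + + disj Vp; elim: s => //= j s IH /andP[js us].
rewrite inE big_cons actM => /predU1P[ij|is_].
  subst j; rewrite act_prod_off// => k ks; apply: disj => //.
  by apply: contraNneq js => <-.
rewrite IH// hV//; apply: disj; last exact: supported_stable.
by apply: contraNneq js => ->.
Qed.

End DisjointProduct.
End Supports.

Section DisplacedPatches.
Variables (G : groupType) (X : topologicalType).
Variable phi : {multiplicative G -> homeo X}.
Hypothesis phi_inj : injective phi.
Variables (A : eqType) (U : A -> set X).
Hypothesis disjU : forall a b p, U a p -> U b p -> a = b.

(** Members of a confined subgroup are found by conjugating with products of
    elements supported in disjoint sets; keeping track of the factors [l] allows
    one to compute commutators one set at a time. *)
Definition patched (x : G) (l : A -> G) :=
  [/\ forall a, supported phi (l a) (U a),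
      forall a p, U a p -> phi x p = phi (l a) p &
      forall p, (forall a, ~ U a p) -> phi x p = p].

Lemma patched_stable x l a p : patched x l -> U a p -> U a (phi x p).
Proof.
by move=> [ls lE _] Uap; rewrite (lE a)//; apply: supported_stable.
Qed.

Lemma patchedM x l x' l' : patched x l -> patched x' l' ->
  patched (x * x') (fun a => l a * l' a).
Proof.
move=> px px'; have [ls lE lO] := px; have [ls' lE' lO'] := px'; split.
- by move=> a; apply: supportedM.
- move=> a p Uap; rewrite !actM (lE a); last exact: patched_stable px' Uap.
  by rewrite (lE' a).
- by move=> p Op; rewrite actM lO' ?lO.
Qed.

Lemma patchedV x l : patched x l -> patched x^-1 (fun a => (l a)^-1).
Proof.
move=> [ls lE lO]; split.
- by move=> a; apply: supportedV.
- move=> a p Uap; apply: (@act_inj _ _ phi x); rewrite actVK (lE a) ?actVK//.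
  by apply: supported_stable Uap; exact: supportedV.
- by move=> p Op; apply: (@act_inj _ _ phi x); rewrite actVK lO.
Qed.

Section Difference.
Variable g : G.
Hypothesis dichg : forall a, (forall p, U a p -> phi g p = p) \/
  (forall b p, U a p -> ~ U b (phi g p)).

Let moved a := forall b p, U a p -> ~ U b (phi g p).

Variables (x y : G) (l m : A -> G).
Hypotheses (px : patched x l) (py : patched y m).

Definition conj_diff := (g ^ x) * (g ^ y)^-1.

Lemma conj_diffE p :
  phi conj_diff p = phi x^-1 (phi g (phi (x * y^-1) (phi g^-1 (phi y p)))).
Proof. by rewrite /conj_diff !conjgE !invgM invgK !actM. Qed.

Lemma moved_inverse a b p : moved a -> U a p -> ~ U b (phi g^-1 p).
Proof.
move=> mova Uap Ubp; have [fixb|movb] := dichg b.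
  have e : p = phi g^-1 p by rewrite -[in LHS](actVK phi g p) fixb.
  rewrite -e in Ubp; have ab := disjU Uap Ubp; subst b.
  by apply: (mova a p Uap); rewrite fixb.
by apply: (movb a _ Ubp); rewrite actVK.
Qed.

Lemma conj_diff_fixed a p : (forall q, U a q -> phi g q = q) -> U a p ->
  phi conj_diff p = p.
Proof.
move=> fixa Uap; have fixVa q : U a q -> phi g^-1 q = q.
  by move=> Uaq; apply: (@act_inj _ _ phi g); rewrite actVK fixa.
have Uy := patched_stable py Uap.
rewrite conj_diffE fixVa// fixa; last first.
  by apply: patched_stable Uy; apply: patchedM px (patchedV py).
by rewrite (actM _ x) !actK.
Qed.

Lemma conj_diff_on a p : moved a -> U a p ->
  phi conj_diff p = phi ((l a)^-1 * m a) p.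
Proof.
move=> mova Uap; have Uy := patched_stable py Uap.
have [_ _ dO] := patchedM px (patchedV py).
rewrite conj_diffE dO; last by move=> b; exact: moved_inverse Uy.
rewrite actVK actM; have [_ /(_ a) lE _] := patchedV px.
by have [_ mE _] := py; rewrite lE// (mE a).
Qed.

Lemma conj_diff_image a p : moved a -> (forall b, ~ U b p) ->
  U a (phi g^-1 p) ->
  phi conj_diff p = phi g (phi (l a * (m a)^-1) (phi g^-1 p)).
Proof.
move=> mova Op Uap; have [_ _ yO] := py.
have pd := patchedM px (patchedV py).
rewrite conj_diffE yO//; have [_ _ ->] := patchedV px.
  by have [_ /(_ a) -> //] := pd.
by move=> b; apply: mova; exact: patched_stable pd Uap.
Qed.

Lemma conj_diff_off p : (forall b, ~ U b p) -> (forall b, ~ U b (phi g^-1 p)) ->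
  phi conj_diff p = p.
Proof.
move=> Op Ogp; have [_ _ yO] := py.
have [_ _ dO] := patchedM px (patchedV py).
rewrite conj_diffE yO// dO// actVK.
by have [_ _ ->] := patchedV px.
Qed.

End Difference.

(** On a moved patch, a difference of conjugates acts as [l^-1 * m]; on the
    image of the patch, it acts as a conjugate of [l * m^-1]. Two such
    differences with disjoint variation outside the patch [a0] therefore have a
    commutator that lives on [a0] and on its image, and the choice of the four
    local factors on [a0] makes the second component vanish. *)
Lemma conj_diff_commutator (g : G) (a0 : A) (x1 x2 x3 x4 : G)
    (l1 l2 l3 l4 : A -> G) (a b y : G) :
  (forall a, (forall p, U a p -> phi g p = p) \/
     (forall b p, U a p -> ~ U b (phi g p))) ->
  (forall b p, U a0 p -> ~ U b (phi g p)) ->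
  patched x1 l1 -> patched x2 l2 -> patched x3 l3 -> patched x4 l4 ->
  (forall c, c != a0 -> (l1 c = 1 /\ l2 c = 1) \/ (l3 c = 1 /\ l4 c = 1)) ->
  l1 a0 = 1 -> l2 a0 = a -> l3 a0 = y -> l4 a0 = y * b ->
  commute a (y * b * y^-1) ->
  let k1 := conj_diff g x1 x2 in let k2 := conj_diff g x3 x4 in
  [~ a^-1, b^-1] = k1 * k2 * (k2 * k1)^-1.
Proof.
move=> dich mov0 p1 p2 p3 p4 other e1 e2 e3 e4 comm_ab k1 k2.
have sa : supported phi a (U a0) by rewrite -e2; case: p2.
have sb : supported phi b (U a0).
  rewrite -[b](mulKg y) -e4 -e3; apply: supportedM; last by case: p4.
  by apply: supportedV; case: p3.
suff -> : k1 * k2 = [~ a^-1, b^-1] * (k2 * k1) by rewrite mulgK.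
apply: phi_inj; apply: homeoP => p.
have sK : supported phi [~ a^-1, b^-1] (U a0).
  rewrite commgEl conjgE !invgK.
  by do ?[apply: supportedM|apply: supportedV].
have E1 : phi (k1 * k2) p = phi k1 (phi k2 p) by exact: actM.
have E2 : phi ([~ a^-1, b^-1] * (k2 * k1)) p =
    phi [~ a^-1, b^-1] (phi k2 (phi k1 p)) by rewrite actM (actM _ k2).
rewrite {}E1 {}E2.
have [[c Ucp]|] := pselect (exists c, U c p); last first.
  move=> nU; have Op c : ~ U c p by move=> Ucp; apply: nU; exists c.
  have [[c Ucp]|] := pselect (exists c, U c (phi g^-1 p)); last first.
    move=> nUg; have Ogp c : ~ U c (phi g^-1 p) by move=> ?; apply: nUg; exists c.
    have k1p : phi k1 p = p by apply: conj_diff_off p1 p2 _ _ _.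
    have k2p : phi k2 p = p by apply: conj_diff_off p3 p4 _ _ _.
    by rewrite k1p k2p k1p sK.
  have movc : forall d q, U c q -> ~ U d (phi g q).
    have [fixc|//] := dich c; case: (Op c).
    by rewrite -[p](actVK phi g) fixc.
  have im z z' l l' : patched z l -> patched z' l' ->
      forall q, U c q -> phi (conj_diff g z z') (phi g q) =
                         phi g (phi (l c * (l' c)^-1) q).
    move=> pz pz' q Ucq; rewrite (conj_diff_image pz pz' movc) ?actK//.
    by move=> d; exact: movc.
  have st z z' l l' : patched z l -> patched z' l' ->
      forall q, U c q -> U c (phi (l c * (l' c)^-1) q).
    move=> [ls _ _] [ls' _ _] q Ucq; apply: supported_stable Ucq.
    by apply: supportedM => //; exact: supportedV.
  rewrite -[p](actVK phi g) (im _ _ _ _ p3 p4)// (im _ _ _ _ p1 p2)//; last first.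
    exact: st p3 p4 _ Ucp.
  rewrite (im _ _ _ _ p1 p2)// (im _ _ _ _ p3 p4)//; last exact: st p1 p2 _ Ucp.
  rewrite sK; last by move=> /(movc a0 _ _); apply; exact: st p3 p4 _ (st _ _ _ _ p1 p2 _ Ucp).
  congr (phi g _); rewrite -!actM; congr (phi (_ * _) _).
  have [->|/other[[-> ->]|[-> ->]]] := eqVneq c a0.
  - rewrite e1 e2 e3 e4 mul1g.
    have -> : y * (y * b)^-1 = (y * b * y^-1)^-1 by rewrite !invgM invgK mulgA.
    exact: (commuteV (commute_sym (commuteV (commute_sym comm_ab)))).
  - by rewrite invg1 !mulg1 mul1g.
  - by rewrite invg1 !mulg1 mul1g.
have [fixc|movc] := dich c.
  have k1p : phi k1 p = p by apply: conj_diff_fixed p1 p2 _ _ fixc Ucp.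
  have k2p : phi k2 p = p by apply: conj_diff_fixed p3 p4 _ _ fixc Ucp.
  rewrite k1p k2p k1p sK// => U0p.
  by have := mov0 a0 p U0p; rewrite -(disjU Ucp U0p) fixc.
have st z z' l l' : patched z l -> patched z' l' ->
    forall q, U c q -> U c (phi ((l c)^-1 * l' c) q).
  move=> [ls _ _] [ls' _ _] q Ucq; apply: supported_stable Ucq.
  by apply: supportedM => //; exact: supportedV.
rewrite (conj_diff_on dich p3 p4 movc)// (conj_diff_on dich p1 p2 movc)//; last first.
  exact: st p3 p4 _ Ucp.
rewrite (conj_diff_on dich p1 p2 movc)// (conj_diff_on dich p3 p4 movc)//; last first.
  exact: st p1 p2 _ Ucp.
have [c0|ca0] := eqVneq c a0.
  rewrite c0 e1 e2 e3 e4 invg1 mul1g mulKg -!actM; congr (phi _ _).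
  by rewrite [LHS]commgCV mulgA.
rewrite sK; last first.
  move=> /disjU /(_ (st _ _ _ _ p3 p4 _ (st _ _ _ _ p1 p2 _ Ucp))) /esym /eqP.
  by rewrite (negbTE ca0).
rewrite -!actM; congr (phi _ _).
by have [[-> ->]|[-> ->]] := other c ca0; rewrite invg1 !mulg1 ?mul1g.
Qed.

End DisplacedPatches.

(** * Confined subgroups *)

Section ConfinedSubgroups.
Variables (G : groupType) (X : topologicalType).
Variable phi : {multiplicative G -> homeo X}.
Hypothesis hX : hausdorff_space X.
Hypothesis perfX : no_isolated_point X.
Hypothesis phi_inj : injective phi.

(** Every conjugator [h] is coloured by an element [g] of [P] with [g ^ h] in
    [K]. The conjugators used are words with one letter for each colour, placed in
    one of many disjoint open sets. If no colour had a position where all letters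
    are available, a diagonal choice of letters and positions would give a word
    without colour. At such a position, four words of the same colour, with the
    letters [1], [a], [y] and [y * b], have differences of conjugates in [K] whose
    commutator is a conjugate of the wanted one. *)
Theorem confined_contains_commutators (K : SubG G) (P B : seq G) (E : set X)
    (y : G) :
  (forall g, g \in P -> g <> 1) ->
  (forall h, exists2 g, g \in P & g ^ h \in mem_sub K) ->
  (forall b, b \in B -> supported phi b E) -> supported phi y E ->
  (forall a b, a \in B -> b \in B -> commute a (y * b * y^-1)) ->
  (forall O, open O -> O !=set0 -> exists c, forall p, E p -> O (phi c p)) ->
  exists c, forall a b, a \in B -> b \in B ->
    [~ a^-1, b^-1] ^ c \in mem_sub K.
Proof.
move=> P1 conf sB sy commB small.
pose n := size P; pose M := (n * n * 2).+1.
pose gs (i : 'I_n) := nth 1 P i.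
have gsP i : gs i \in P by exact: mem_nth.
have {}conf h : exists i, gs i ^ h \in mem_sub K.
  have [g gP gK] := conf h; have iP : (index g P < n)%N by rewrite index_mem.
  by exists (Ordinal iP); rewrite /gs nth_index.
have phi1 : phi 1 = 1 by apply: homeoP => p; exact: act1.
have phi_gs1 i : phi (gs i) <> 1.
  by rewrite -phi1 => /phi_inj; apply: P1; exact: gsP.
have [|a|U [U0 disjU dichU movU]] := @generic_opens X hX perfX
    ('I_n * 'I_M)%type [seq phi g | g <- P] (fun a => phi (gs a.1)).
- by move=> a; exact: map_f.
- exact: phi_gs1.
have {}U0 a : exists c, forall p, E p -> U a (phi c p).
  by have [oU U1] := U0 a; exact: small.
have /choice[c cE] := U0.
(* A letter is supported in E; its copies live in the various sets U a. *)
pose letter a w := w ^ (c a)^-1.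
have sletter a w : supported phi w E -> supported phi (letter a w) (U a).
  by move=> sw; apply: supported_conj sw _; exact: cE.
pose word (w : 'I_n -> G) (t : 'I_n -> 'I_M) :=
  \prod_(i <- enum 'I_n) letter (i, t i) (w i).
pose loc (w : 'I_n -> G) (t : 'I_n -> 'I_M) (a : 'I_n * 'I_M) :=
  if t a.1 == a.2 then letter a (w a.1) else 1.
have patch w t : (forall i, supported phi (w i) E) ->
    patched phi U (word w t) (loc w t).
  move=> sw; have sl i : supported phi (letter (i, t i) (w i)) (U (i, t i)).
    exact: sletter.
  split.
  - move=> [i s]; rewrite /loc; case: eqP => [/= <-|_]; last exact: supported1.
    exact: sletter.
  - move=> [i s] p Up; rewrite /loc; case: eqP => /= ts.
      rewrite -ts in Up; rewrite -ts /word.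
      apply: (act_prod_on (V := fun i => U (i, t i))) => //.
      + exact: enum_uniq.
      + by rewrite mem_enum.
      + by move=> j q ji Uq /(disjU _ _ _ Uq)[ij _]; rewrite ij eqxx in ji.
    rewrite act1 /word (act_prod_off (V := fun i => U (i, t i)))// => j _ Uj.
    by have [ij st] := disjU _ _ _ Up Uj; apply: ts; rewrite ij.
  - by move=> p Op; rewrite /word (act_prod_off (V := fun i => U (i, t i))).
pose letters : seq G := 1 :: y :: B ++ [seq y * b | b <- B].
have slet w : w \in letters -> supported phi w E.
  rewrite !inE mem_cat => /or3P[/eqP ->|/eqP ->//|/orP[/sB//|/mapP[b bB ->]]].
    exact: supported1.
  by apply: supportedM => //; exact: sB.
(* Diagonal choice: a letter that is not rich at (i, s) is forbidden there for
   colour i, up to two tags in each other position. *)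
have [i [s rich]] : exists i s, forall w, w \in letters ->
    forall u : bool -> 'I_n -> 'I_M, exists w' t',
    [/\ forall j, w' j \in letters, gs i ^ word w' t' \in mem_sub K,
        w' i = w, t' i = s & forall b j, j != i -> t' j != u b j].
  apply: contrapT => norich.
  have /choice[wu wuP] (a : 'I_n * 'I_M) : exists wu : G * (bool -> 'I_n -> 'I_M),
      wu.1 \in letters /\ forall w' t', (forall j, w' j \in letters) ->
      gs a.1 ^ word w' t' \in mem_sub K -> w' a.1 = wu.1 -> t' a.1 = a.2 ->
      ~ (forall b j, j != a.1 -> t' j != wu.2 b j).
    apply: contrapT => nwu; apply: norich; exists a.1, a.2 => w wl u.
    apply: contrapT => nw; apply: nwu; exists (w, u); split=> // w' t' w'l w'K w'a t'a ne.
    by apply: nw; exists w', t'.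
  have [t tP] := @avoiding_transversal n M (fun b i s => (wu (i, s)).2 b) (ltnSn _).
  have [i iK] := conf (word (fun i => (wu (i, t i)).1) t).
  have [_ /(_ _ _ _ iK)] := wuP (i, t i); apply=> // [j|b j].
    by have [] := wuP (j, t j).
  by move=> ji; apply: tP.
exists (c (i, s))^-1 => a b aB bB.
have [w1 [t1 [l1 K1 w1i t1i _]]] := rich 1 (mem_head _ _) (fun _ _ => s).
have [|w2 [t2 [l2 K2 w2i t2i _]]] := rich a _ (fun _ _ => s).
  by rewrite !inE mem_cat aB !orbT.
have [|w3 [t3 [l3 K3 w3i t3i t3N]]] := rich y _ (fun b => if b then t1 else t2).
  by rewrite !inE eqxx orbT.
have [|w4 [t4 [l4 K4 w4i t4i t4N]]] := rich (y * b) _ (fun b => if b then t1 else t2).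
  by rewrite !inE mem_cat (map_f _ bB) !orbT.
have pt w t : (forall j, w j \in letters) -> patched phi U (word w t) (loc w t).
  by move=> wl; apply: patch => j; apply: slet.
have locE w t z : w i = z -> t i = s -> loc w t (i, s) = letter (i, s) z.
  by move=> wi ti; rewrite /loc /= ti eqxx wi.
have -> : [~ a^-1, b^-1] ^ (c (i, s))^-1 =
    [~ (letter (i, s) a)^-1, (letter (i, s) b)^-1].
  by rewrite conjRg !conjVg.
rewrite (@conj_diff_commutator _ _ _ phi_inj _ _ disjU (gs i) (i, s)
  _ _ _ _ _ _ _ _ (letter (i, s) a) (letter (i, s) b) (letter (i, s) y)
  _ _ (pt _ t1 l1) (pt _ t2 l2) (pt _ t3 l3) (pt _ t4 l4)).
- by apply: sub_divg; apply: mem_subM; apply: sub_divg.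
- by move=> d; apply: dichU; exact: map_f.
- by move=> d p; exact: (movU (i, s)).
- move=> [j r]; rewrite xpair_eqE negb_and /loc /=.
  have [-> /= rs|ji _] := eqVneq j i.
    by left; rewrite t1i t2i eq_sym (negbTE rs).
  have := t3N true j ji; have := t3N false j ji.
  have := t4N true j ji; have := t4N false j ji => /= n1 n2 n3 n4.
  have [e3|_] := eqVneq (t3 j) r.
    by left; rewrite -e3 eq_sym (negbTE n4) eq_sym (negbTE n3).
  have [e4|_] := eqVneq (t4 j) r; last by right.
  by left; rewrite -e4 eq_sym (negbTE n2) eq_sym (negbTE n1).
- by rewrite (locE _ _ 1)// /letter conj1g.
- exact: locE.
- exact: locE.
- by rewrite (locE _ _ (y * b))// /letter conjMg.
- rewrite /letter -conjVg -!conjMg /commute -!conjMg.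
  by congr (_ ^ _); exact: commB.
Qed.

End ConfinedSubgroups.

(** * Uniformly recurrent subgroups of groups of homeomorphisms *)

Section LocallyTrivial.
Variables (G : groupType) (X : topologicalType).
Variable phi : {multiplicative G -> homeo X}.
Implicit Types (g h c : G) (x y p : X) (U : set (SubG G)).

Definition locally_trivial x g := \forall p \near x, phi g p = p.

Definition expanding x := forall N O, nbhs x N -> open O -> O !=set0 ->
  exists2 c, locally_trivial x c & forall p, ~ N p -> O (phi c p).

(** Perfectness of the group of elements trivial near [x], expressed by the
    subgroups of [G] that contain its commutators. *)
Definition locally_perfect x := forall H : SubG G,
  (forall a b, locally_trivial x a -> locally_trivial x b ->
     [~ a, b] \in mem_sub H) ->
  forall g, locally_trivial x g -> g \in mem_sub H.

Definition somewhere_trivial g :=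
  exists2 O, open O & O !=set0 /\ forall p, O p -> phi g p = p.

Definition fragmented := forall g, exists g1 g2,
  [/\ g = g1 * g2, somewhere_trivial g1 & somewhere_trivial g2].

Lemma locally_trivialV x g : locally_trivial x g -> locally_trivial x g^-1.
Proof. by apply: filterS => p gp; rewrite -{1}gp actK. Qed.

Lemma locally_trivial_fix x g : locally_trivial x g -> phi g x = x.
Proof. exact: nbhs_singleton. Qed.

Lemma locally_trivial_conj x g c :
  locally_trivial (phi c x) g -> locally_trivial x (g ^ c).
Proof.
move=> lg; have := act_continuous (phi := phi) (g := c) lg.
apply: (@filterS _ (nbhs x)) => p /= gp; by rewrite conjgE !actM gp actK.
Qed.

Lemma commute_disjoint_supports (V W : set X) g h : injective phi ->
  supported phi g V -> supported phi h W -> (forall p, V p -> ~ W p) ->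
  commute g h.
Proof.
move=> phi_inj sg sh VW; apply: phi_inj; apply: homeoP => p.
rewrite !actM; have [Vp|nVp] := pselect (V p).
  have Vgp := supported_stable sg Vp.
  by rewrite (sh p (VW _ Vp)) (sh _ (VW _ Vgp)).
have [Wp|nWp] := pselect (W p); last by rewrite (sh p)// (sg p)// (sh p).
rewrite (sg p)// sg// => Vhp.
by apply: (VW _ Vhp); exact: supported_stable.
Qed.

Lemma mem_stabilizer x g : (g \in mem_sub (stabilizer phi x)) = `[< phi g x = x >].
Proof. by rewrite mem_mkSub. Qed.

Lemma conj_stabilizer c x :
  conj_sub c (stabilizer phi x) = stabilizer phi (phi c x).
Proof.
apply: subG_ext => g; rewrite mem_conj_sub !mem_stabilizer conjgE !actM.
congr asbool; apply/propext; split=> [/(congr1 (phi c))|->].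
  by rewrite actVK.
by rewrite actK.
Qed.

Section Expansion.
Variable x0 : X.
Hypothesis hX : hausdorff_space X.
Hypothesis perfX : no_isolated_point X.
Hypothesis phi_inj : injective phi.
Hypothesis expand : expanding x0.
Hypothesis perfect : locally_perfect x0.

(** Finitely many commutators of elements that are trivial near [x0] can be
    conjugated into a confined subgroup; compactness turns this into a member
    of the URS that contains all of them. *)
Lemma URS_contains_locally_trivial U : is_URS U -> U <> [set trivial_sub G] ->
  exists2 K, U K & forall g, locally_trivial x0 g -> g \in mem_sub K.
Proof.
move=> URSU U1; have [P [P1 PU]] := URS_confined URSU U1.
have [[K0 UK0] cU invU _] := URSU.
pose S : set G := [set q | exists a b,
  [/\ locally_trivial x0 a, locally_trivial x0 b & q = [~ a, b]]].
suff [K UK KS] : exists2 K, U K & forall g, S g -> g \in mem_sub K.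
  by exists K => //; apply: perfect => a b la lb; apply: KS; exists a, b.
apply: closed_family_contains => // Q QS.
have [B [lB BQ]] : exists B : seq G, (forall b, b \in B -> locally_trivial x0 b) /\
    forall q, q \in Q -> exists a b, [/\ a \in B, b \in B & q = [~ a^-1, b^-1]].
  elim: Q QS => [|q Q IH] QS; first by exists [::].
  have [|B [lB BQ]] := IH; first by move=> r rQ; apply: QS; rewrite inE rQ orbT.
  have [a [b [la lb qab]]] := QS q (mem_head _ _).
  exists [:: a^-1, b^-1 & B]; split=> [c|r].
    by rewrite !inE => /or3P[/eqP->|/eqP->|/lB//]; exact: locally_trivialV.
  rewrite inE => /predU1P[->|/BQ[a' [b' [a'B b'B ->]]]].
    by exists a^-1, b^-1; rewrite !inE !eqxx !orbT !invgK.
  by exists a', b'; rewrite !inE a'B b'B !orbT.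
pose N := [set p | forall b, b \in B -> phi b p = p].
have nN : nbhs x0 N.
  rewrite /N; elim: B lB {BQ} @N => [|b B IH] lB N; first exact: filterE.
  have {}IH := IH (fun c cB => lB c (mem_behead (s := b :: B) cB)).
  apply: filterS2 (lB b (mem_head _ _)) IH => p bp Bp c.
  by rewrite inE => /predU1P[->|/Bp].
have N0 : N^° !=set0 by exists x0.
have [y ly yN] := expand nN (open_interior N) N0.
pose N' := N `&` [set p | phi y p = p].
have nN' : nbhs x0 N' by apply: filterI.
have sB b : b \in B -> supported phi b (~` N).
  by move=> bB p /contrapT; apply.
have [||||a b aB bB||c cB] := @confined_contains_commutators _ _ _ hX perfX phi_inj
    K0 P B (~` N') y.
- exact: P1.
- move=> h; have [g gP gK] := PU _ (invU h K0 UK0).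
  by exists g => //; rewrite -mem_conj_sub.
- by move=> b bB p /contrapT[Np _]; exact: Np.
- by move=> p /contrapT[].
- apply: (@commute_disjoint_supports (~` N) N) => //; first exact: sB.
  have -> : y * b * y^-1 = b ^ y^-1 by rewrite conjgE invgK mulgA.
  apply: supported_conj (sB b bB) _ => p Np.
  exact: interior_subset (yN p Np).
- move=> O oO O0; have [c _ cO] := expand nN' oO O0.
  by exists c.
exists (conj_sub c K0); first exact: invU.
by move=> q /BQ[a [b [aB bB ->]]]; rewrite mem_conj_sub; exact: cB.
Qed.

Lemma dense_orbit p O : p <> x0 -> open O -> O !=set0 ->
  exists2 c, locally_trivial x0 c & O (phi c p).
Proof.
move=> px0 oO O0; have [|c lc cO] := @expand (~` [set p]) O _ oO O0.
- apply: open_nbhs_nbhs; split; last by move=> /= /esym.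
  rewrite openC; apply: accessible_closed_set1; exact: hausdorff_accessible.
- by exists c => //; apply: cO => /(_ erefl).
Qed.

(** Conjugating by an element of [K] that moves [x0] shows that [K] contains the
    elements trivial near another point, hence those trivial on some open set by density
    of the orbits, and these generate the group. *)
Lemma whole_of_moves K :
  fragmented -> (forall g, locally_trivial x0 g -> g \in mem_sub K) ->
  (exists2 k, k \in mem_sub K & phi k x0 <> x0) ->
  K = whole_sub G.
Proof.
move=> fragment ltK [k kK kx0].
have trivK g O : open O -> O !=set0 -> (forall p, O p -> phi g p = p) ->
    g \in mem_sub K.
  move=> oO O0 gO; have [c lc Oc] := dense_orbit kx0 oO O0.
  have ckK : c * k \in mem_sub K by rewrite mem_subM// ltK.
  have : g ^ (c * k) \in mem_sub K.
    apply: ltK; apply: locally_trivial_conj; rewrite actM.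
    have : nbhs (phi c (phi k x0)) O by apply: open_nbhs_nbhs.
    exact: filterS.
  move=> gckK; rewrite -(conjgK (c * k) g) conjgE.
  by rewrite invgK mem_subM// mem_subM// mem_subV.
apply: subG_ext => g; rewrite mem_whole_sub.
have [g1 [g2 [-> [V oV [V0 g1V]] [W oW [W0 g2W]]]]] := fragment g.
by rewrite mem_subM//; [exact: trivK oV V0 g1V|exact: trivK oW W0 g2W].
Qed.

End Expansion.

Section StabilizerURS.
Hypothesis hX : hausdorff_space X.
Hypothesis minimal : forall p O, open O -> O !=set0 -> exists c, O (phi c p).

(** Being moved is an open condition, so only the elements that fix [y] can make
    the stabilizer discontinuous at [y]. *)
Lemma continuous_stabilizerP y : {for y, continuous (stabilizer phi)} <->
  forall g, phi g y = y -> locally_trivial y g.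
Proof.
split=> [cy g gy|loc].
  have near_y : \forall p \near y, (g \in mem_sub (stabilizer phi p)) =
    (g \in mem_sub (stabilizer phi y)) := cy _ (nbhs_mem_sub _ g).
  apply: filterS near_y => p.
  by rewrite !mem_stabilizer (asboolT gy) => /asboolP.
apply/SubG_cvgP => g.
change (\forall p \near y, (g \in mem_sub (stabilizer phi p)) =
  (g \in mem_sub (stabilizer phi y))).
have [gy|gy] := pselect (phi g y = y).
  apply: filterS (loc g gy) => p gp.
  by rewrite !mem_stabilizer (asboolT gy) (asboolT gp).
have : nbhs y [set p | phi g p != p].
  apply: open_nbhs_nbhs; split; last exact/eqP.
  exact: open_moved.
apply: filterS => p /eqP gp.
by rewrite !mem_stabilizer (asboolF gy) (asboolF gp).
Qed.

(** A conjugate of [K] is squeezed between germ and point stabilizers at any point of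
    the orbit of [x]. When the orbit approaches a continuity point [y], both
    bounds agree with the stabilizer of [y] on any given finite set. *)
Lemma stabilizer_in_closed_invariant U K x y : closed U -> conj_invariant U ->
  U K -> (forall g, locally_trivial x g -> g \in mem_sub K) ->
  (forall g, g \in mem_sub K -> phi g x = x) ->
  {for y, continuous (stabilizer phi)} -> U (stabilizer phi y).
Proof.
move=> cU invU UK ltK Kx /continuous_stabilizerP loc.
apply: (closed_SubGP cU) => Q.
pose W := [set z | forall g, g \in Q ->
  (phi g y = y -> locally_trivial z g) /\ (phi g y <> y -> phi g z <> z)].
have nW : nbhs y W.
  rewrite /W; elim: Q {W} => [|g Q IH]; first exact: filterE.
  have n1 : \forall z \near y, phi g y = y -> locally_trivial z g.
    have [gy|gy] := pselect (phi g y = y); last exact: filterE.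
    have : \forall z \near y, locally_trivial z g.
      by have /nbhs_interior := loc g gy.
    exact: filterS.
  have n2 : \forall z \near y, phi g y <> y -> phi g z <> z.
    have [gy|gy] := pselect (phi g y = y); first exact: filterE.
    have : nbhs y [set p | phi g p != p].
      apply: open_nbhs_nbhs; split; last exact/eqP.
      exact: open_moved.
    by apply: filterS => z /eqP.
  apply: filterS3 IH n1 n2 => z H z1 z2 h.
  by rewrite inE => /predU1P[->|/H].
have [||c Wc] := @minimal x W^°; first exact: open_interior.
  by exists y.
exists (conj_sub c K); first exact: invU.
move=> g gQ; rewrite mem_conj_sub mem_stabilizer.
have [W1 W2] := interior_subset Wc g gQ.
apply/idP/asboolP => [gK|/W1/locally_trivial_conj/ltK//].
apply: contrapT => /W2; apply.
by apply: (@act_inj _ _ phi c^-1); rewrite actK; have := Kx _ gK; rewrite conjgE !actM.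
Qed.

Lemma stabilizer_URS_conj_invariant : conj_invariant (stabilizer_URS phi).
Proof.
move=> c H SH A /nbhs_SubGP[Q QA].
have [_ [y cy <-] HQ] := closure_SubGP SH [seq g ^ c | g <- Q].
exists (stabilizer phi (phi c y)); split.
  exists (phi c y) => //; apply/continuous_stabilizerP => g gcy.
  suff -> : g = (g ^ c) ^ c^-1.
    apply: locally_trivial_conj; rewrite actK.
    move/continuous_stabilizerP : cy; apply.
    by rewrite conjgE !actM gcy actK.
  by rewrite conjgK.
apply: QA => g gQ; rewrite -conj_stabilizer !mem_conj_sub HQ//.
exact: map_f.
Qed.

Hypothesis cX : compact [set: X].

(** A limit of stabilizers of points of a compact space is squeezed between the
    two stabilizers of a cluster point of these points. *)
Lemma closure_stabilizers H : stabilizer_URS phi H -> exists x,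
  (forall g, locally_trivial x g -> g \in mem_sub H) /\
  (forall g, g \in mem_sub H -> phi g x = x).
Proof.
move=> SH.
pose A (Q : seq G) := [set z | {in Q, mem_sub (stabilizer phi z) =i mem_sub H}].
pose F := filter_from [set: seq G] A.
have FF : ProperFilter F.
  apply: filter_from_proper; first apply: filter_from_filter.
  - by exists [::].
  - move=> P Q _ _; exists (P ++ Q) => // z PQz.
    by split=> g gPQ; apply: PQz; rewrite mem_cat gPQ ?orbT.
  - by move=> Q _; have [_ [z _ <-] HQ] := closure_SubGP SH Q; exists z.
have [x [_ Fx]] := cX _ (filterT : F setT).
have near_x g (B : set X) : nbhs x B ->
    exists2 z, B z & (g \in mem_sub H) = `[< phi g z = z >].
  move=> nB; have [|z [Az Bz]] := Fx (A [:: g]) B _ nB; first by exists [:: g].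
  by exists z => //; rewrite -mem_stabilizer Az// inE.
exists x; split=> g.
  by move=> lg; have [z /= gz ->] := near_x g _ lg; apply/asboolP.
move=> gH; apply: contrapT => /eqP gx.
have [|z gz] := near_x g [set p | phi g p != p].
  by apply: open_nbhs_nbhs; split => //; exact: open_moved.
by rewrite gH => /esym/asboolP/eqP; apply/negP.
Qed.

Lemma stabilizer_URS_sub U K x : closed U -> conj_invariant U ->
  U K -> (forall g, locally_trivial x g -> g \in mem_sub K) ->
  (forall g, g \in mem_sub K -> phi g x = x) -> stabilizer_URS phi `<=` U.
Proof.
move=> cU invU UK ltK Kx; rewrite [X in _ `<=` X](closure_id U).1//.
apply: closure_subset => _ [y cy <-].
exact: stabilizer_in_closed_invariant UK ltK Kx cy.
Qed.

Hypothesis continuity_point : exists y, forall g, phi g y = y -> locally_trivial y g.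

Lemma stabilizer_URS_neq0 : stabilizer_URS phi !=set0.
Proof.
have [y yP] := continuity_point; exists (stabilizer phi y).
by apply: subset_closure; exists y => //; exact/continuous_stabilizerP.
Qed.

Lemma is_URS_stabilizer_URS : is_URS (stabilizer_URS phi).
Proof.
split.
- exact: stabilizer_URS_neq0.
- exact: closed_closure.
- exact: stabilizer_URS_conj_invariant.
- move=> W WS [K WK] cW invW; rewrite eqEsubset; split=> //.
  have [x [ltK Kx]] := closure_stabilizers (WS _ WK).
  exact: stabilizer_URS_sub WK ltK Kx.
Qed.

End StabilizerURS.
End LocallyTrivial.

(** Once a member [K] of the URS contains the elements trivial near [x0], either
    [K] moves [x0] and is everything, or it lies between the germ stabilizer and
    the stabilizer of [x0], which brings in all stabilizers of continuity points. *)
Theorem URS_classification (G : groupType) (X : topologicalType)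
    (phi : {multiplicative G -> homeo X}) (x0 : X) :
  hausdorff_space X -> compact [set: X] -> no_isolated_point X ->
  injective phi -> expanding phi x0 -> locally_perfect phi x0 ->
  fragmented phi ->
  (exists k, phi k x0 <> x0) ->
  (exists y, forall g, phi g y = y -> locally_trivial phi y g) ->
  forall U, is_URS U <-> [\/ U = [set trivial_sub G], U = [set whole_sub G] |
                             U = stabilizer_URS phi].
Proof.
move=> hX cX perfX phi_inj expand perfect fragment [k kx0] contpt U.
have minimal p O : open O -> O !=set0 -> exists c, O (phi c p).
  move=> oO O0; have [->|px0] := pselect (p = x0); last first.
    by have [c _ Oc] := dense_orbit hX expand px0 oO O0; exists c.
  have [c _ Oc] := dense_orbit hX expand kx0 oO O0.
  by exists (c * k); rewrite actM.
split=> [URSU|[] ->]; last 3 first.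
- by apply: normal_URS; exact: trivial_sub_normal.
- by apply: normal_URS; exact: whole_sub_normal.
- exact: is_URS_stabilizer_URS.
have [->|U1] := pselect (U = [set trivial_sub G]); first by constructor 1.
have [K UK ltK] :=
  URS_contains_locally_trivial hX perfX phi_inj expand perfect URSU U1.
have [mv|fx] := pselect (exists2 k, k \in mem_sub K & phi k x0 <> x0).
  constructor 2; apply: URS_normal => //; first exact: whole_sub_normal.
  by rewrite -(whole_of_moves hX expand fragment ltK mv).
constructor 3; have [_ cU invU minU] := URSU; apply/esym/minU.
- apply: stabilizer_URS_sub UK ltK _ => // g gK.
  by apply: contrapT => gx0; apply: fx; exists g.
- exact: stabilizer_URS_neq0.
- exact: closed_closure.
- exact: stabilizer_URS_conj_invariant.
Qed.

(** * Restricting an action to a subgroup *)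

Section Restriction.
Variables (G : groupType) (X : topologicalType).
Variable phi : {multiplicative G -> homeo X}.
Variables (x0 : X) (L : SubG G).

Definition restricted_act : {multiplicative subg L -> homeo X} :=
  phi \o subg_incl L.

Lemma restricted_locally_trivial (g : subg L) :
  locally_trivial restricted_act x0 g = locally_trivial phi x0 (val g).
Proof. by []. Qed.

Lemma restricted_act_inj : injective phi -> injective restricted_act.
Proof. by move=> phi_inj g h /phi_inj/val_inj. Qed.

Hypothesis loctriv_in : forall g, locally_trivial phi x0 g -> g \in mem_sub L.

Lemma restricted_expand :
  expanding phi x0 -> expanding restricted_act x0.
Proof.
move=> expand N O nN oO O0; have [c lc cO] := expand N O nN oO O0.
by exists (exist (fun g => g \in mem_sub L) c (loctriv_in lc)).
Qed.

Lemma image_sub_closed (H : SubG (subg L)) : group_closed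
  [pred g : G | `[< [set g | exists2 h, h \in mem_sub H & val h = g] g >]].
Proof.
apply: set_group_closed => [|_ _ [x xH <-] [y yH <-]].
  by exists 1; [case: (mem_sub_closed H)|].
by exists (x * y^-1); [exact: sub_divg|].
Qed.

(** Subgroups of [L] are tested through their images in [G]. *)
Lemma restricted_perfect :
  locally_perfect phi x0 -> locally_perfect restricted_act x0.
Proof.
move=> perfect H HH g lg.
have := perfect (mk_subG (image_sub_closed H)) _ (val g) lg.
rewrite mem_mkSub => /(_ _)/asboolP[a b la lb|h hH /val_inj <-//].
rewrite mem_mkSub; apply/asboolP.
pose lift c lc : subg L := exist (fun g => g \in mem_sub L) c (@loctriv_in c lc).
by exists [~ lift a la, lift b lb]; [exact: HH|].
Qed.

End Restriction.

Lemma normal_of_commutators (G : groupType) (K : SubG G) :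
  (forall a b, [~ a, b] \in mem_sub K) -> normal_sub K.
Proof.
move=> cK g; apply: subG_ext => x; rewrite mem_conj_sub.
have -> : x ^ g = x * [~ x, g] by rewrite commgEl mulVKg.
apply/idP/idP => [xK|xK]; last exact: mem_subM.
by rewrite -[x](mulgK [~ x, g]); apply: sub_divg.
Qed.

Section NoExoticURS.
Variables (G : groupType) (X : topologicalType).
Variable phi : {multiplicative G -> homeo X}.
Variable x0 : X.
Hypothesis hX : hausdorff_space X.
Hypothesis perfX : no_isolated_point X.
Hypothesis phi_inj : injective phi.
Hypothesis expand : expanding phi x0.
Hypothesis perfect : locally_perfect phi x0.

(** A member that contains all commutators is normal, and a normal subgroup in a
    minimal system is the whole system. *)
Lemma URS_are_normal_subgroups :
  (forall a b, locally_trivial phi x0 [~ a, b]) ->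
  forall U, is_URS U <-> exists N : SubG G, normal_sub N /\ U = [set N].
Proof.
move=> comm U; split=> [URSU|[N [nN ->]]]; last exact: normal_URS.
have [->|U1] := pselect (U = [set trivial_sub G]).
  by exists (trivial_sub G); split=> //; exact: trivial_sub_normal.
have [K UK ltK] :=
  URS_contains_locally_trivial hX perfX phi_inj expand perfect URSU U1.
have nK : normal_sub K by apply: normal_of_commutators => a b; exact: ltK.
by exists K; split=> //; exact: URS_normal.
Qed.

Lemma URS_trivial_or_whole :
  (forall g, locally_trivial phi x0 g) ->
  forall U, is_URS U <-> U = [set trivial_sub G] \/ U = [set whole_sub G].
Proof.
move=> triv U; split=> [URSU|[] ->]; last 2 first.
- by apply: normal_URS; exact: trivial_sub_normal.
- by apply: normal_URS; exact: whole_sub_normal.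
have [->|U1] := pselect (U = [set trivial_sub G]); first by left.
have [K UK ltK] :=
  URS_contains_locally_trivial hX perfX phi_inj expand perfect URSU U1.
right; apply: URS_normal => //; first exact: whole_sub_normal.
suff <- : K = whole_sub G by [].
by apply: subG_ext => g; rewrite mem_whole_sub ltK.
Qed.

End NoExoticURS.

(** * Binary words, trees and rotations *)

Definition word := seq bool.

Definition incomparable (u v : word) := ~~ prefix u v && ~~ prefix v u.

Lemma incomparableC u v : incomparable u v = incomparable v u.
Proof. by rewrite /incomparable andbC. Qed.

Lemma prefix_eq_size (u v : word) : prefix u v -> (size v <= size u)%N -> u = v.
Proof.
by move=> /prefixP[s ->]; rewrite size_cat -{2}[size u]addn0 leq_add2l leqn0
  size_eq0 => /eqP ->; rewrite cats0.
Qed.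

Lemma prefix_linear (u v w : word) : prefix u w -> prefix v w ->
  prefix u v || prefix v u.
Proof.
elim: u v w => [|a u IH] [|b v] [|c w] //=.
by move=> /andP[/eqP -> /IH uw] /andP[/eqP -> /uw]; rewrite !eqxx.
Qed.

Lemma incomparable_prefix u v u' : incomparable u v -> prefix u u' ->
  ~~ prefix v u'.
Proof.
move=> /andP[uv vu] uu'; apply/negP => vu'.
by have := prefix_linear uu' vu'; rewrite (negbTE uv) (negbTE vu).
Qed.

Lemma incomparable_ext u v u' : incomparable u v -> prefix u u' ->
  incomparable u' v.
Proof.
move=> uv uu'; rewrite /incomparable (incomparable_prefix uv uu') andbT.
apply/negP => u'v; move: uv; rewrite /incomparable.
by rewrite (prefix_trans uu' u'v).
Qed.

Lemma incomparable_cat u v s t : incomparable u v ->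
  incomparable (u ++ s) (v ++ t).
Proof.
move=> uv; apply: (@incomparable_ext u); last exact: prefix_prefix.
by rewrite incomparableC; apply: incomparable_ext (prefix_prefix _ _);
  rewrite incomparableC.
Qed.

Lemma incomparable_sib u b : incomparable (u ++ [:: b]) (u ++ [:: ~~ b]).
Proof.
elim: u => [|a u IH]; first by case: b.
by move: IH; rewrite /incomparable /= !eqxx.
Qed.

Lemma prefix_next (w : word) b s : prefix (w ++ [:: b]) (w ++ b :: s).
Proof. by rewrite -(cat1s b s) catA prefix_prefix. Qed.

Lemma not_prefix_incomparable (p z : word) : ~~ prefix p z ->
  exists v, incomparable p (z ++ v).
Proof.
move=> pz; have [/prefixP[s ps]|zp] := boolP (prefix z p); last first.
  by exists [::]; rewrite cats0 /incomparable pz.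
case: s ps => [|b s] ps; first by rewrite ps cats0 prefix_refl in pz.
exists [:: ~~ b]; apply: (@incomparable_ext (z ++ [:: b])).
  exact: incomparable_sib.
by rewrite ps prefix_next.
Qed.

Inductive tree := Leaf | Node of tree & tree.

Fixpoint leaves (w : word) (t : tree) : seq word :=
  if t is Node l r then leaves (w ++ [:: false]) l ++ leaves (w ++ [:: true]) r
  else [:: w].

Fixpoint nodes (t : tree) : nat :=
  if t is Node l r then (nodes l + nodes r).+1 else 0.

Fixpoint comb (n : nat) : tree := if n is m.+1 then Node Leaf (comb m) else Leaf.

Fixpoint height (t : tree) : nat :=
  if t is Node l r then (maxn (height l) (height r)).+1 else 0.

Lemma size_leaves w t : size (leaves w t) = (nodes t).+1.
Proof.
by elim: t w => //= l IHl r IHr w; rewrite size_cat IHl IHr addnS addSn.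
Qed.

Lemma leaves_prefix w t u : u \in leaves w t -> prefix w u.
Proof.
elim: t w => [w|l IHl r IHr w] /=; first by rewrite inE => /eqP ->; exact: prefix_refl.
by rewrite mem_cat => /orP[/IHl|/IHr]; apply: prefix_trans; exact: prefix_prefix.
Qed.

Lemma leaves_incomparable w t u v : u \in leaves w t -> v \in leaves w t ->
  u != v -> incomparable u v.
Proof.
elim: t w => [w|l IHl r IHr w] /=.
  by rewrite !inE => /eqP -> /eqP ->; rewrite eqxx.
have lr x y : x \in leaves (w ++ [:: false]) l -> y \in leaves (w ++ [:: true]) r ->
    incomparable x y.
  move=> /leaves_prefix/prefixP[s ->] /leaves_prefix/prefixP[s' ->].
  by apply: incomparable_cat; exact: (incomparable_sib w false).
rewrite !mem_cat => /orP[ul|ur] /orP[vl|vr].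
- exact: IHl ul vl.
- by move=> _; exact: lr.
- by move=> _; rewrite incomparableC; exact: lr.
- exact: IHr ur vr.
Qed.

Lemma leaves_uniq w t : uniq (leaves w t).
Proof.
elim: t w => //= l IHl r IHr w; rewrite cat_uniq IHl IHr andbT /=.
apply/hasPn => u ur; apply/negP => /leaves_prefix lu.
have := incomparable_prefix (incomparable_sib w false) lu.
by rewrite (leaves_prefix ur).
Qed.

Lemma leaves_cover w t u : prefix w u -> (size w + height t <= size u)%N ->
  exists2 v, v \in leaves w t & prefix v u.
Proof.
elim: t w => [w|l IHl r IHr w] /= wu.
  by exists w; rewrite ?inE.
move=> su; have [[|b s] us] := prefixP wu.
  by move: su; rewrite us cats0 addnS ltnNge leq_addr.
have wbu : prefix (w ++ [:: b]) u by rewrite us prefix_next.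
have {}su : (size (w ++ [:: b]) + maxn (height l) (height r) <= size u)%N.
  by rewrite size_cat addn1 addSnnS.
case: b {us} wbu su => wbu su.
  have [|v vr vu] := IHr _ wbu.
    by apply: leq_trans su; rewrite leq_add2l leq_maxr.
  by exists v => //; rewrite mem_cat vr orbT.
have [|v vr vu] := IHl _ wbu.
  by apply: leq_trans su; rewrite leq_add2l leq_maxl.
by exists v => //; rewrite mem_cat vr.
Qed.

Section MinimalWords.
Variable P : word -> Prop.

Fixpoint minimal_tree (k : nat) (w : word) : tree :=
  if k is k'.+1 then
    if `[< P w >] then Leaf
    else Node (minimal_tree k' (w ++ [:: false])) (minimal_tree k' (w ++ [:: true]))
  else Leaf.

Definition minimal_word (w u : word) :=
  [/\ prefix w u, P u & forall v, prefix w v -> prefix v u -> v != u -> ~ P v].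

Lemma minimal_treeP k w u :
  (forall v, prefix w v -> (size w + k <= size v)%N -> P v) ->
  u \in leaves w (minimal_tree k w) <-> minimal_word w u.
Proof.
elim: k w => [|k IH] w Pw /=.
  have Pww : P w by apply: Pw; rewrite ?prefix_refl ?addn0.
  rewrite inE; split=> [/eqP ->|[wu _ minu]].
    split=> // [|v wv vw]; first exact: prefix_refl.
    by rewrite (prefix_eq_size wv) ?eqxx// size_prefix.
  by rewrite eq_sym; apply: contrapT => /negP/(minu w (prefix_refl _) wu); exact.
case: asboolP => Pww.
  rewrite inE; split=> [/eqP ->|[wu _ minu]].
    split=> // [|v wv vw]; first exact: prefix_refl.
    by rewrite (prefix_eq_size wv) ?eqxx// size_prefix.
  by rewrite eq_sym; apply: contrapT => /negP/(minu w (prefix_refl _) wu); exact.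
have IHb b : u \in leaves (w ++ [:: b]) (minimal_tree k (w ++ [:: b])) <->
    minimal_word (w ++ [:: b]) u.
  apply: IH => v wv; rewrite size_cat addn1 addSnnS => sv.
  by apply: Pw => //; apply: prefix_trans wv; exact: prefix_prefix.
have extend b : minimal_word (w ++ [:: b]) u -> minimal_word w u.
  move=> [wu Pu minu]; split=> // [|v wv vu vNu].
    by apply: prefix_trans wu; exact: prefix_prefix.
  have [wbv|] := boolP (prefix (w ++ [:: b]) v); first exact: minu.
  move=> nb; have := prefix_linear wu vu; rewrite (negbTE nb) /=.
  have /prefixP[[|c s] vE] := wv; first by rewrite vE cats0.
  move=> /prefix_eq_size e; rewrite -e ?prefix_refl// in nb.
  by rewrite vE !size_cat leq_add2l.
rewrite mem_cat; split=> [/orP[/IHb|/IHb]|[wu Pu minu]]; [exact: extend|exact: extend|].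
have /prefixP[[|b s] us] := wu; first by rewrite us cats0 in Pu.
have wbu : prefix (w ++ [:: b]) u by rewrite us prefix_next.
have mb : minimal_word (w ++ [:: b]) u.
  by split=> // v wv; apply: minu; apply: prefix_trans wv; exact: prefix_prefix.
by apply/orP; case: b {us wbu} mb => /IHb; [right|left].
Qed.

End MinimalWords.

(** Both [T] and [V] act on a space in which words denote cells; [carry g w z] says
    that [g] maps the cell of [w] to the cell of [z] by the canonical
    identification. *)
Section Carry.
Variables (G : groupType) (carry : G -> word -> word -> Prop).
Hypothesis carry1 : forall w, carry 1 w w.
Hypothesis carryM : forall g h w z y, carry h w z -> carry g z y -> carry (g * h) w y.
Hypothesis carryV : forall g w z, carry g w z -> carry g^-1 z w.
Hypothesis carry_cat : forall g w z v, carry g w z -> carry g (w ++ v) (z ++ v).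
Hypothesis carry1_eq : forall w z, carry 1 w z -> w = z.
Hypothesis carry_sep : forall g N, (forall w, size w = N -> carry g w w) -> g = 1.

Lemma carry_fun g w z z' : carry g w z -> carry g w z' -> z = z'.
Proof.
by move=> /carryV gz gz'; apply: carry1_eq; rewrite -(mulgV g); exact: carryM gz'.
Qed.

Lemma carry_inj g w w' z : carry g w z -> carry g w' z -> w = w'.
Proof. by move=> /carryV gw /carryV gw'; exact: carry_fun gw gw'. Qed.

Fixpoint carries g (s s' : seq word) : Prop :=
  match s, s' with
  | [::], [::] => True
  | w :: s, z :: s' => carry g w z /\ carries g s s'
  | _, _ => False
  end.

Lemma carries_catl g s1 s2 t1 t2 : carries g s1 t1 -> carries g s2 t2 ->
  carries g (s1 ++ s2) (t1 ++ t2).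
Proof. by elim: s1 t1 => [|w s1 IH] [|z t1] //= [? /IH H] /H. Qed.

Lemma carriesM g h s t u : carries h s t -> carries g t u -> carries (g * h) s u.
Proof.
elim: s t u => [|w s IH] [|z t] [|y u] //= [hw /IH hs] [gz /hs].
by split=> //; exact: carryM gz.
Qed.

Lemma carriesV g s t : carries g s t -> carries g^-1 t s.
Proof. by elim: s t => [|w s IH] [|z t] //= [/carryV ? /IH]. Qed.

Lemma carries_leaves g w z t : carry g w z -> carries g (leaves w t) (leaves z t).
Proof.
elim: t w z => //= l IHl r IHr w z gwz.
by apply: carries_catl; [apply: IHl|apply: IHr]; exact: carry_cat.
Qed.

Lemma carries_refl g s w : carries g s s -> w \in s -> carry g w w.
Proof.
by elim: s => //= z s IH [gz /IH gs]; rewrite inE => /predU1P[->|].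
Qed.

Lemma carries_ex g s s' w : carries g s s' -> w \in s ->
  exists2 z, z \in s' & carry g w z.
Proof.
elim: s s' => [//|v s IH] [//|z s'] /= [gv /IH gs]; rewrite inE => /predU1P[->|/gs].
  by exists z => //; rewrite mem_head.
by move=> [y ys gw]; exists y => //; rewrite inE ys orbT.
Qed.

Lemma carries_map g (s : seq word) (f : word -> word) :
  (forall w, w \in s -> carry g w (f w)) -> carries g s (map f s).
Proof.
elim: s => //= w s IH gs; split; first by apply: gs; rewrite mem_head.
by apply: IH => z zs; apply: gs; rewrite inE zs orbT.
Qed.

Lemma carry_deeper g N : (forall w, size w = N -> exists z, carry g w z) ->
  forall w, (N <= size w)%N -> exists z, carry g w z.
Proof.
move=> gN w sw; have [|z gz] := gN (take N w); first by rewrite size_takel.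
by exists (z ++ drop N w); rewrite -{1}(cat_take_drop N w); exact: carry_cat.
Qed.

Definition carry_off p g := forall v, incomparable p v -> carry g v v.

Lemma eq1_of_leaves g p t : carry_off p g ->
  (forall u, u \in leaves p t -> carry g u u) -> g = 1.
Proof.
move=> go gl; apply: (@carry_sep _ (size p + height t)) => w sw.
have [pw|pw] := boolP (prefix p w).
  have [|v vl /prefixP[s ->]] := leaves_cover (t := t) pw; first by rewrite sw.
  exact/carry_cat/gl.
have [wp|wp] := boolP (prefix w p); last by apply: go; rewrite /incomparable pw.
have wE := prefix_eq_size wp; rewrite sw leq_addr in wE.
by rewrite wE ?prefix_refl in pw.
Qed.

Section Comb.
Variables (N : G -> Prop) (p : word).
Hypothesis N1 : N 1.
Hypothesis NM : forall g h, N g -> N h -> N (g * h).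
Hypothesis rot : forall w, prefix p w -> exists x, [/\ N x,
  carry x (w ++ [:: false; false]) (w ++ [:: false]),
  carry x (w ++ [:: false; true]) (w ++ [:: true; false]),
  carry x (w ++ [:: true]) (w ++ [:: true; true]) &
  carry_off w x].

(** Rotations turn every tree into the right comb with as many leaves, by moving
    carets from left subtrees to the right; elements that carry the leaves of one
    tree to those of another are thus compared through the same comb. *)
Lemma carries_to_comb t w : prefix p w -> exists r, [/\ N r,
  carries r (leaves w t) (leaves w (comb (nodes t))) & carry_off w r].
Proof.
have [n] := ubnP (nodes t); elim: n t w => // n IH t w.
have [m] := ubnP (if t is Node l _ then nodes l else 0%N).
elim: m t => // m IHm [|l r] lm tn pw.
  by exists 1; split=> //= v _; exact: carry1.
case: l lm tn => [|l1 l2] /= lm tn.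
  have [||x [Nx xr xo]] := IH r (w ++ [:: true]).
  - by move: tn; rewrite add0n ltnS.
  - exact: prefix_trans pw (prefix_prefix _ _).
  exists x; split=> //=.
    by split=> //; apply: xo; exact: (incomparable_sib w true).
  move=> v wv; apply: xo; apply: incomparable_ext wv _; exact: prefix_prefix.
have [x [Nx x00 x01 x1 xo]] := rot pw.
have [|||y [Ny yt yo]] := IHm (Node l1 (Node l2 r)).
- by move: lm; rewrite ltnS; apply: leq_trans; rewrite /= ltnS leq_addr.
- by move: tn => /=; rewrite !ltnS addnS addSn addnA.
- exact: pw.
have eN : nodes (Node l1 (Node l2 r)) = nodes (Node (Node l1 l2) r).
  by rewrite /= addSn addnS addnA.
rewrite {}eN in yt.
exists (y * x); split; first exact: NM.
- apply: (@carriesM _ _ _ (leaves w (Node l1 (Node l2 r)))); last exact: yt.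
  rewrite /= -!catA; apply: carries_catl; last apply: carries_catl.
  + by apply: carries_leaves; rewrite -?catA.
  + by apply: carries_leaves; rewrite -?catA.
  + by apply: carries_leaves; rewrite -?catA.
- by move=> v wv; apply: carryM (xo v wv) (yo v wv).
Qed.

End Comb.

(** The cells of [p] on which [g] is a canonical identification, and their
    images, are the leaves of two trees: both are given by the minimal words
    with a property that passes to extensions. *)
Lemma carry_trees g p N N' : carry_off p g ->
  (forall w, size w = N -> exists z, carry g w z) ->
  (forall w, size w = N' -> exists z, carry g^-1 w z) ->
  exists t t' (f : word -> word), [/\
    forall u, u \in leaves p t -> carry g u (f u),
    {in leaves p t &, injective f} &
    map f (leaves p t) =i leaves p t'].
Proof.
move=> go dg dgV.
have ext h n : (forall w, size w = n -> exists z, carry h w z) ->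
    forall v, prefix p v -> (size p + n <= size v)%N -> exists z, carry h v z.
  by move=> dh v _ sv; apply: (carry_deeper dh); apply: leq_trans sv; exact: leq_addl.
pose P w := exists z, carry g w z; pose Q z := exists w, carry g^-1 z w.
have Pt u := @minimal_treeP P N p u (ext g N dg).
have Qt u := @minimal_treeP Q N' p u (ext g^-1 N' dgV).
have inp h u z : carry_off p h -> prefix p u -> carry h u z -> prefix p z.
  move=> ho pu huz; apply: contrapT => /negP/not_prefix_incomparable[v pzv].
  have zE := carry_inj (carry_cat v huz) (ho _ pzv).
  move: pzv; rewrite -zE /incomparable => /andP[/negP[]].
  by apply: prefix_trans pu _; exact: prefix_prefix.
have goV : carry_off p g^-1 by move=> v pv; apply: carryV; exact: go.
have minPQ h u z : carry_off p h -> carry h u z ->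
    minimal_word (fun w => exists y, carry h w y) p u ->
    minimal_word (fun w => exists y, carry h^-1 w y) p z.
  move=> ho huz [pu _ minu]; split; first exact: inp huz.
    by exists u; exact: carryV.
  move=> y py /prefixP[s zs] yz [w /carryV]; rewrite invgK => hwy.
  have hoV : carry_off p h^-1 by move=> v pv; apply: carryV; exact: ho.
  have us : u = w ++ s.
    by apply: carry_inj huz _; rewrite zs; exact: carry_cat.
  apply: (minu w); last by exists y.
  - by apply: inp (carryV hwy).
  - by rewrite us prefix_prefix.
  - apply: contra yz => /eqP wu; rewrite zs; move: us; rewrite -wu.
    by move=> /(congr1 size)/eqP; rewrite size_cat -{1}[size w]addn0 eqn_add2l
      eq_sym size_eq0 => /eqP ->; rewrite cats0.
have /choice[f fP] w : exists z, (exists y, carry g w y) -> carry g w z.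
  have [[z gz]|nz] := pselect (exists y, carry g w y); first by exists z.
  by exists w => /nz.
have fl u : u \in leaves p (minimal_tree P N p) -> carry g u (f u).
  by move=> /Pt[_ Pu _]; exact: fP.
exists (minimal_tree P N p), (minimal_tree Q N' p), f; split=> //.
  by move=> u v /fl gu /fl gv e; rewrite e in gu; exact: carry_inj gu gv.
move=> z; apply/mapP/idP => [[u ul ->]|/Qt Qz].
  by apply/Qt; apply: minPQ (fl _ ul) _ => //; exact/Pt.
have [_ [u guz] _] := Qz.
have ut : u \in leaves p (minimal_tree P N p).
  by apply/Pt; have := @minPQ g^-1 z u goV guz Qz; rewrite invgK.
exists u => //; apply: carry_fun (fl u ut).
by have := carryV guz; rewrite invgK.
Qed.

End Carry.

(** * Thompson's group V on the Cantor set *)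

Section CantorSpace.
Implicit Types (x y : cantor_space) (u v w z : word).

Lemma nbhs_cantorP x (A : set cantor_space) :
  nbhs x A <-> exists k, forall y, (forall i, (i < k)%N -> y i = x i) -> A y.
Proof.
split=> [xA|[k kA]].
  pose F : set_system cantor_space := [set B | exists k,
    forall y, (forall i, (i < k)%N -> y i = x i) -> B y].
  have FF : Filter F.
    split=> [|B C [k kB] [l lC]|B C BC [k kB]]; first by exists 0%N.
      exists (maxn k l) => y yx; split; [apply: kB|apply: lC] => i ik; apply: yx.
        by rewrite leq_max ik.
      by rewrite leq_max ik orbT.
    by exists k => y /kB /BC.
  suff : F --> x by apply.
  apply/cvg_sup => i C [_ [[b ob <-] bx bC]].
  apply: filterS bC _; exists i.+1 => y yx.
  by move: bx; rewrite /preimage /= yx.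
apply: filterS kA _ => /=.
elim: k => [|k IH]; first by apply: filterE => y i.
have n1 : nbhs x [set y | y k = x k].
  apply: (@proj_continuous nat (fun=> bool) k x [set b | b = x k]).
  by rewrite nbhs_principalE.
apply: filterS2 n1 IH => y yk Hy i; rewrite ltnS leq_eqVlt => /predU1P[->//|].
exact: Hy.
Qed.

Lemma nbhs_cylinder x (A : set cantor_space) :
  nbhs x A -> exists k, forall l, (k <= l)%N -> cylinder (mkseq x l) `<=` A.
Proof.
move=> /nbhs_cantorP[k kA]; exists k => l kl y yx; apply: kA => i ik.
have il : (i < l)%N by apply: leq_trans kl.
by rewrite yx ?size_mkseq// nth_mkseq.
Qed.

Lemma open_cylinder w : open (cylinder w).
Proof.
rewrite openE => x wx; apply/nbhs_cantorP; exists (size w) => y yx i iw.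
by rewrite yx// wx.
Qed.

Lemma cylinder_neq0 w : cylinder w !=set0.
Proof. by exists (prepend w (fun=> false)); exact: prepend_cylinder. Qed.

Lemma cylinderE w x : cylinder w x <-> exists t, x = prepend w t.
Proof.
split=> [/cylinderP <-|[t ->]]; last exact: prepend_cylinder.
by exists (fun i => x (i + size w)%N).
Qed.

Lemma cylinder_linear w z x : cylinder w x -> cylinder z x ->
  prefix w z || prefix z w.
Proof.
have pref v l : cylinder v x -> (size v <= l)%N -> prefix v (mkseq x l).
  move=> vx vl; rewrite prefixE; apply/eqP/(@eq_from_nth _ false) => [|i].
    by rewrite size_takel// size_mkseq.
  rewrite size_takel ?size_mkseq// => iv.
  by rewrite nth_take// nth_mkseq ?vx//; apply: leq_trans vl.
move=> wx zx; apply: (@prefix_linear _ _ (mkseq x (maxn (size w) (size z)))).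
  by apply: pref => //; rewrite leq_maxl.
by apply: pref => //; rewrite leq_maxr.
Qed.

Lemma cylinder_incomparable w z x : incomparable w z -> cylinder w x ->
  ~ cylinder z x.
Proof.
move=> /andP[wz zw] wx zx.
by have := cylinder_linear wx zx; rewrite (negbTE wz) (negbTE zw).
Qed.

Lemma cylinder_prefix w z : prefix w z -> cylinder z `<=` cylinder w.
Proof.
by move=> /prefixP[s ->] x /cylinderE[t ->]; rewrite prepend_cat;
  exact: prepend_cylinder.
Qed.

Lemma cantor_no_isolated_point : no_isolated_point cantor_space.
Proof.
move=> O x oO Ox; have [k kO] : exists k, forall y,
    (forall i, (i < k)%N -> y i = x i) -> O y.
  by apply/nbhs_cantorP; apply: open_nbhs_nbhs.
exists (fun i => if i == k then ~~ x k else x i).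
  by apply: kO => i ik; rewrite ltn_eqF.
apply/eqP => /(congr1 (@^~ k)); rewrite eqxx.
by case: (x k).
Qed.

Lemma depth_continuous (f : cantor_space -> cantor_space) N :
  (forall w, size w = N -> exists z, forall x, f (prepend w x) = prepend z x) ->
  continuous f.
Proof.
move=> fN x A /nbhs_cantorP[k kA]; apply/nbhs_cantorP; exists (N + k)%N => y yx.
have [z fz] := fN (mkseq x N) (size_mkseq _ _).
have xE : x = prepend (mkseq x N) (fun i => x (i + N)%N).
  have := cylinderP (cylinder_mkseq (x := x) (N := N)).
  by rewrite size_mkseq.
have yE : y = prepend (mkseq x N) (fun i => y (i + N)%N).
  have <- : mkseq y N = mkseq x N.
    apply: (@eq_from_nth _ false); first by rewrite !size_mkseq.
    move=> i; rewrite size_mkseq => iN; rewrite !nth_mkseq// yx//.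
    by apply: leq_trans iN _; rewrite leq_addr.
  have := cylinderP (cylinder_mkseq (x := y) (N := N)).
  by rewrite size_mkseq.
have fx : f x = prepend z (fun i => x (i + N)%N) by rewrite [in LHS]xE fz.
have fy : f y = prepend z (fun i => y (i + N)%N) by rewrite [in LHS]yE fz.
rewrite /preimage /= fy; apply: kA => i ik; rewrite fx /prepend.
case: ifP => // iz; rewrite yx// [(N + k)%N]addnC ltn_add2r.
by apply: leq_ltn_trans ik; rewrite leq_subr.
Qed.

Section Swap.
Variables (w z : word).
Hypothesis wz : incomparable w z.

Definition swap_fun x : cantor_space :=
  if `[< cylinder w x >] then prepend z (fun i => x (i + size w)%N)
  else if `[< cylinder z x >] then prepend w (fun i => x (i + size z)%N)
  else x.

Lemma prepend_tail u (t : cantor_space) : (fun i => prepend u t (i + size u)%N) = t.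
Proof.
by apply/funext => i; rewrite /prepend ltnNge leq_addl /= addnK.
Qed.

Lemma swap_fun_l t : swap_fun (prepend w t) = prepend z t.
Proof. by rewrite /swap_fun asboolT ?prepend_tail//; exact: prepend_cylinder. Qed.

Lemma swap_fun_r t : swap_fun (prepend z t) = prepend w t.
Proof.
rewrite /swap_fun asboolF; last first.
  move=> /(cylinder_incomparable wz); apply; exact: prepend_cylinder.
by rewrite asboolT ?prepend_tail//; exact: prepend_cylinder.
Qed.

Lemma swap_fun_off x : ~ cylinder w x -> ~ cylinder z x -> swap_fun x = x.
Proof. by move=> wx zx; rewrite /swap_fun !asboolF. Qed.

Lemma swap_funK : involutive swap_fun.
Proof.
move=> x; have [/cylinderE[t ->]|wx] := pselect (cylinder w x).
  by rewrite swap_fun_l swap_fun_r.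
have [/cylinderE[t ->]|zx] := pselect (cylinder z x).
  by rewrite swap_fun_r swap_fun_l.
by rewrite !swap_fun_off.
Qed.

Lemma swap_fun_depth u : size u = (size w + size z)%N -> exists v, forall x,
  swap_fun (prepend u x) = prepend v x.
Proof.
move=> su; have [/prefixP[s us]|wu] := boolP (prefix w u).
  by exists (z ++ s) => x; rewrite us !prepend_cat swap_fun_l.
have [/prefixP[s us]|zu] := boolP (prefix z u).
  by exists (w ++ s) => x; rewrite us !prepend_cat swap_fun_r.
exists u => x; have ux := @prepend_cylinder u x.
rewrite swap_fun_off// => cx.
  have := cylinder_linear cx ux; rewrite (negbTE wu) /= => uw.
  by rewrite (prefix_eq_size uw) ?prefix_refl ?su ?leq_addr in wu.
have := cylinder_linear cx ux; rewrite (negbTE zu) /= => uw.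
by rewrite (prefix_eq_size uw) ?prefix_refl ?su ?leq_addl in zu.
Qed.

Definition swap_homeo : homeo cantor_space :=
  Homeo swap_funK swap_funK (depth_continuous swap_fun_depth)
    (depth_continuous swap_fun_depth).

End Swap.
End CantorSpace.

Section ThompsonV.
Implicit Types (g h : thompsonV) (u v w z : word).
Local Notation act := thompsonV_act.

Definition carryC g w z := forall x, act g (prepend w x) = prepend z x.

Lemma carryC1 w : carryC 1 w w.
Proof. by move=> x; rewrite act1. Qed.

Lemma carryCM g h u v w : carryC h u v -> carryC g v w -> carryC (g * h) u w.
Proof. by move=> hw gz x; rewrite actM hw gz. Qed.

Lemma carryCV g w z : carryC g w z -> carryC g^-1 z w.
Proof. by move=> gw x; rewrite -gw actK. Qed.

Lemma carryC_cat g w z v : carryC g w z -> carryC g (w ++ v) (z ++ v).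
Proof. by move=> gw x; rewrite !prepend_cat gw. Qed.

Lemma prepend_eq_word w z : (forall x, prepend w x = prepend z x) -> w = z.
Proof.
have sle u v : (forall x, prepend u x = prepend v x) -> (size u <= size v)%N.
  move=> uv; rewrite leqNgt; apply/negP => vu.
  have := congr1 (@^~ (size v)) (uv (fun=> ~~ nth false u (size v))).
  by rewrite /prepend vu ltnn; case: (nth _ _ _).
move=> wz; have swz : size w = size z by apply/eqP; rewrite eqn_leq !sle.
apply: (@eq_from_nth _ false) => // i iw.
have := congr1 (@^~ i) (wz (fun=> false)).
by rewrite /prepend iw -swz iw.
Qed.

Lemma carryC1_eq w z : carryC 1 w z -> w = z.
Proof. by move=> wz; apply: prepend_eq_word => x; rewrite -wz act1. Qed.

Lemma act_V_inj : injective act.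
Proof. exact: val_inj. Qed.

Lemma prepend_mkseq x N : prepend (mkseq x N) (fun i => x (i + N)%N) = x.
Proof. by have := cylinderP (cylinder_mkseq (x := x) (N := N)); rewrite size_mkseq. Qed.

Lemma carryC_sep g N : (forall w, size w = N -> carryC g w w) -> g = 1.
Proof.
move=> gN; apply: act_V_inj; apply: homeoP => x; rewrite act1.
by rewrite -(prepend_mkseq x N) gN// size_mkseq.
Qed.

Lemma carryC_depth g : exists N, forall w, size w = N -> exists z, carryC g w z.
Proof.
have /asboolP/thompsonV_depth[N gN] := valP g.
by exists N.
Qed.

Lemma swapP w z : incomparable w z -> exists s : thompsonV,
  [/\ carryC s w z, carryC s z w &
      forall u, incomparable w u -> incomparable z u -> carryC s u u].
Proof.
move=> wz; have sV : swap_homeo wz \in mem_sub (mk_subG thompsonV_closed).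
  rewrite mem_mkSub; apply/asboolP/thompsonV_depth.
  by exists (size w + size z)%N => u /(swap_fun_depth wz).
exists (exist (fun x : homeo cantor_space =>
  x \in mem_sub (mk_subG thompsonV_closed)) (swap_homeo wz) sV).
split=> [x|x|u wu zu x].
- exact: swap_fun_l.
- exact: swap_fun_r.
- by apply: swap_fun_off;
    [move=> /(cylinder_incomparable wu)|move=> /(cylinder_incomparable zu)];
    apply; exact: prepend_cylinder.
Qed.

Lemma carryC_mul_eq g h w z : carryC g w z -> carryC h w z -> carryC (g^-1 * h) w w.
Proof. by move=> gw hw; apply: carryCM hw (carryCV gw). Qed.

Lemma carryC_swap_eq g h u v : incomparable u v ->
  (forall w b, w = u \/ w = v -> exists z, carryC g (w ++ [:: b]) z /\
     carryC h (w ++ [:: b]) z) ->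
  (forall w, incomparable u w -> incomparable v w -> carryC g w w /\ carryC h w w) ->
  g = h.
Proof.
move=> uv ghuv ghw; suff : g^-1 * h = 1 by move=> /mulg1_eq <-; rewrite invgK.
apply: (@carryC_sep _ (size u + size v).+1) => w sw.
have ext (x : word) : x = u \/ x = v -> (size x < size w)%N -> prefix x w ->
    carryC (g^-1 * h) w w.
  move=> xuv sx /prefixP[[|b s] wE]; first by rewrite wE cats0 ltnn in sx.
  rewrite wE -(cat1s b) catA; apply: carryC_cat.
  by have [z [gz hz]] := ghuv x b xuv; apply: carryC_mul_eq hz.
have su : (size u < size w)%N by rewrite sw ltnS leq_addr.
have sv : (size v < size w)%N by rewrite sw ltnS leq_addl.
have [uw|uw] := boolP (prefix u w); first by apply: (ext u) => //; left.
have [vw|vw] := boolP (prefix v w); first by apply: (ext v) => //; right.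
have [||gw hw] := ghw w; last exact: carryC_mul_eq hw.
  rewrite /incomparable uw; apply/negP => /size_prefix.
  by rewrite leqNgt su.
rewrite /incomparable vw; apply/negP => /size_prefix.
by rewrite leqNgt sv.
Qed.

Lemma carryC_cylinder g w z x : carryC g w z -> cylinder w x -> cylinder z (act g x).
Proof.
by move=> gw /cylinderE[t ->]; rewrite gw; exact: prepend_cylinder.
Qed.

Lemma carryC_fix g w x : carryC g w w -> cylinder w x -> act g x = x.
Proof. by move=> gw /cylinderE[t ->]. Qed.

Section Perfect.
Variable H : SubG thompsonV.
Hypothesis commH : forall a b, carryC a [:: true] [:: true] ->
  carryC b [:: true] [:: true] -> [~ a, b] \in mem_sub H.

Let in0 (u : word) := prefix [:: false] u.

Lemma in0_incomparable u : in0 u -> incomparable u [:: true].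
Proof. by move: u => [|[] u]. Qed.

(** A swap of two cells is the product of the swaps of their halves, which are
    conjugate; hence it is a commutator. *)
Lemma swap_in_commutators u v : in0 u -> in0 v -> incomparable u v ->
  exists s, [/\ s \in mem_sub H, carryC s u v, carryC s v u &
    forall w, incomparable u w -> incomparable v w -> carryC s w w].
Proof.
move=> u0 v0 uv; have [s [suv svu sw]] := swapP uv.
exists s; split=> //.
have uvb b c : incomparable (u ++ [:: b]) (v ++ [:: c]) by exact: incomparable_cat.
have vub b c : incomparable (v ++ [:: b]) (u ++ [:: c]).
  by apply: incomparable_cat; rewrite incomparableC.
have [t [tuv tvu tw]] := swapP (uvb false false).
have [p [p01 p10 pw]] := swapP (incomparable_sib u false).
have [q [q01 q10 qw]] := swapP (incomparable_sib v false).
rewrite /= in p01 p10 pw q01 q10 qw.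
have incC w b x : incomparable w x -> incomparable (w ++ [:: b]) x.
  by move=> /incomparable_ext; apply; exact: prefix_prefix.
have ut := in0_incomparable u0; have vt := in0_incomparable v0.
have t1 : carryC t [:: true] [:: true] by apply: tw; exact: incC.
have pq1 : carryC (p * q) [:: true] [:: true].
  by apply: (@carryCM _ _ _ [:: true]); [apply: qw|apply: pw]; exact: incC.
have pqu b : carryC (p * q) (u ++ [:: b]) (u ++ [:: ~~ b]).
  apply: (@carryCM _ _ _ (u ++ [:: b])); last by case: b.
  by apply: qw; exact: vub.
have pqv b : carryC (p * q) (v ++ [:: b]) (v ++ [:: ~~ b]).
  apply: (@carryCM _ _ _ (v ++ [:: ~~ b])); first by case: b.
  by apply: pw; exact: uvb.
have pqVu b : carryC (p * q)^-1 (u ++ [:: b]) (u ++ [:: ~~ b]).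
  by have := carryCV (pqu (~~ b)); rewrite negbK.
have pqVv b : carryC (p * q)^-1 (v ++ [:: b]) (v ++ [:: ~~ b]).
  by have := carryCV (pqv (~~ b)); rewrite negbK.
have sibC (x : word) : incomparable (x ++ [:: false]) (x ++ [:: true]).
  exact: (incomparable_sib x false).
have tu1 : carryC t (u ++ [:: true]) (u ++ [:: true]) by apply: tw.
have tv1 : carryC t (v ++ [:: true]) (v ++ [:: true]) by apply: tw.
suff -> : s = [~ t, p * q] by apply: commH.
rewrite commgEl conjgE; apply: (carryC_swap_eq uv).
- move=> w b [->|->]; [exists (v ++ [:: b])|exists (u ++ [:: b])].
    split; first exact: carryC_cat.
    case: b.
      exact: carryCM (carryCM (carryCM (pqu true) tuv) (pqVv false)) (carryCV tv1).
    exact: carryCM (carryCM (carryCM (pqu false) tu1) (pqVu true)) (carryCV tvu).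
  split; first exact: carryC_cat.
  case: b.
    exact: carryCM (carryCM (carryCM (pqv true) tvu) (pqVu false)) (carryCV tu1).
  exact: carryCM (carryCM (carryCM (pqv false) tv1) (pqVv true)) (carryCV tuv).
- move=> w uw vw; split; first exact: sw.
  have tww : carryC t w w by apply: tw; exact: incC.
  have pqw : carryC (p * q) w w.
    by apply: (@carryCM _ _ _ w); [apply: qw|apply: pw]; exact: incC.
  exact: carryCM (carryCM (carryCM pqw tww) (carryCV pqw)) (carryCV tww).
Qed.

(** The rotation of a cell is a product of three swaps of subcells. *)
Lemma rotation_in_commutators w : in0 w -> exists x, [/\ x \in mem_sub H,
  carryC x (w ++ [:: false; false]) (w ++ [:: false]),
  carryC x (w ++ [:: false; true]) (w ++ [:: true; false]),
  carryC x (w ++ [:: true]) (w ++ [:: true; true]) &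
  carry_off carryC w x].
Proof.
move=> w0; have in0w s : in0 (w ++ s) by apply: prefix_trans w0 _; exact: prefix_prefix.
have i01 : incomparable (w ++ [:: false]) (w ++ [:: true]).
  exact: (incomparable_sib w false).
have i00 : incomparable (w ++ [:: false; false]) (w ++ [:: false; true]).
  by have := incomparable_sib (w ++ [:: false]) false; rewrite -!catA.
have i011 : incomparable (w ++ [:: false; true]) (w ++ [:: true]).
  by apply: incomparable_ext i01 _; exact: prefix_next.
have i001 : incomparable (w ++ [:: false; false]) (w ++ [:: true]).
  by apply: incomparable_ext i01 _; exact: prefix_next.
have [a [aH a1 a2 aw]] := swap_in_commutators (in0w _) (in0w _) i00.
have [b [bH b1 b2 bw]] := swap_in_commutators (in0w _) (in0w _) i011.
have [c [cH c1 c2 cw]] := swap_in_commutators (in0w _) (in0w _) i01.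
exists (c * (b * a)); split.
- by rewrite !mem_subM.
- apply: carryCM (carryCM a1 b1) c2.
- have c3 := carryC_cat [:: false] c1; rewrite -!catA in c3.
  by apply: carryCM (carryCM a2 _) c3; apply: bw; rewrite // incomparableC.
- have c3 := carryC_cat [:: true] c1; rewrite -!catA in c3.
  by apply: carryCM (carryCM _ b2) c3; apply: aw.
- move=> v wv; have inc s : incomparable (w ++ s) v.
    by apply: incomparable_ext wv _; exact: prefix_prefix.
  by apply: carryCM (carryCM (aw _ _ _) (bw _ _ _)) (cw _ _ _); exact: inc.
Qed.

(** An element that permutes the leaves of a tree is sorted by swaps. *)
Lemma leaf_permutation_in_commutators t g :
  carry_off carryC [:: false] g ->
  (forall u, u \in leaves [:: false] t ->
     exists2 v, v \in leaves [:: false] t & carryC g u v) ->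
  g \in mem_sub H.
Proof.
move=> go gt; pose L := leaves [:: false] t.
suff perm s : {subset s <= L} -> uniq s -> forall g, carry_off carryC [:: false] g ->
    (forall u, u \in L -> u \notin s -> carryC g u u) ->
    (forall u, u \in s -> exists2 v, v \in s & carryC g u v) -> g \in mem_sub H.
  apply: (perm L) => //; [exact: leaves_uniq|by move=> u ->].
elim: s {g go gt} => [|a s IH] sL.
  move=> _ g go gL _; have := mem_sub1 H.
  rewrite (@eq1_of_leaves _ _ carryC_cat carryC_sep g [:: false] t)//.
  by move=> u uL; apply: gL.
move=> /andP[as_ us] g go gL gs.
have aL : a \in L by apply: sL; rewrite mem_head.
have sL' : {subset s <= L} by move=> u us'; apply: sL; rewrite inE us' orbT.
have [b bs gab] := gs a (mem_head _ _).
have other u : u \in s -> exists v, [/\ v \in a :: s, v != b & carryC g u v].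
  move=> us'; have [|v vs guv] := gs u; first by rewrite inE us' orbT.
  exists v; split=> //; apply: contraNneq as_ => vb; rewrite vb in guv.
  by rewrite (carry_inj carryCM carryCV carryC1_eq gab guv).
have [ab|ab] := eqVneq b a.
  subst b; apply: (IH sL' us g go).
    move=> u uL; have [-> //|ua us'] := eqVneq u a.
    by apply: gL => //; rewrite inE negb_or ua.
  move=> u /other[v [+ va guv]]; rewrite inE (negbTE va) /= => vs.
  by exists v.
have bs' : b \in s by move: bs; rewrite inE (negbTE ab).
have bL := sL' _ bs'.
have in0L u : u \in L -> in0 u by exact: leaves_prefix.
have iab : incomparable a b by apply: leaves_incomparable aL bL _; rewrite eq_sym.
have [x [xH xab xba xw]] := swap_in_commutators (in0L _ aL) (in0L _ bL) iab.
suff : x * g \in mem_sub H.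
  by move=> xgH; rewrite -(mulKg x g) mem_subM// mem_subV.
apply: (IH sL' us).
- move=> v v0; apply: carryCM (go v v0) (xw _ _ _).
    by apply: incomparable_ext v0 _; exact: in0L.
  by apply: incomparable_ext v0 _; exact: in0L.
- move=> u uL; have [-> _|ua us'] := eqVneq u a; first exact: carryCM gab xba.
  have ub : u != b by apply: contraNneq us' => ->.
  apply: (@carryCM _ _ _ u); first by apply: gL => //; rewrite inE negb_or ua.
  by apply: xw; [apply: leaves_incomparable aL uL _|apply: leaves_incomparable bL uL _];
    rewrite eq_sym.
- move=> u /other[v [vs vb guv]].
  have [va|va] := eqVneq v a.
    by exists b => //; apply: carryCM guv _; rewrite va.
  have {}vs : v \in s by move: vs; rewrite inE (negbTE va).
  exists v => //; apply: carryCM guv (xw _ _ _).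
    by apply: leaves_incomparable aL (sL' _ vs) _; rewrite eq_sym.
  by apply: leaves_incomparable bL (sL' _ vs) _; rewrite eq_sym.
Qed.

(** Both trees of such an element are brought to the same comb by rotations, and
    what remains permutes the leaves of the comb. *)
Lemma fixing_half_in_commutators g : carryC g [:: true] [:: true] ->
  g \in mem_sub H.
Proof.
move=> g1.
have go : carry_off carryC [:: false] g.
  move=> [|[] v]; rewrite /incomparable /= ?prefix0s ?andbF //= => _.
  exact: (carryC_cat v g1).
have [N gN] := carryC_depth g; have [N' gN'] := carryC_depth g^-1.
have [t [t' [f [gf finj ft']]]] :=
  carry_trees carryCM carryCV carryC_cat carryC1_eq go gN gN'.
have eqn : nodes t = nodes t'.
  apply: succn_inj; rewrite -!(size_leaves [:: false]) -(size_map f).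
  apply/perm_size/uniq_perm => //; last exact: leaves_uniq.
  by rewrite map_inj_in_uniq// leaves_uniq.
have to_comb := carries_to_comb carryC1 carryCM carryC_cat (N := fun x => x \in mem_sub H)
  (mem_sub1 H) (@mem_subM _ H) rotation_in_commutators.
have [r [rH rt ro]] := to_comb t _ (prefix_refl _).
have [r' [r'H r't r'o]] := to_comb t' _ (prefix_refl _).
suff : r' * g * r^-1 \in mem_sub H.
  move=> qH; have -> : g = r'^-1 * (r' * g * r^-1) * r.
    by rewrite !mulgA mulVg mul1g mulgVK.
  exact: mem_subM (mem_subM (mem_subV r'H) qH) rH.
apply: (@leaf_permutation_in_commutators (comb (nodes t))) => [v v0|u uc].
  exact: carryCM (carryCV (ro v v0)) (carryCM (go v v0) (r'o v v0)).
have [u1 u1t ru1] := carries_ex (carriesV carryCV rt) uc.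
have fu1 : f u1 \in leaves [:: false] t' by rewrite -ft' map_f.
have [v vc r'v] := carries_ex r't fu1.
exists v; first by rewrite eqn.
exact: carryCM ru1 (carryCM (gf _ u1t) r'v).
Qed.

End Perfect.

Lemma mkseq_zero k : mkseq (fun=> false) k = nseq k false.
Proof.
apply: (@eq_from_nth _ false); rewrite ?size_mkseq ?size_nseq// => i ik.
by rewrite nth_mkseq// nth_nseq ik.
Qed.

Lemma zero_cylinderP (x0 := (fun=> false) : cantor_space) g :
  locally_trivial act x0 g <-> exists k, carryC g (nseq k false) (nseq k false).
Proof.
split=> [/nbhs_cylinder[k /(_ k (leqnn k)) kg]|[k gk]].
  exists k => x; apply: kg; rewrite mkseq_zero; exact: prepend_cylinder.
have : nbhs x0 (cylinder (nseq k false)).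
  by apply: open_nbhs_nbhs; split; [exact: open_cylinder|rewrite -mkseq_zero; exact: cylinder_mkseq].
by apply: filterS => x /cylinderE[t ->]; exact: gk.
Qed.

(** Exchanging a neighbourhood of [x0] with one half of the Cantor set reduces
    statements about elements that are trivial near [x0] to statements about
    elements that are trivial on that half. *)
Lemma half_swap k : exists s : thompsonV,
  [/\ carryC s (nseq k.+1 false) [:: true], carryC s [:: true] (nseq k.+1 false) &
    forall p, ~ cylinder (nseq k.+1 false) p -> cylinder [:: false] (act s p)].
Proof.
have [|s [s1 s2 _]] := @swapP (nseq k.+1 false) [:: true]; first by [].
exists s; split=> // p np; have [e|e] := boolP (act s p 0%N).
  case: np; rewrite -(actK act s p); apply: carryC_cylinder (carryCV s1) _.
  by move=> [|i] //= _; rewrite e.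
by move=> [|i] //= _; rewrite (negbTE e).
Qed.

Lemma nseq_carryC g k l : (k <= l)%N -> carryC g (nseq k false) (nseq k false) ->
  carryC g (nseq l false) (nseq l false).
Proof. by move=> kl gk; rewrite -(subnKC kl) nseqD; exact: carryC_cat. Qed.

Lemma thompsonV_perfect : locally_perfect act (fun=> false).
Proof.
move=> H commH g /zero_cylinderP[k /(nseq_carryC (leqnSn k)) gk].
have [s [s1 s2 _]] := half_swap k.
suff : g ^ s^-1 \in mem_sub (conj_sub s H) by rewrite mem_conj_sub conjgKV.
apply: fixing_half_in_commutators => [a b a1 b1|]; last first.
  by rewrite conjgE invgK; exact: carryCM (carryCM (carryCV s1) gk) s1.
rewrite mem_conj_sub conjRg; apply: commH; apply/zero_cylinderP; exists k.+1.
  by rewrite conjgE; exact: carryCM (carryCM s1 a1) (carryCV s1).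
by rewrite conjgE; exact: carryCM (carryCM s1 b1) (carryCV s1).
Qed.

Lemma compress_half (y : word) : y != [::] -> exists r z j, [/\ prefix y z,
  carryC r [:: false] z &
  carryC r (true :: nseq j false) (true :: nseq j false)].
Proof.
case: y => [//|[] y] _.
  have yj n : (size y).+1 = n -> incomparable (true :: y ++ [:: true]) (true :: nseq n.+1 false).
    move=> ny; rewrite /incomparable; apply/andP; split.
      apply/negP => /prefixP[s] [e].
      have : true \in nseq n.+1 false by rewrite /= e !mem_cat mem_head orbT.
      by rewrite mem_nseq.
    apply/negP => /size_prefix; rewrite /= size_nseq size_cat addn1 ny.
    by rewrite ltnn.
  have [|r [r1 _ rw]] := @swapP [:: false] (true :: y ++ [:: true]); first by [].
  exists r, (true :: y ++ [:: true]), (size y).+2; split=> //.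
    by rewrite -cat_cons prefix_prefix.
  by apply: rw => //; exact: yj.
have [|s [s1 _ sw]] := @swapP [:: false] [:: true; true]; first by [].
have [|r [r1 _ rw]] := @swapP [:: true; true] (false :: y); first by [].
exists (r * s), (false :: y), 1%N; split; first exact: prefix_refl.
  exact: carryCM s1 r1.
by apply: carryCM (sw _ _ _) (rw _ _ _).
Qed.

(** [half_swap] moves the complement of a small neighbourhood into the cell [0],
    which [compress_half] sends into any other cell without disturbing a smaller
    neighbourhood. *)
Lemma thompsonV_expand : expanding act (fun=> false).
Proof.
move=> N O /nbhs_cylinder[k kN] oO [q Oq].
have {}kN : cylinder (nseq k.+1 false) `<=` N.
  by rewrite -mkseq_zero; exact: kN (leqnSn k).
have [s [s1 s2 sO]] := half_swap k.
have [l [y [lO slw]]] : exists l y, cylinder l `<=` O /\ carryC s l y.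
  have [M sM] := carryC_depth s.
  have [l lO] := nbhs_cylinder (open_nbhs_nbhs (conj oO Oq)).
  have [|y sy] := carry_deeper carryC_cat sM (w := mkseq q (maxn l M)).
    by rewrite size_mkseq leq_maxr.
  by exists (mkseq q (maxn l M)), y; split=> //; apply: lO; exact: leq_maxl.
have [|r [z [j [yz r0 r1]]]] := @compress_half (y ++ [:: true]); first by case: y {slw}.
exists (s^-1 * (r * s)).
  apply/zero_cylinderP; exists (k.+1 + j)%N; rewrite nseqD.
  have := carryC_cat (nseq j false) s1; rewrite cat1s => sj.
  exact: carryCM (carryCM sj r1) (carryCV sj).
move=> p Np; have sp : cylinder [:: false] (act s p) by apply: sO => /kN.
apply: lO; rewrite actM (actM _ r); apply: carryC_cylinder (carryCV slw) _.
apply: (@cylinder_prefix y z).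
  by apply: prefix_trans yz; exact: prefix_prefix.
exact: carryC_cylinder r0 sp.
Qed.

Lemma carryC_moved g : g <> 1 -> exists w z, carryC g w z /\ incomparable w z.
Proof.
move=> g1; have [N gN] := carryC_depth g.
have [w [z [gw wz]]] : exists w z, carryC g w z /\ w != z.
  apply: contrapT => nw; apply: g1; apply: (@carryC_sep _ N) => w sw.
  have [z gz] := gN w sw; have [wz|wz] := eqVneq w z; first by rewrite {2}wz.
  by case: nw; exists w, z.
have [/prefixP[[|b s] zE]|nwz] := boolP (prefix w z).
- by rewrite zE cats0 eqxx in wz.
- exists (w ++ [:: ~~ b]), (z ++ [:: ~~ b]); split; first exact: carryC_cat.
  rewrite zE -catA /= -(cat1s b) catA incomparableC.
  by apply: incomparable_ext (incomparable_sib w b) _; exact: prefix_prefix.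
have [/prefixP[[|b s] wE]|nzw] := boolP (prefix z w).
- by rewrite wE cats0 eqxx in wz.
- exists (w ++ [:: ~~ b]), (z ++ [:: ~~ b]); split; first exact: carryC_cat.
  rewrite wE -catA /= -(cat1s b) catA.
  by apply: incomparable_ext (incomparable_sib z b) _; exact: prefix_prefix.
by exists w, z; split=> //; rewrite /incomparable nwz.
Qed.

(** If [g] moves the cell [w] off itself to [z], the swap of the cells [w0] and
    [z0] agrees with [g] on [w0] and is trivial on [w1]. *)
Lemma thompsonV_fragment : fragmented act.
Proof.
move=> g; have [->|/eqP g1] := eqVneq g 1.
  have T0 : [set: cantor_space] !=set0 by exists (fun=> false).
  exists 1, 1; rewrite mulg1; split=> //; exists setT => //; exact: openT.
have [w [z [gw wz]]] := carryC_moved g1.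
have [s [sw sz so]] := swapP (incomparable_cat [:: false] [:: false] wz).
exists s, (s^-1 * g); rewrite mulVKg; split=> //.
- exists (cylinder (w ++ [:: true])); first exact: open_cylinder.
  split=> [|p]; first exact: cylinder_neq0.
  apply: carryC_fix; apply: so; first exact: (incomparable_sib w false).
  by apply: incomparable_cat; rewrite incomparableC.
- exists (cylinder (w ++ [:: false])); first exact: open_cylinder.
  split=> [|p]; first exact: cylinder_neq0.
  exact: carryC_fix (carryCM (carryC_cat _ gw) (carryCV sw)).
Qed.

Lemma thompsonV_moves_zero : exists k, act k (fun=> false) <> (fun=> false).
Proof.
have [|s [s0 _ _]] := @swapP [:: false] [:: true]; first by [].
exists s => e; have := s0 (fun=> false).
have -> : prepend [:: false] (fun=> false) = (fun=> false).
  by apply/funext => -[|i].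
by rewrite e => /(congr1 (@^~ 0%N)).
Qed.

(** The indicator function of the powers of two is not eventually periodic,
    and only eventually periodic points are fixed by an element that is not
    trivial near them. *)
Lemma thompsonV_free_point : exists y, forall g,
  act g y = y -> locally_trivial act y g.
Proof.
pose y : cantor_space := fun i => [exists k : 'I_i.+1, i == (2 ^ k)%N].
have y2 k : y (2 ^ k)%N.
  have k2 : (k < (2 ^ k).+1)%N by rewrite ltnS ltnW// ltn_expl.
  by apply/existsP; exists (Ordinal k2).
have aper a d : (forall i, y (i + a)%N = y (i + (a + d.+1))%N) -> False.
  move=> per; pose k := (a + d.+1)%N.
  have ak : (a + d.+1 < 2 ^ k)%N by rewrite ltn_expl.
  have := per (2 ^ k - a)%N; rewrite addnA subnK; last first.
    by rewrite ltnW// (leq_trans _ ak)// ltnS leq_addr.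
  rewrite y2 => /esym/existsP[[l _] /= /eqP e].
  have kl : (k < l)%N by rewrite -(ltn_exp2l _ _ (ltnSn 1)) -e addnS ltnS leq_addr.
  have : (2 ^ k.+1 <= 2 ^ l)%N by rewrite leq_exp2l.
  rewrite -e expnS mul2n -addnn leq_add2l leqNgt => /negP; apply.
  by apply: leq_ltn_trans ak; rewrite leq_addl.
exists y => g gy; have [N gN] := carryC_depth g.
have [z gz] := gN _ (size_mkseq y N).
have zy : prepend z (fun i => y (i + N)%N) = y by rewrite -gz prepend_mkseq.
have sz : size z = N.
  have tail i : y (i + N)%N = y (i + size z)%N.
    by have := congr1 (@^~ (i + size z)%N) zy; rewrite /prepend ltnNge leq_addl /= addnK.
  have [lt|lt|//] := ltngtP (size z) N; exfalso.
    have e : (size z + (N - size z).-1.+1 = N)%N by lia.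
    by apply: (@aper (size z) (N - size z).-1) => i; rewrite e tail.
  have e : (N + (size z - N).-1.+1 = size z)%N by lia.
  by apply: (@aper N (size z - N).-1) => i; rewrite e tail.
have zE : z = mkseq y N.
  apply: (@eq_from_nth _ false); rewrite ?size_mkseq// => i; rewrite sz => iN.
  rewrite nth_mkseq//; have := congr1 (@^~ i) zy.
  by rewrite /prepend sz iN.
have : nbhs y (cylinder (mkseq y N)).
  by apply: open_nbhs_nbhs; split; [exact: open_cylinder|exact: cylinder_mkseq].
by apply: filterS => p; apply: carryC_fix; rewrite {2}(esym zE).
Qed.

Theorem thompsonV_URS (U : set (SubG thompsonV)) :
  is_URS U <-> [\/ U = [set trivial_sub thompsonV],
                   U = [set whole_sub thompsonV] |
                   U = stabilizer_URS act].
Proof.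
apply: (@URS_classification _ _ act (fun=> false)).
- exact: cantor_space_hausdorff.
- exact: cantor_space_compact.
- exact: cantor_no_isolated_point.
- exact: act_V_inj.
- exact: thompsonV_expand.
- exact: thompsonV_perfect.
- exact: thompsonV_fragment.
- exact: thompsonV_moves_zero.
- exact: thompsonV_free_point.
Qed.

End ThompsonV.

(** * The circle and its dyadic intervals *)

Section Circle.
Local Open Scope ring_scope.
Variable R : realType.
Implicit Types (x y s t : R) (n m : int) (p : circle R).
Local Notation pi := (@circle_pi R).

Lemma circle_pi_continuous : continuous pi.
Proof. exact: pi_continuous. Qed.

Lemma circle_piD x n : pi (x + n%:~R) = pi x.
Proof. by apply/circle_piP; rewrite addrAC subrr add0r intr_int. Qed.

Lemma circle_pi_eq x y : pi x = pi y -> exists n, x = y + n%:~R.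
Proof.
by move=> /circle_piP/intrP[n e]; exists n; rewrite -e addrC subrK.
Qed.

Lemma open_circle_pi (A : set R) : open A -> open (pi @` A).
Proof.
move=> oA; rewrite /open /= /quotient_open /=.
suff -> : (\pi_(circle R))%qT @^-1` (pi @` A) =
    \bigcup_(n in [set: int]) ((fun x => x + n%:~R) @^-1` A).
  apply: bigcup_open => n _.
  have cn : continuous (fun x : R => x + n%:~R).
    by move=> x; apply: cvgD; [exact: cvg_id|exact: cvg_cst].
  by move/continuousP : cn; exact.
rewrite eqEsubset; split=> [x [y Ay /circle_pi_eq[n e]]|x [n _ Ax]].
  by exists n; rewrite // /preimage /= -e.
by exists (x + n%:~R) => //; rewrite circle_piD.
Qed.

Lemma nbhs_circle_pi x (A : set R) : nbhs x A -> nbhs (pi x) (pi @` A).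
Proof.
rewrite nbhsE => -[B [oB Bx] BA]; rewrite nbhsE; exists (pi @` B).
  by split; [exact: open_circle_pi|exists x].
exact: image_subset.
Qed.

Lemma nbhs_circleP x (A : set (circle R)) : nbhs (pi x) A <-> nbhs x (pi @^-1` A).
Proof.
split=> [|/nbhs_circle_pi]; first exact: circle_pi_continuous.
by apply: filterS => _ [y Ay <-].
Qed.

Lemma circle_pi_repr p : exists x, [/\ 0 <= x, x < 1 & p = pi x].
Proof.
have [x <-] := circle_pi_surj p; exists (x - (Num.floor x)%:~R).
have /andP[fl fu] := floor_itv x; split.
- by rewrite subr_ge0.
- by rewrite ltrBlDl -intrD1.
- by rewrite -mulrNz circle_piD.
Qed.

Lemma int_small n : -1 < (n%:~R : R) -> (n%:~R : R) < 1 -> n = 0.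
Proof.
by rewrite -[1]/(1%:~R) -mulrNz !ltr_int => n1 n2; lia.
Qed.

Lemma circle_pi_inj x y : -1 < x - y -> x - y < 1 -> pi x = pi y -> x = y.
Proof.
move=> xy1 xy2 /circle_pi_eq[n xy].
have nE : n%:~R = x - y by rewrite xy addrAC subrr add0r.
by rewrite xy (@int_small n) ?nE// addr0.
Qed.

Lemma circle_hausdorff : hausdorff_space (circle R).
Proof.
rewrite open_hausdorff => p q; have [x [x0 x1 ->]] := circle_pi_repr p.
have [y [y0 y1 ->]] := circle_pi_repr q => pxy.
have xy : x != y by apply: contraNneq pxy => ->.
pose d := Num.min `|x - y| (1 - `|x - y|) / 2.
have xy1 : `|x - y| < 1 by rewrite ltr_norml; apply/andP; split; lra.
have d0 : 0 < d by rewrite divr_gt0// lt_min normr_gt0 subr_eq0 xy subr_gt0.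
exists (pi @` ball x d, pi @` ball y d).
  by split; apply/mem_set => /=; [exists x|exists y]; rewrite //; exact: ballxx.
split; [exact/open_circle_pi/ball_open|exact/open_circle_pi/ball_open|].
apply/eqP; rewrite -subset0 => _ [[u /= xu <-] [v /= yv]] /circle_pi_eq[n vu].
move: xu yv; rewrite /ball /= vu => xu yv.
have dxy : d *+ 2 <= `|x - y|.
  by rewrite /d -mulr_natr divfK ?pnatr_eq0// ge_min lexx.
have dxy' : d *+ 2 <= 1 - `|x - y|.
  by rewrite /d -mulr_natr divfK ?pnatr_eq0// ge_min lexx orbT.
have H : `|x - y + n%:~R| < d *+ 2.
  have -> : x - y + n%:~R = (x - u) - (y - (u + n%:~R)) by ring.
  by apply: le_lt_trans (ler_normB _ _) _; rewrite mulr2n ltrD.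
have n0 : n = 0.
  have : `|n%:~R : R| < 1.
    have -> : n%:~R = (x - y + n%:~R) - (x - y) by ring.
    apply: le_lt_trans (ler_normB _ _) _; lra.
  by rewrite ltr_norml => /andP[]; exact: int_small.
by move: H; rewrite n0 addr0; lra.
Qed.

Lemma circle_compact : compact [set: circle R].
Proof.
suff -> : [set: circle R] = pi @` `[0, 1].
  apply: continuous_compact; last exact: segment_compact.
  exact/continuous_subspaceT/circle_pi_continuous.
rewrite eqEsubset; split=> // p _; have [x [x0 x1 ->]] := circle_pi_repr p.
by exists x => //; rewrite /= in_itv /= x0 ltW.
Qed.

Lemma circle_no_isolated_point : no_isolated_point (circle R).
Proof.
move=> O p; have [x <-] := circle_pi_surj p => oO Ox.
have : nbhs x (pi @^-1` O) by apply/nbhs_circleP; exact: open_nbhs_nbhs.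
move=> /nbhs_ballP[e /= e0 eO].
pose d := Num.min e 1 / 2.
have d0 : 0 < d by rewrite divr_gt0// lt_min e0 ltr01.
have le : Num.min e 1 <= e by rewrite ge_min lexx.
have l1 : Num.min e 1 <= 1 by rewrite ge_min lexx orbT.
have de : d < e by rewrite /d; lra.
have d1 : d < 1 by rewrite /d; lra.
exists (pi (x + d)).
  by apply: eO; rewrite /ball /= opprD addrA subrr add0r normrN gtr0_norm.
apply/eqP => /circle_pi_inj; rewrite addrAC subrr add0r => /(_ _ d1).
by have -> : -1 < d by [lra]; move=> /(_ erefl); lra.
Qed.

End Circle.

Section Cells.
Local Open Scope ring_scope.
Variable R : realType.
Implicit Types (w z u v : word) (s t x : R).
Local Notation pi := (@circle_pi R).

Lemma pow2_neq0 (n : nat) : 2 ^+ n != 0 :> R.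
Proof. by rewrite expf_neq0// pnatr_eq0. Qed.

(** The affine identification of the unit interval with the dyadic interval of
    the word [w]. *)
Fixpoint cell w s : R := if w is b :: v then (b%:R + cell v s) / 2 else s.

Lemma cell_cat w v s : cell (w ++ v) s = cell w (cell v s).
Proof. by elim: w => //= b w ->. Qed.

Lemma cell_ge0 w s : 0 <= s -> 0 <= cell w s.
Proof. by move=> s0; elim: w => //= b w IH; rewrite divr_ge0// addr_ge0. Qed.

Lemma cell_le1 w s : s <= 1 -> cell w s <= 1.
Proof. by move=> s1; elim: w => //= b w IH; case: b => /=; lra. Qed.

Lemma cell_gt0 w s : 0 < s -> 0 < cell w s.
Proof. by move=> s0; elim: w => //= b w IH; rewrite divr_gt0// ltr_wpDl. Qed.

Lemma cell_lt1 w s : s < 1 -> cell w s < 1.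
Proof. by move=> s1; elim: w => //= b w IH; case: b => /=; lra. Qed.

Lemma cell_affine w s : cell w s = cell w 0 + s / 2 ^+ size w.
Proof.
elim: w => [|b w IH] /=; first by rewrite add0r divr1.
by rewrite IH exprS invfM; field.
Qed.

Lemma cell_inj w z : (forall s, 0 < s -> s < 1 -> cell w s = cell z s) -> w = z.
Proof.
have t1 : 0 < 1 / 3 :> R by lra.
have t2 : 1 / 3 < 1 :> R by lra.
have t3 : 0 < 2 / 3 :> R by lra.
have t4 : 2 / 3 < 1 :> R by lra.
elim: w z => [|b w IH] [|c z] //= wz.
- have := wz _ t1 t2; have := wz _ t3 t4.
  have := @cell_gt0 z _ t1; have := @cell_gt0 z _ t3.
  have := @cell_lt1 z _ t2; have := @cell_lt1 z _ t4.
  by case: c {wz} => /= *; exfalso; lra.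
- have := wz _ t1 t2; have := wz _ t3 t4.
  have := @cell_gt0 w _ t1; have := @cell_gt0 w _ t3.
  have := @cell_lt1 w _ t2; have := @cell_lt1 w _ t4.
  by case: b {wz} => /= *; exfalso; lra.
have bc : b = c.
  have := wz _ t1 t2; have := @cell_gt0 w _ t1; have := @cell_gt0 z _ t1.
  have := @cell_lt1 w _ t2; have := @cell_lt1 z _ t2.
  by case: b {wz}; case: c => //= *; exfalso; lra.
congr cons => //; apply: IH => s s0 s1; have := wz s s0 s1.
by rewrite bc => /(mulIf _)/addrI; apply; rewrite invr_eq0 pnatr_eq0.
Qed.

Lemma cell_cover N x : 0 <= x -> x <= 1 -> exists w s,
  [/\ size w = N, 0 <= s, s <= 1 & x = cell w s].
Proof.
elim: N x => [|N IH] x x0 x1; first by exists [::], x.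
have [xh|xh] := leP x (1 / 2).
  have [||w [s [sw s0 s1 e]]] := IH (2 * x); [lra|lra|].
  exists (false :: w), s; split=> //=; first by rewrite sw.
  by rewrite -e; lra.
have [||w [s [sw s0 s1 e]]] := IH (2 * x - 1); [lra|lra|].
exists (true :: w), s; split=> //=; first by rewrite sw.
by rewrite -e; lra.
Qed.

Lemma cell_of_nat l i : (i < 2 ^ l)%N -> exists2 w, size w = l &
  forall s, cell w s = (i%:R + s) / 2 ^+ l.
Proof.
elim: l i => [|l IH] i il.
  by exists [::] => // s; move: il; rewrite expn0 ltnS leqn0 => /eqP ->; rewrite add0r divr1.
have e2 := pow2_neq0 l.
have [il'|il'] := ltnP i (2 ^ l).
  have [w sw wE] := IH i il'; exists (false :: w) => [|s] /=; first by rewrite sw.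
  by rewrite wE exprS; field.
have [|w sw wE] := IH (i - 2 ^ l)%N.
  by rewrite ltn_subLR// addnn -mul2n -expnS.
exists (true :: w) => [|s] /=; first by rewrite sw.
by rewrite wE natrB// natrX exprS; field.
Qed.

Lemma nat_of_cell w : exists2 i, (i < 2 ^ size w)%N &
  forall s, cell w s = (i%:R + s) / 2 ^+ size w.
Proof.
elim: w => [|b w [i il iE]]; first by exists 0%N => // s /=; rewrite add0r divr1.
have e2 := pow2_neq0 (size w).
exists (b * 2 ^ size w + i)%N => [|s] /=.
  by rewrite expnS mul2n -addnn; case: b; rewrite ?mul1n ?mul0n ?ltn_add2l//
    ltn_addr.
by rewrite iE natrD natrM natrX exprS; field.
Qed.

Lemma cell_interior_inj w z s t : 0 < s < 1 -> 0 <= t <= 1 ->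
  pi (cell w s) = pi (cell z t) -> cell w s = cell z t.
Proof.
move=> /andP[s0 s1] /andP[t0 t1]; apply: circle_pi_inj.
  by have := @cell_gt0 w _ s0; have := @cell_le1 z _ t1; lra.
by have := @cell_lt1 w _ s1; have := @cell_ge0 z _ t0; lra.
Qed.

Lemma cell_prefix_disjoint w z s t : incomparable w z -> 0 < s < 1 ->
  0 <= t <= 1 -> cell w s <> cell z t.
Proof.
move=> + /andP[s0 s1] /andP[t0 t1].
elim: w z => [|b w IH] [|c z] //.
have := @cell_gt0 w _ s0; have := @cell_lt1 w _ s1.
have := @cell_ge0 z _ t0; have := @cell_le1 z _ t1 => z1 z0 w1 w0 wz.
have [bc|bc] := eqVneq b c.
  rewrite bc /= => /(mulIf _)/addrI e; apply: (IH z) => //.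
    by move: wz; rewrite bc /incomparable /= eqxx.
  by apply: e; rewrite invr_eq0 pnatr_eq0.
by case: b bc wz; case: c => //= *; lra.
Qed.

End Cells.

(** * Elements of T given by lifts *)

Section BuildingT.
Local Open Scope ring_scope.
Variable R : realType.
Implicit Types (x y t c : R) (n m k : int).
Local Notation pi := (@circle_pi R).
Local Notation act := (thompsonT_act R).

Lemma dyadicD x y : dyadic x -> dyadic y -> dyadic (x + y).
Proof.
move=> [a [i ->]] [b [j ->]]; exists (a * 2 ^+ j + b * 2 ^+ i), (i + j)%N.
have e2 := pow2_neq0 R.
by rewrite intrD !intrM !rmorphXn /= exprD; field; rewrite !e2.
Qed.

Lemma dyadicN x : dyadic x -> dyadic (- x).
Proof. by move=> [a [i ->]]; exists (- a), i; rewrite intrN mulNr. Qed.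

Lemma dyadic_int n : dyadic (n%:~R : R).
Proof. by exists n, 0%N; rewrite expr0 divr1. Qed.

Lemma dyadic_half x : dyadic x -> dyadic (x / 2).
Proof.
by move=> [a [i ->]]; exists a, i.+1; rewrite exprSr invfM mulrA.
Qed.

Lemma dyadic_double x : dyadic x -> dyadic (2 * x).
Proof. by move=> dx; rewrite mulr2n mulrDl mul1r; exact: dyadicD. Qed.

Lemma dyadic_expz x k : dyadic x -> dyadic (2 ^ k * x).
Proof.
move=> dx; case: k => n.
  elim: n => [|n IH]; first by rewrite expr0z mul1r.
  rewrite -[2 ^ n.+1]/(2 ^+ n.+1) exprS -mulrA; exact: dyadic_double.
rewrite NegzE -exprnN.
elim: n => [|n IH]; first by rewrite mulrC; exact: dyadic_half.
rewrite exprSr invfM -mulrA mulrCA mulrC; apply: dyadic_half.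
exact: IH.
Qed.

Lemma dyadic_cell w x : dyadic x -> dyadic (cell w x).
Proof.
move=> dx; elim: w => //= b w IH; apply: dyadic_half; apply: dyadicD => //.
by case: b; [exact: (dyadic_int 1)|exact: (dyadic_int 0)].
Qed.

Lemma circle_dyadicP x : circle_dyadic (pi x) <-> dyadic x.
Proof.
split=> [[y dy /esym/circle_pi_eq[n ->]]|dx]; last by exists x.
exact: dyadicD (dyadic_int n).
Qed.

Section Lift.
Variable H : homeo R.
Hypothesis HD : forall x n, H (x + n%:~R) = H x + n%:~R.

Lemma lift_invD x n : homeo_inv H (x + n%:~R) = homeo_inv H x + n%:~R.
Proof. by apply: (can_inj (@homeoK _ H)); rewrite HD !homeoVK. Qed.

Lemma lift_map (h : R -> R) : (forall x n, h (x + n%:~R) = h x + n%:~R) ->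
  continuous h -> exists f : circle R -> circle R,
  continuous f /\ forall x, f (pi x) = pi (h x).
Proof.
move=> hD ch; pose f (p : circle R) := pi (h (repr p)).
have fE x : f (pi x) = pi (h x).
  have [n xn] : exists n, repr (pi x) = x + n%:~R.
    by apply: circle_pi_eq; rewrite /circle_pi reprK.
  by rewrite /f xn hD circle_piD.
exists f; split=> //; apply/quotient_continuous.
have -> : f \o \pi_(circle R)%qT = pi \o h by apply/funext => x; exact: fE.
by move=> x; apply: continuous_comp; [exact: ch|exact: circle_pi_continuous].
Qed.

Hypothesis Hinc : {homo H : x y / x < y}.
Hypothesis Haff : exists bs : seq R, (forall b, b \in bs -> dyadic b) /\
  forall x, (forall b, b \in bs -> pi x <> pi b) ->
    exists k c, \forall y \near x, H y = 2 ^ k * y + c.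
Hypothesis Hdyadic : forall x, dyadic x -> dyadic (H x).
Hypothesis HdyadicV : forall x, dyadic x -> dyadic (homeo_inv H x).

(** A lift is easier to define than a map of the circle: continuity passes to the
    quotient, and breakpoints need only be listed modulo 1. *)
Lemma thompsonT_of_lift : exists g, forall x, act g (pi x) = pi (H x).
Proof.
have [f [cf fE]] := lift_map HD (@homeo_continuous _ H).
have [f' [cf' f'E]] := lift_map lift_invD (@homeo_inv_continuous _ H).
have fK : cancel f f'.
  by move=> p; have [x <-] := circle_pi_surj p; rewrite fE f'E homeoK.
have f'K : cancel f' f.
  by move=> p; have [x <-] := circle_pi_surj p; rewrite f'E fE homeoVK.
pose g := Homeo fK f'K cf cf'.
have gT : g \in mem_sub (mk_subG (@thompsonT_closed R)).
  rewrite mem_mkSub; apply/asboolP; split.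
  - by exists H; split=> // x; exact: fE.
  - have [bs [bsD bsA]] := Haff.
    exists [set p | exists2 b, b \in bs & p = pi b]; split.
    + have -> : [set p | exists2 b, b \in bs & p = pi b] = pi @` [set` bs].
        by rewrite eqEsubset; split=> p [b bb e]; exists b.
      by apply: finite_image; exact: finite_seq.
    + by move=> _ [b /bsD db ->]; exists b.
    + move=> x nB; have [|k [c Hk]] := bsA x.
        by move=> b bb e; apply: nB; exists b.
      by exists k, c; apply: filterS Hk => y <-; exact: fE.
  - rewrite eqEsubset; split=> [_ [_ [x dx <-] <-]|_ [x dx <-]].
      by rewrite /= fE; apply/circle_dyadicP; exact: Hdyadic.
    exists (pi (homeo_inv H x)); last by rewrite /= fE homeoVK.
    by apply/circle_dyadicP; exact: HdyadicV.
by exists (exist (fun x : homeo (circle R) => x \in mem_sub (mk_subG (@thompsonT_closed R))) g gT).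
Qed.

End Lift.

Lemma half_turn : exists g, forall x, act g (pi x) = pi (x + 1 / 2).
Proof.
have c1 d : continuous (fun x : R => x + d).
  by move=> x; apply: cvgD; [exact: cvg_id|exact: cvg_cst].
have hK : cancel (fun x : R => x + 1 / 2) (fun x => x + - (1 / 2)).
  by move=> x; rewrite addrK.
have hVK : cancel (fun x : R => x + - (1 / 2)) (fun x => x + 1 / 2).
  by move=> x; rewrite addrNK.
pose H := Homeo hK hVK (c1 _) (c1 _).
have dh : dyadic (1 / 2 : R) by apply: dyadic_half; exact: (dyadic_int 1).
apply: (@thompsonT_of_lift H).
- by move=> x n /=; rewrite addrAC.
- by move=> x y xy /=; rewrite ltrD2r.
- exists [::]; split=> // x _; exists 0, (1 / 2); apply: filterE => y.
  by rewrite expr0z mul1r.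
- by move=> x dx; exact: dyadicD.
- by move=> x dx; apply: dyadicD => //; exact: dyadicN.
Qed.

Section Periodize.
Variable f : R -> R.
Hypothesis finc : {homo f : x y / x < y}.
Hypothesis f0 : forall y, y <= 0 -> f y = y.
Hypothesis f1 : forall y, 1 <= y -> f y = y.
Hypothesis cf : continuous f.

Definition periodize x := f (x - (Num.floor x)%:~R) + (Num.floor x)%:~R.

Lemma unit_stable t : 0 <= t < 1 -> 0 <= f t < 1.
Proof.
move=> /andP[t0 t1]; apply/andP; split; last by rewrite -(f1 (lexx 1)) finc.
by move: t0; rewrite le_eqVlt => /predU1P[<-|/finc/ltW]; rewrite f0.
Qed.

Lemma frac_itv x : 0 <= x - (Num.floor x)%:~R < 1.
Proof.
have /andP[fl fu] := floor_itv x.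
by rewrite subr_ge0 fl ltrBlDl -intrD1 fu.
Qed.

Lemma floor_periodize x : Num.floor (periodize x) = Num.floor x.
Proof.
apply: floor_def; have /andP[f0' f1'] := unit_stable (frac_itv x).
by rewrite /periodize intrD1 lerDr f0' addrC ltrD2l.
Qed.

Lemma periodizeD x n : periodize (x + n%:~R) = periodize x + n%:~R.
Proof.
rewrite /periodize floorDrz ?intr_int// intrKfloor intrD.
by rewrite opprD addrACA subrr addr0 addrA.
Qed.

Lemma periodize_unit x : 0 <= x <= 1 -> periodize x = f x.
Proof.
move=> /andP[x0]; rewrite le_eqVlt => /predU1P[->|x1].
  have := periodizeD 0 1; rewrite add0r => ->.
  by rewrite /periodize floor0 subr0 addr0 f0// f1// add0r.
rewrite /periodize (@floor_def _ x 0) ?subr0 ?addr0// x0.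
by rewrite add0r.
Qed.

Lemma periodize_inc : {homo periodize : x y / x < y}.
Proof.
move=> x y xy; have := le_floor (ltW xy); rewrite le_eqVlt => /predU1P[e|lt].
  by rewrite /periodize e ltrD2r finc// ltrD2r.
have /andP[_] := floor_itv (periodize x); rewrite floor_periodize => px.
have /andP[py _] := floor_itv (periodize y); rewrite floor_periodize in py.
apply: lt_le_trans px (le_trans _ py).
by rewrite ler_int -ltzD1 ltzD1 lezD1.
Qed.

(** Around [x], the periodic extension is a sum of two translates of [f] with
    disjoint variation, which avoids treating the integers apart. *)
Lemma periodize_continuous : continuous periodize.
Proof.
move=> x; set n := Num.floor x.
have /andP[nx xn] := floor_itv x; rewrite intrD1 -/n in nx xn.
pose g y := f (y - n%:~R) + f (y - n%:~R + 1) - (y - n%:~R + 1) + n%:~R.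
have gE y : n%:~R - 1 < y -> y < n%:~R + 1 -> periodize y = g y.
  move=> y1 y2; rewrite /periodize; have [ny|yn] := leP n%:~R y.
    rewrite (@floor_def _ y n) ?intrD1 ?ny ?y2// /g.
    by rewrite [f (_ + 1)]f1; lra.
  have -> : Num.floor y = n - 1.
    by apply: floor_def; rewrite subrK intrD yn andbT ltW// -mulrNz.
  rewrite intrD mulrNz mulr1z opprD opprK [y + (_ + 1)]addrA /g [f (y - n%:~R)]f0; last lra.
  by lra.
have cg : {for x, continuous g}.
  have sub : {for x, continuous (fun y : R => y - n%:~R)}.
    by apply: cvgD; [exact: cvg_id|exact: cvg_cst].
  have sub1 : {for x, continuous (fun y : R => y - n%:~R + 1)}.
    by apply: cvgD; [exact: sub|exact: cvg_cst].
  rewrite /g; apply: cvgD; last exact: cvg_cst.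
  apply: cvgB; last exact: sub1.
  apply: cvgD; apply: continuous_comp => //; exact: cf.
have near_x : \forall y \near x, g y = periodize y.
  have x1 : n%:~R - 1 < x by lra.
  have x2 : x < n%:~R + 1 by [].
  by apply: filterS2 (lt_nbhsl x2) (lt_nbhsr x1) => y y2 y1; rewrite gE.
rewrite /continuous_at -(nbhs_singleton near_x).
apply: cvg_trans cg; apply: near_eq_cvg.
exact: near_x.
Qed.

End Periodize.

Lemma thompsonT_of_unit_map (f f' : R -> R) :
  cancel f f' -> cancel f' f -> continuous f -> continuous f' ->
  {homo f : x y / x < y} ->
  (forall y, y <= 0 -> f y = y) -> (forall y, 1 <= y -> f y = y) ->
  (exists bs : seq R, (forall b, b \in bs -> dyadic b) /\
    forall t, 0 < t < 1 -> t \notin bs ->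
      exists k c, \forall y \near t, f y = 2 ^ k * y + c) ->
  (forall x, dyadic x -> dyadic (f x)) ->
  (forall x, dyadic x -> dyadic (f' x)) ->
  exists g, forall x, 0 <= x <= 1 -> act g (pi x) = pi (f x).
Proof.
move=> fK f'K cf cf' finc f0 f1 [bs [bsD bsA]] df df'.
have f'inc : {homo f' : x y / x < y}.
  move=> x y xy; rewrite ltNge; apply/negP; rewrite le_eqVlt => /predU1P[e|/finc].
    by move: xy; rewrite -(f'K x) -(f'K y) e ltxx.
  by rewrite !f'K => /(lt_trans xy); rewrite ltxx.
have f'0 y : y <= 0 -> f' y = y by move=> y0; rewrite -{1}(f0 y y0) fK.
have f'1 y : 1 <= y -> f' y = y by move=> y1; rewrite -{1}(f1 y y1) fK.
have perK h h' : {homo h : x y / x < y} -> (forall y, y <= 0 -> h y = y) ->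
    (forall y, 1 <= y -> h y = y) -> cancel h h' ->
    cancel (periodize h) (periodize h').
  move=> hinc h0 h1 hK x; rewrite {1}/periodize floor_periodize// /periodize addrK hK.
  by rewrite subrK.
pose H := Homeo (perK _ _ finc f0 f1 fK) (perK _ _ f'inc f'0 f'1 f'K)
  (periodize_continuous f0 f1 cf) (periodize_continuous f'0 f'1 cf').
have dfloor h : (forall x, dyadic x -> dyadic (h x)) ->
    forall x, dyadic x -> dyadic (periodize h x).
  move=> dh x dx; apply: dyadicD (dyadic_int _); apply: dh.
  by apply: dyadicD => //; apply: dyadicN; exact: dyadic_int.
have [|||||g gE] := @thompsonT_of_lift H.
- exact: periodizeD.
- exact: periodize_inc.
- exists (0 :: bs); split.
    by move=> b; rewrite inE => /predU1P[->|/bsD//]; exact: (dyadic_int 0).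
  move=> x xbs; set n := Num.floor x.
  have xn b : b \in 0 :: bs -> x - n%:~R != b.
    by move=> /xbs; apply: contra_notN => /eqP <-; rewrite -mulrNz circle_piD.
  have /andP[t0 t1] := frac_itv x; rewrite -/n in t0 t1.
  have {}t0 : 0 < x - n%:~R by rewrite lt_def t0 andbT xn// mem_head.
  have [||k [c fkc]] := bsA (x - n%:~R); first by rewrite t0 t1.
    by apply/negP => xb; have := xn _ (mem_behead (s := 0 :: bs) xb); rewrite eqxx.
  exists k, (c - 2 ^ k * n%:~R + n%:~R).
  have sub : {for x, continuous (fun y : R => y - n%:~R)}.
    by apply: cvgD; [exact: cvg_id|exact: cvg_cst].
  have near_f : \forall y \near x, f (y - n%:~R) = 2 ^ k * (y - n%:~R) + c.
    exact: (sub _ fkc).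
  have nx : n%:~R < x by rewrite -subr_gt0.
  have xn1 : x < n%:~R + 1 by rewrite -ltrBlDl.
  apply: filterS3 near_f (lt_nbhsl xn1) (lt_nbhsr nx) => y fy y1 y0.
  rewrite /= /periodize (@floor_def _ y n) ?intrD1 ?(ltW y0)// fy.
  by rewrite mulrBr; ring.
- exact: dfloor.
- exact: dfloor.
exists g => x x01; rewrite gE /= periodize_unit//.
Qed.

End BuildingT.

(** * Rotations of dyadic intervals *)

Section RotationMap.
Local Open Scope ring_scope.
Variable R : realType.
Implicit Types (x y t c : R) (n m k : int).
Local Notation pi := (@circle_pi R).
Local Notation act := (thompsonT_act R).
Variables (a l : R).
Hypotheses (a0 : 0 <= a) (al1 : a + l <= 1).
Hypotheses (da : dyadic a) (dl : dyadic l).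

(** The slopes are 2, 1 and 1/2 on the first quarter, the second quarter and the
    second half of the interval of length [l] at [a]. The formula by maxima and
    minima makes continuity and monotonicity immediate. *)
Definition rot_map y :=
  Num.max y (Num.min (2 * y - a) (Num.min (y + l / 4) ((y + a + l) / 2))).

Definition rot_inv y :=
  Num.min y (Num.max ((y + a) / 2) (Num.max (y - l / 4) (2 * y - a - l))).

Let max_spec x y : (Num.max x y = x /\ y <= x) \/ (Num.max x y = y /\ x <= y).
Proof. by have [xy|xy] := leP x y; [right|left; rewrite (ltW xy)]. Qed.

Let min_spec x y : (Num.min x y = x /\ x <= y) \/ (Num.min x y = y /\ y <= x).
Proof. by have [xy|xy] := leP x y; [left|right; rewrite (ltW xy)]. Qed.

Local Ltac minmax :=
  repeat match goal with
  | |- context [Order.max ?u ?v] => move: (max_spec u v); move: (Order.max u v) => ?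
  | |- context [Order.min ?u ?v] => move: (min_spec u v); move: (Order.min u v) => ?
  end;
  repeat (case=> [[? ?]|[? ?]]); lra.

Lemma rot_map_pieces y :
  [/\ y <= a -> rot_map y = y,
      a <= y <= a + l / 4 -> rot_map y = 2 * y - a,
      a + l / 4 <= y <= a + l / 2 -> rot_map y = y + l / 4,
      a + l / 2 <= y <= a + l -> rot_map y = (y + a + l) / 2 &
      a + l <= y -> rot_map y = y].
Proof. by rewrite /rot_map; split=> [?|/andP[? ?]|/andP[? ?]|/andP[? ?]|?]; minmax. Qed.

Lemma rot_inv_pieces y :
  [/\ y <= a -> rot_inv y = y,
      a <= y <= a + l / 2 -> rot_inv y = (y + a) / 2,
      a + l / 2 <= y <= a + l * 3 / 4 -> rot_inv y = y - l / 4,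
      a + l * 3 / 4 <= y <= a + l -> rot_inv y = 2 * y - a - l &
      a + l <= y -> rot_inv y = y].
Proof. by rewrite /rot_inv; split=> [?|/andP[? ?]|/andP[? ?]|/andP[? ?]|?]; minmax. Qed.

Variant rot_piece y : Prop :=
  | RotPiece0 of y <= a
  | RotPiece1 of a < y <= a + l / 4
  | RotPiece2 of a + l / 4 < y <= a + l / 2
  | RotPiece3 of a + l / 2 < y <= a + l
  | RotPiece4 of a + l < y.

Lemma rot_pieceP y : rot_piece y.
Proof.
have [y0|y0] := leP y a; first exact: RotPiece0.
have [y1|y1] := leP y (a + l / 4); first by apply: RotPiece1; rewrite y0.
have [y2|y2] := leP y (a + l / 2); first by apply: RotPiece2; rewrite y1.
have [y3|y3] := leP y (a + l); first by apply: RotPiece3; rewrite y2.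
exact: RotPiece4.
Qed.

Lemma rot_mapK : cancel rot_map rot_inv.
Proof.
move=> y; have [m0 m1 m2 m3 m4] := rot_map_pieces y.
case: (rot_pieceP y) => [y0|/andP[y0 y1]|/andP[y1 y2]|/andP[y2 y3]|y4].
- by rewrite m0//; have [->] := rot_inv_pieces y.
- have [_ e _ _ _] := rot_inv_pieces (2 * y - a).
  by rewrite m1 ?(ltW y0)// e; [lra|apply/andP; split; lra].
- have [_ _ e _ _] := rot_inv_pieces (y + l / 4).
  by rewrite m2 ?(ltW y1)// e; [lra|apply/andP; split; lra].
- have [_ _ _ e _] := rot_inv_pieces ((y + a + l) / 2).
  by rewrite m3 ?(ltW y2)// e; [lra|apply/andP; split; lra].
- by rewrite m4 ?ltW//; have [_ _ _ _ ->] := rot_inv_pieces y; rewrite ?ltW.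
Qed.

Lemma rot_invK : cancel rot_inv rot_map.
Proof.
move=> y; have [m0 m1 m2 m3 m4] := rot_inv_pieces y.
have [y0|y0] := leP y a.
  by rewrite m0//; have [->] := rot_map_pieces y.
have [y1|y1] := leP y (a + l / 2).
  have [_ e _ _ _] := rot_map_pieces ((y + a) / 2).
  by rewrite m1 ?(ltW y0)// e; [lra|apply/andP; split; lra].
have [y2|y2] := leP y (a + l * 3 / 4).
  have [_ _ e _ _] := rot_map_pieces (y - l / 4).
  by rewrite m2 ?(ltW y1)// e; [lra|apply/andP; split; lra].
have [y3|y3] := leP y (a + l).
  have [_ _ _ e _] := rot_map_pieces (2 * y - a - l).
  by rewrite m3 ?(ltW y2)// e; [lra|apply/andP; split; lra].
by rewrite m4 ?ltW//; have [_ _ _ _ ->] := rot_map_pieces y; rewrite ?ltW.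
Qed.

Let max_lt (u v u' v' : R) : u < u' -> v < v' -> Num.max u v < Num.max u' v'.
Proof.
move=> uu vv; case: (max_spec u v) => [[-> ?]|[-> ?]];
by case: (max_spec u' v') => [[-> ?]|[-> ?]]; lra.
Qed.

Let min_lt (u v u' v' : R) : u < u' -> v < v' -> Num.min u v < Num.min u' v'.
Proof.
move=> uu vv; case: (min_spec u v) => [[-> ?]|[-> ?]];
by case: (min_spec u' v') => [[-> ?]|[-> ?]]; lra.
Qed.

Lemma rot_map_inc : {homo rot_map : x y / x < y}.
Proof.
by move=> x y xy; apply: max_lt => //; apply: min_lt; [lra|apply: min_lt; lra].
Qed.

Local Ltac cont := do ?[exact: cvg_id|exact: cvg_cst|apply: cvgD|apply: cvgN|apply: cvgM].

Lemma rot_map_continuous : continuous rot_map.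
Proof.
move=> y; apply: (@continuous_max R _ id); first exact: cvg_id.
apply: (@continuous_min R _ (fun y : R => 2 * y - a)); first by cont.
apply: (@continuous_min R _ (fun y : R => y + l / 4) (fun y => (y + a + l) / 2)); by cont.
Qed.

Lemma rot_inv_continuous : continuous rot_inv.
Proof.
move=> y; apply: (@continuous_min R _ id); first exact: cvg_id.
apply: (@continuous_max R _ (fun y : R => (y + a) / 2)); first by cont.
apply: (@continuous_max R _ (fun y : R => y - l / 4) (fun y => 2 * y - a - l)); by cont.
Qed.

Let dl4 : dyadic (l / 4).
Proof.
by have := dyadic_half (dyadic_half dl); rewrite -mulrA -invfM -natrM.
Qed.

Lemma rot_map_dyadic y : dyadic y -> dyadic (rot_map y).
Proof.
move=> dy; rewrite /rot_map /Num.max /Num.min.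
have d1 : dyadic (2 * y - a) by apply: dyadicD (dyadic_double dy) (dyadicN da).
have d2 : dyadic (y + l / 4) by apply: dyadicD.
have d3 : dyadic ((y + a + l) / 2).
  by apply: dyadic_half; do 2 ?apply: dyadicD.
by repeat (case: ifP => _).
Qed.

Lemma rot_inv_dyadic y : dyadic y -> dyadic (rot_inv y).
Proof.
move=> dy; rewrite /rot_inv /Num.max /Num.min.
have d1 : dyadic (2 * y - a - l).
  by apply: dyadicD (dyadicN dl); apply: dyadicD (dyadic_double dy) (dyadicN da).
have d2 : dyadic (y - l / 4) by apply: dyadicD (dyadicN _).
have d3 : dyadic ((y + a) / 2) by apply: dyadic_half; apply: dyadicD.
by repeat (case: ifP => _).
Qed.

Lemma rotation_exists : exists g, forall x, 0 <= x <= 1 ->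
  act g (pi x) = pi (rot_map x).
Proof.
apply: (@thompsonT_of_unit_map R rot_map rot_inv).
- exact: rot_mapK.
- exact: rot_invK.
- exact: rot_map_continuous.
- exact: rot_inv_continuous.
- exact: rot_map_inc.
- by move=> y y0; have [m0 _ _ _ _] := rot_map_pieces y; apply: m0; exact: le_trans y0 a0.
- by move=> y y1; have [_ _ _ _ m4] := rot_map_pieces y; apply: m4; exact: le_trans al1 y1.
- exists [:: a; a + l / 4; a + l / 2; a + l]; split.
    move=> b; rewrite !inE => /or4P[] /eqP -> //; apply: dyadicD => //.
    exact: dyadic_half.
  move=> t _; rewrite !inE !negb_or => /and4P[ta tb tc td].
  have piece k c u v : u < t -> t < v ->
      (forall y, u <= y <= v -> rot_map y = 2 ^ k * y + c) ->
      exists k c, \forall y \near t, rot_map y = 2 ^ k * y + c.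
    move=> ut tv H; exists k, c.
    apply: filterS2 (lt_nbhsl tv) (lt_nbhsr ut) => y yv uy.
    by apply: H; rewrite !ltW.
  have two1 : 2 ^ (1 : int) = 2 :> R by [].
  have twoN1 : 2 ^ (-1 : int) = 2^-1 :> R by rewrite exprN1.
  case: (rot_pieceP t) => [t0|/andP[t0 t1]|/andP[t1 t2]|/andP[t2 t3]|t4].
  + apply: (piece 0 0 (t - 1) a) => [||y /andP[_ ya]].
    * by rewrite ltrBlDr ltrDl.
    * by rewrite lt_neqAle ta.
    * by have [m0 _ _ _ _] := rot_map_pieces y; rewrite expr0z mul1r addr0 m0.
  + apply: (piece 1 (- a) a (a + l / 4)) => // [|y yy]; first by rewrite lt_neqAle tb.
    by have [_ m1 _ _ _] := rot_map_pieces y; rewrite two1 m1.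
  + apply: (piece 0 (l / 4) (a + l / 4) (a + l / 2)) => // [|y yy]; first by rewrite lt_neqAle tc.
    by have [_ _ m2 _ _] := rot_map_pieces y; rewrite expr0z mul1r m2.
  + apply: (piece (-1) ((a + l) / 2) (a + l / 2) (a + l)) => // [|y yy].
      by rewrite lt_neqAle td.
    by have [_ _ _ m3 _] := rot_map_pieces y; rewrite twoN1 m3//; field.
  + apply: (piece 0 0 (a + l) (t + 1)) => // [|y /andP[ya _]]; first by rewrite ltrDl.
    by have [_ _ _ _ m4] := rot_map_pieces y; rewrite expr0z mul1r addr0 m4.
- exact: rot_map_dyadic.
- exact: rot_inv_dyadic.
Qed.

End RotationMap.

(** * Elements of T on small dyadic intervals *)

Section ThompsonTCells.
Local Open Scope ring_scope.
Variable R : realType.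
Implicit Types (g h : thompsonT R) (u v w z : word) (x y s t c : R).
Implicit Types (n m k : int).
Local Notation pi := (@circle_pi R).
Local Notation act := (thompsonT_act R).

Definition carryT g w z := forall s, 0 <= s <= 1 ->
  act g (pi (cell w s)) = pi (cell z s).

Lemma cell_unit w s : 0 <= s <= 1 -> 0 <= cell w s <= 1.
Proof. by move=> /andP[s0 s1]; rewrite cell_ge0// cell_le1. Qed.

Lemma carryT1 w : carryT 1%g w w.
Proof. by move=> s _; rewrite act1. Qed.

Lemma carryTM g h u v w : carryT h u v -> carryT g v w -> carryT (g * h)%g u w.
Proof. by move=> hu gv s s01; rewrite actM hu// gv. Qed.

Lemma carryTV g w z : carryT g w z -> carryT g^-1%g z w.
Proof. by move=> gw s s01; rewrite -gw// actK. Qed.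

Lemma carryT_cat g w z v : carryT g w z -> carryT g (w ++ v) (z ++ v).
Proof. by move=> gw s s01; rewrite !cell_cat gw// cell_unit. Qed.

Lemma carryT1_eq w z : carryT 1%g w z -> w = z.
Proof.
move=> wz; apply: (@cell_inj R) => s s0 s1.
by apply: cell_interior_inj; rewrite ?s0 ?ltW// -wz ?act1// !ltW.
Qed.

Lemma act_T_inj : injective act.
Proof. exact: val_inj. Qed.

Lemma circle_cell N (p : circle R) : exists w s,
  [/\ size w = N, 0 <= s <= 1 & p = pi (cell w s)].
Proof.
have [x [x0 x1 ->]] := circle_pi_repr p.
have [w [s [sw s0 s1 ->]]] := cell_cover N x0 (ltW x1).
by exists w, s; rewrite s0 s1.
Qed.

Lemma carryT_sep g N : (forall w, size w = N -> carryT g w w) -> g = 1%g.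
Proof.
move=> gN; apply: act_T_inj; apply: homeoP => p; rewrite act1.
by have [w [s [sw s01 ->]]] := circle_cell N p; rewrite gN.
Qed.

Definition locally_affine (f : R -> R) x a :=
  exists c, \forall y \near x, f y = a * y + c.

Lemma thompsonT_lift g : exists f : homeo R,
  {homo f : x y / x < y} /\ forall x, act g (pi x) = pi (f x).
Proof. by have /asboolP[[f [f1 f2]] _ _] := valP g; exists f. Qed.

(** On the level of lifts, a slope determines an honest affine germ: a
    continuous function with integer values is locally constant. *)
Lemma lift_locally_affine g (f : homeo R) x a :
  (forall x, act g (pi x) = pi (f x)) -> affine_near (val g) x a ->
  locally_affine f x a.
Proof.
move=> fE [c gc]; pose d y := f y - (a * y + c).
have cd : {for x, continuous d}.
  apply: cvgB; first exact: homeo_continuous.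
  by apply: cvgD; [apply: cvgM; [exact: cvg_cst|exact: cvg_id]|exact: cvg_cst].
have dint y : act g (pi y) = pi (a * y + c) -> exists n, d y = n%:~R.
  rewrite fE => /circle_pi_eq[n e]; exists n.
  by rewrite /d e addrAC subrr add0r.
have [n0 dx] := dint x (nbhs_singleton gc).
exists (c + n0%:~R).
have near1 : \forall y \near x, `|d x - d y| < 1.
  by have /cvgrPdist_lt := cd; apply.
apply: filterS2 gc near1 => y gy dy; have [n ny] := dint y gy.
move: dy; rewrite dx ny -intrB ltr_norml => /andP[d1 d2].
have /eqP := int_small d1 d2; rewrite subr_eq0 => /eqP n0n.
by rewrite addrA n0n -ny /d addrC subrK.
Qed.

Lemma locally_affine_slope (f : R -> R) x a c a' c' :
  (\forall y \near x, f y = a * y + c) -> (\forall y \near x, f y = a' * y + c') ->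
  a = a' /\ c = c'.
Proof.
move=> fa fa'; have /nbhs_ballP[e /= e0 He] :
    nbhs x [set y | f y = a * y + c /\ f y = a' * y + c'] by exact: filterI.
have [fx fx'] := He x (ballxx _ e0).
have [|fy fy'] := He (x + e / 2).
  rewrite /ball /= opprD addrA subrr add0r normrN gtr0_norm ?divr_gt0//.
  by rewrite ltr_pdivrMr// ltr_pMr// ltr1n.
have e2 : e / 2 != 0 by rewrite gt_eqF// divr_gt0.
have : (a - a') * (e / 2) = 0.
  have E1 : a * (x + e / 2) + c = a' * (x + e / 2) + c' by rewrite -fy -fy'.
  have E2 : a * x + c = a' * x + c' by rewrite -fx -fx'.
  have -> : (a - a') * (e / 2) = (a * (x + e / 2) + c) - (a * x + c) -
    ((a' * (x + e / 2) + c') - (a' * x + c')) by ring.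
  by rewrite E1 E2 subrr.
move=> /eqP; rewrite mulf_eq0 (negbTE e2) orbF subr_eq0 => /eqP aa'.
split=> //; move: fx'; rewrite fx aa'; exact: addrI.
Qed.

(** A locally affine function on an interval is affine: the set where a given
    affine formula holds locally is open and closed. *)
Lemma affine_on_interval (f : R -> R) x0 x1 :  x0 < x1 ->
  (forall x, x0 < x < x1 -> exists a, locally_affine f x a) ->
  exists a c, [/\ exists2 x, x0 < x < x1 & \forall y \near x, f y = a * y + c &
    forall x, x0 < x < x1 -> f x = a * x + c].
Proof.
move=> x01 floc; pose m := (x0 + x1) / 2.
have m01 : x0 < m < x1 by rewrite /m; apply/andP; split; lra.
have [a [c fm]] := floc m m01; exists a, c; split; first by exists m.
pose I := [set` `]x0, x1[]; pose A : set R := [set x | \forall y \near x, f y = a * y + c].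
have oA : open A by rewrite openE => x /nbhs_interior.
have cI : connected I by apply/connected_intervalP/interval_is_interval.
have AI : I `&` A = I.
  apply: cI.
  - by exists m; split=> //; rewrite /I /= in_itv.
  - by exists A.
  - exists (closure A); first exact: closed_closure.
    rewrite eqEsubset; split=> x [Ix Ax]; split=> //; first exact: subset_closure.
    move: Ix; rewrite /I /= in_itv /= => /floc[b [d fb]].
    have [y [Ay fy]] := Ax _ (nbhs_interior fb).
    have [ab cd] := locally_affine_slope fy Ay.
    by rewrite /A /= -ab -cd.
move=> x xI; have : (I `&` A) x by rewrite AI /I /= in_itv.
by case=> _; exact: nbhs_singleton.
Qed.

Lemma affine_closed_interval (f : R -> R) x0 x1 a c : x0 < x1 -> continuous f ->
  (forall x, x0 < x < x1 -> f x = a * x + c) ->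
  forall x, x0 <= x <= x1 -> f x = a * x + c.
Proof.
move=> x01 cf fE; pose d y := f y - (a * y + c).
have cd : continuous d.
  move=> y; apply: cvgB; first exact: cf.
  by apply: cvgD; [apply: cvgM; [exact: cvg_cst|exact: cvg_id]|exact: cvg_cst].
move=> x xI; apply/eqP; rewrite -subr_eq0 -/(d x); apply: contraT => dx.
have d0 : 0 < `|d x| by rewrite normr_gt0.
have /cvgrPdist_lt /(_ _ d0) := cd x.
move=> /nbhs_ballP[e /= e0 He].
suff [y [y01 xy]] : exists y, x0 < y < x1 /\ `|x - y| < e.
  have := He y xy; rewrite /= {2}/d fE// subrr subr0 ltxx.
  by [].
move: xI => /andP[xx0 xx1]; pose e' := Num.min e (x1 - x0) / 4.
have e'0 : 0 < e' by rewrite divr_gt0// lt_min e0 subr_gt0.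
have le1 : Num.min e (x1 - x0) <= e by rewrite ge_min lexx.
have le2 : Num.min e (x1 - x0) <= x1 - x0 by rewrite ge_min lexx orbT.
have e'e : e' < e by rewrite /e'; lra.
have e'x : e' <= (x1 - x0) / 4 by rewrite /e'; lra.
have [xm|xm] := ltP x ((x0 + x1) / 2).
  exists (x + e'); split; first by apply/andP; split; lra.
  by rewrite opprD addrA subrr add0r normrN gtr0_norm.
exists (x - e'); split; first by apply/andP; split; lra.
by rewrite opprB addrC subrK gtr0_norm.
Qed.

Lemma finite_dyadic_level (B : set (circle R)) : finite_set B ->
  B `<=` @circle_dyadic R -> exists N, forall x, B (pi x) ->
    exists n, x = n%:~R / 2 ^+ N.
Proof.
move=> /finite_seqP[s ->] sD.
elim: s sD => [|p s IH] sD; first by exists 0%N.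
have [|N NP] := IH; first by move=> q qs; apply: sD; rewrite /= inE qs orbT.
have [_ [m [i ->]] ip] := sD p (mem_head _ _).
have e2 := pow2_neq0 R.
exists (i + N)%N => x; rewrite /= inE => /predU1P[px|/NP[n ->]]; last first.
  exists (n * 2 ^+ i); rewrite intrM rmorphXn /= exprD; field.
  by rewrite !e2.
have [n xn] : exists n, x = m%:~R / 2 ^+ i + n%:~R.
  by apply: circle_pi_eq; rewrite ip px.
exists ((m + n * 2 ^+ i) * 2 ^+ N); rewrite xn !(intrM, intrD, rmorphXn) /= exprD.
by field; rewrite !e2.
Qed.

Lemma cell_dyadic_free w N x n : (size w = N)%N -> cell w 0 < x < cell w 1 ->
  x <> n%:~R / 2 ^+ N.
Proof.
move=> sw; have [i _ iE] := @nat_of_cell R w; rewrite !iE sw addr0 => /andP[x0 x1] xn.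
have p2 : 0 < 2 ^+ N :> R by rewrite exprn_gt0.
move: x0 x1; rewrite xn ltr_pM2r ?invr_gt0// ltr_pM2r ?invr_gt0//.
rewrite -[i%:R]/(i%:Z%:~R) -[1]/(1%:~R) -intrD !ltr_int => n1 n2.
by lia.
Qed.

(** [N] bounds the exponents of the denominators of the breakpoints, so these are
    not in the interior of a cell of length [N]. *)
Lemma thompsonT_affine_cells g : exists N, forall w, size w = N ->
  forall f : homeo R, (forall x, act g (pi x) = pi (f x)) ->
  exists k c, forall s, 0 <= s <= 1 -> f (cell w s) = 2 ^ k * cell w s + c.
Proof.
have /asboolP[_ [B [finB BD gB]] _] := valP g.
have [N NB] := finite_dyadic_level finB BD.
exists N => w sw f fE.
have w01 : cell w 0 < cell w 1 :> R.
  by rewrite [cell w 1]cell_affine ltrDl divr_gt0// exprn_gt0.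
have nB x : cell w 0 < x < cell w 1 -> ~ B (pi x).
  by move=> xw /NB[n]; exact: cell_dyadic_free xw.
have [x xw|a [c [[x xw fx] fa]]] := @affine_on_interval f _ _ w01.
  have [k gk] := gB x (nB x xw); exists (2 ^ k).
  exact: lift_locally_affine fE gk.
have [k gk] := gB x (nB x xw).
have [c' fx'] := lift_locally_affine fE gk.
have [ak _] := locally_affine_slope fx fx'.
exists k, c => s /andP[s0 s1]; rewrite -ak.
apply: (affine_closed_interval w01) => //; first exact: homeo_continuous.
have p2 : 0 < 2 ^+ size w :> R by rewrite exprn_gt0.
rewrite [cell w s]cell_affine [cell w 1]cell_affine lerDl divr_ge0// ?(ltW p2)//=.
by rewrite lerD2l ler_pM2r// invr_gt0.
Qed.

Lemma act_dyadic g x : dyadic x -> circle_dyadic (act g (pi x)).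
Proof.
have /asboolP[_ _ gD] := valP g; move=> dx.
rewrite -gD; exists (pi x) => //; exact/circle_dyadicP.
Qed.

(** On a cell where the slope is [2 ^ k] and the translation part is dyadic, every
    sufficiently small subcell is mapped to a standard dyadic interval. *)
Lemma carryT_depth g : exists N, forall w, size w = N -> exists z, carryT g w z.
Proof.
have [f [finc fE]] := thompsonT_lift g.
have [N fN] := thompsonT_affine_cells g.
have level w : size w = N -> exists L, forall v, (L <= size v)%N ->
    exists z, carryT g (w ++ v) z.
  move=> sw; have [k [c fw]] := fN w sw f fE.
  have dc : dyadic c.
    have d2 : dyadic (1 / 2 : R) by apply: dyadic_half; exact: (dyadic_int _ 1).
    have half01 : (0 <= (1 / 2 : R)) && ((1 / 2 : R) <= 1) by lra.
    have dw := dyadic_cell w d2.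
    have df : dyadic (f (cell w (1 / 2))).
      by apply/circle_dyadicP; rewrite -fE; exact: act_dyadic.
    have -> : c = f (cell w (1 / 2)) + - (2 ^ k * cell w (1 / 2)).
      by rewrite fw// addrC addKr.
    by apply: dyadicD => //; apply: dyadicN; exact: dyadic_expz.
  have [m [i ci]] := dc.
  exists (`|k| + i)%N => v sv.
  have [j _ jE] := @nat_of_cell R (w ++ v); set L := size (w ++ v) in jE.
  have e2 := pow2_neq0 R.
  have [l lE] : exists l : nat, (l : int) = L%:Z - k.
    exists `|L%:Z - k|%N; apply: gez0_abs.
    by rewrite /L size_cat; move: sv; lia.
  have il : (i <= l)%N by move: sv lE; rewrite /L size_cat; lia.
  pose a := j%:Z + m * 2 ^+ (l - i).
  have fa s : 0 <= s <= 1 -> f (cell (w ++ v) s) = (a%:~R + s) / 2 ^+ l.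
    move=> s01; rewrite cell_cat fw ?cell_unit// -cell_cat jE ci /a.
    have kE : 2 ^ k = 2 ^+ L / 2 ^+ l :> R.
      have -> : k = L%:Z - l%:Z by lia.
      by rewrite expfzDr ?pnatr_eq0// -invr_expz.
    have lE2 : 2 ^+ l = 2 ^+ (l - i) * 2 ^+ i :> R by rewrite -exprD subnK.
    rewrite kE intrD intrM rmorphXn /= lE2; field.
    by rewrite !e2.
  pose q := (a %/ 2 ^+ l)%Z; pose r := (a %% 2 ^+ l)%Z.
  have p2 : (2 ^+ l : int) != 0 by rewrite expf_neq0.
  have r0 : 0 <= r by apply: modz_ge0.
  have rl : (`|r| < 2 ^ l)%N.
    have := @ltz_mod a _ p2; rewrite -/r.
    have pE : ((2 ^ l)%N : int) = 2 ^+ l by rewrite -natz natrX.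
    by rewrite -ltz_nat gez0_abs// pE ger0_norm// exprn_ge0.
  have [z sz zE] := @cell_of_nat R l _ rl.
  exists z => s s01; rewrite fE fa// zE.
  have -> : (a%:~R + s) / 2 ^+ l = (`|r|%N%:R + s) / 2 ^+ l + q%:~R.
    have -> : a = q * 2 ^+ l + `|r|%N%:Z by rewrite gez0_abs//; exact: divz_eq.
    rewrite intrD intrM rmorphXn /= -[`|r|%N%:R]/(`|r|%N%:Z%:~R); field.
    exact: e2.
  by rewrite circle_piD.
have /choice[L LP] (w : N.-tuple bool) := level w (size_tuple w).
exists (N + \max_(w : N.-tuple bool) L w)%N => w sw.
have st : size (take N w) == N by rewrite size_takel// sw leq_addr.
have [|z gz] := LP (Tuple st) (drop N w).
  by rewrite size_drop sw addKn; exact: leq_bigmax.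
by exists z; move: gz; rewrite /= cat_take_drop.
Qed.

End ThompsonTCells.

(** * The action of T near the base point *)

Section ThompsonTDynamics.
Local Open Scope ring_scope.
Variable R : realType.
Implicit Types (g h : thompsonT R) (u v w z : word) (x y s t c : R).
Local Notation pi := (@circle_pi R).
Local Notation act := (thompsonT_act R).
Local Notation carry := (@carryT R).
Local Notation zeros n := (nseq n false).
Local Notation ones n := (nseq n true).

Definition fixes_base g := act g (pi 0) = pi 0.

Local Notation loctriv := (locally_trivial act (pi 0)).

Lemma fixes_base1 : fixes_base 1%g.
Proof. exact: act1. Qed.

Lemma fixes_baseM g h : fixes_base g -> fixes_base h -> fixes_base (g * h)%g.
Proof. by move=> g0 h0; rewrite /fixes_base actM h0. Qed.

Lemma fixes_baseV g : fixes_base g -> fixes_base g^-1%g.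
Proof. by move=> g0; rewrite /fixes_base -{1}g0 actK. Qed.

Lemma loctriv_fixes_base g : loctriv g -> fixes_base g.
Proof. exact: locally_trivial_fix. Qed.

Lemma loctriv_conj g h : fixes_base h -> loctriv g -> loctriv (g ^ h)%g.
Proof. by move=> h0 lg; apply: locally_trivial_conj; rewrite h0. Qed.

Lemma rotationT w : exists g, [/\ fixes_base g,
  carry g (w ++ [:: false; false]) (w ++ [:: false]),
  carry g (w ++ [:: false; true]) (w ++ [:: true; false]),
  carry g (w ++ [:: true]) (w ++ [:: true; true]) &
  carry_off carry w g].
Proof.
pose a : R := cell w 0; pose l : R := (2 ^+ size w)^-1.
have a0 : 0 <= a by apply: cell_ge0.
have l0 : 0 < l by rewrite invr_gt0 exprn_gt0.
have cE s : cell w s = a + s * l by rewrite cell_affine.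
have al1 : a + l <= 1 by have := @cell_le1 R w _ (lexx 1); rewrite cE mul1r.
have da : dyadic a by apply: dyadic_cell; exact: (dyadic_int _ 0).
have dl : dyadic l by exists 1, (size w); rewrite mul1r.
have [g gE] := rotation_exists a0 al1 da dl.
have gc v z : (forall s, 0 <= s <= 1 ->
    rot_map a l (cell w (cell v s)) = cell w (cell z s)) ->
    carry g (w ++ v) (w ++ z).
  by move=> vz s s01; rewrite gE ?cell_unit// !cell_cat vz.
exists g; split.
- rewrite /fixes_base gE ?lexx ?ler01//.
  by have [m0 _ _ _ _] := rot_map_pieces a l 0; rewrite m0.
- apply: gc => s /andP[s0 s1]; rewrite !cE /=.
  have sl0 : 0 <= s * l by rewrite mulr_ge0// ltW.
  have sl1 : s * l <= l by rewrite ler_piMl// ltW.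
  have [_ m1 _ _ _] := rot_map_pieces a l (a + (0 + (0 + s) / 2) / 2 * l).
  by rewrite m1; [lra|apply/andP; split; lra].
- apply: gc => s /andP[s0 s1]; rewrite !cE /=.
  have sl0 : 0 <= s * l by rewrite mulr_ge0// ltW.
  have sl1 : s * l <= l by rewrite ler_piMl// ltW.
  have [_ _ m2 _ _] := rot_map_pieces a l (a + (0 + (1 + s) / 2) / 2 * l).
  by rewrite m2; [lra|apply/andP; split; lra].
- apply: gc => s /andP[s0 s1]; rewrite !cE /=.
  have sl0 : 0 <= s * l by rewrite mulr_ge0// ltW.
  have sl1 : s * l <= l by rewrite ler_piMl// ltW.
  have [_ _ _ m3 _] := rot_map_pieces a l (a + (1 + s) / 2 * l).
  by rewrite m3; [lra|apply/andP; split; lra].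
- move=> v wv s s01; rewrite gE ?cell_unit//.
  have [m0 _ _ _ m4] := rot_map_pieces a l (cell v s).
  have [va|av] := leP (cell v s) a; first by rewrite m0.
  have [lv|vl] := leP (a + l) (cell v s); first by rewrite m4.
  exfalso; pose t := (cell v s - a) / l.
  have t01 : 0 < t < 1.
    by rewrite divr_gt0 ?subr_gt0//= ltr_pdivrMr// mul1r ltrBlDl.
  apply: (cell_prefix_disjoint wv t01 s01).
  by rewrite cE divfK ?gt_eqF// addrC subrK.
Qed.

Lemma cell_zeros n s : cell (zeros n) s = s / 2 ^+ n.
Proof.
elim: n => [|n IH] /=; first by rewrite divr1.
by rewrite IH add0r exprSr invfM mulrA.
Qed.

Lemma cell_ones n s : cell (ones n) s = 1 - (1 - s) / 2 ^+ n.
Proof.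
elim: n => [|n IH] /=; first by rewrite divr1 opprB addrC subrK.
have e2 := pow2_neq0 R n.
by rewrite IH exprS; field.
Qed.

Lemma half_power_small (e : R) : 0 < e -> exists n, forall m, (n <= m)%N ->
  (2 ^+ m)^-1 < e.
Proof.
move=> e0; pose n := `|Num.floor e^-1|.+1%N.
exists n => m nm; rewrite invf_plt ?posrE ?exprn_gt0//.
have fl : e^-1 < n%:R.
  have := floorD1_gt e^-1; rewrite intrD1 /n -natr1 natr_absz.
  by rewrite ger0_norm// floor_ge0 invr_ge0 ltW.
apply: lt_le_trans fl _.
by rewrite -natrX ler_nat (leq_trans nm)// ltnW// ltn_expl.
Qed.

Lemma nbhs_base_cells (N : set (circle R)) : nbhs (pi 0) N -> exists k,
  forall l, (k <= l)%N -> forall s, 0 <= s <= 1 ->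
    N (pi (cell (zeros l) s)) /\ N (pi (cell (ones l) s)).
Proof.
move=> /nbhs_circleP/nbhs_ballP[e /= e0 eN].
have [k ke] := half_power_small e0.
exists k => l kl s /andP[s0 s1].
have p2 : 0 < (2 ^+ l)^-1 :> R by rewrite invr_gt0 exprn_gt0.
have small t : 0 <= t <= 1 -> `|t / 2 ^+ l| < e.
  move=> /andP[t0 t1]; rewrite ger0_norm ?divr_ge0 ?exprn_ge0//.
  by apply: le_lt_trans (ke l kl); rewrite ler_piMl// ltW.
split.
  by apply: eN; rewrite /ball /= sub0r normrN cell_zeros small// s0.
rewrite cell_ones addrC -[1]/(1%:~R) circle_piD; apply: eN.
rewrite /ball /= sub0r opprK small//; apply/andP; split; lra.
Qed.

Lemma nbhs_base_of_cells (N : set (circle R)) k :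
  (forall s, 0 <= s <= 1 ->
    N (pi (cell (zeros k) s)) /\ N (pi (cell (ones k) s))) -> nbhs (pi 0) N.
Proof.
move=> kN; apply/nbhs_circleP.
have p2 : 0 < 2 ^+ k :> R by rewrite exprn_gt0.
apply/nbhs_ballP; exists (2 ^+ k)^-1; first by rewrite /= invr_gt0.
move=> x; rewrite /ball /= sub0r normrN ltr_norml => /andP[x1 x2].
have xk : x = x * 2 ^+ k / 2 ^+ k by rewrite mulfK// gt_eqF.
have xlt : x * 2 ^+ k < 1 by rewrite -ltr_pdivlMr// mul1r.
have xgt : -1 < x * 2 ^+ k by rewrite -ltr_pdivrMr// mulN1r.
have [x0|x0] := leP 0 x.
  have [|+ _] := kN (x * 2 ^+ k); first by rewrite mulr_ge0 ?(ltW p2)//= (ltW xlt).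
  by rewrite cell_zeros -xk.
have xneg : x * 2 ^+ k <= 0 by rewrite mulr_le0_ge0// ltW.
have [|_] := kN (1 + x * 2 ^+ k); first by apply/andP; split; lra.
by rewrite cell_ones opprD addrA subrr add0r mulNr -xk opprK addrC -[1]/(1%:~R) circle_piD.
Qed.

Lemma loctrivP g : loctriv g <->
  exists k, carry g (zeros k) (zeros k) /\ carry g (ones k) (ones k).
Proof.
split=> [/nbhs_base_cells[k /(_ k (leqnn k)) kg]|[k [gz go]]].
  by exists k; split=> s /kg[].
by apply: (@nbhs_base_of_cells _ k) => s s01; split; [apply: gz|apply: go].
Qed.

Lemma loctriv_cells g n m : carry g (zeros n) (zeros n) ->
  carry g (ones m) (ones m) -> loctriv g.
Proof.
move=> gn gm; apply/loctrivP; exists (n + m)%N; split.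
  by rewrite nseqD; apply: carryT_cat.
by rewrite addnC nseqD; apply: carryT_cat.
Qed.

(** The image of a cell with the base point as an end is again such a cell, on
    the same side because the base point is seen as 0 or as 1. *)
Lemma fixes_base_germs g : fixes_base g ->
  (exists n m, carry g (zeros n) (zeros m)) /\
  (exists n m, carry g (ones n) (ones m)).
Proof.
move=> g0; have [N gN] := carryT_depth g.
have one01 : (0 : R) <= 1 <= (1 : R) by apply/andP.
have zero01 : (0 : R) <= 0 <= (1 : R) by apply/andP.
split.
  have [z gz] := gN (zeros N) (size_nseq _ _).
  exists N, (size z); suff <- : z = zeros (size z) by [].
  have : cell z 0 = 0 :> R.
    apply: circle_pi_inj.
    - by have := @cell_ge0 R z _ (lexx 0); lra.
    - by have := @cell_lt1 R z _ ltr01; lra.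
    by rewrite -gz// cell_zeros mul0r.
  elim: {gz} z => //= b z IH e.
  have z0 := @cell_ge0 R z _ (lexx 0).
  by case: b e => /= e; [exfalso; lra|congr cons; apply: IH; lra].
have [z gz] := gN (ones N) (size_nseq _ _).
exists N, (size z); suff <- : z = ones (size z) by [].
have p1 : pi 1 = pi 0 by rewrite -[1]add0r -[X in _ + X]/(1%:~R) circle_piD.
have : cell z 1 = 1 :> R.
  apply: circle_pi_inj.
  - by have := @cell_gt0 R z _ ltr01; lra.
  - by have := @cell_le1 R z _ (lexx 1); lra.
  by rewrite -gz// cell_ones subrr mul0r subr0 p1.
elim: {gz} z => //= b z IH e.
have z1 := @cell_le1 R z _ (lexx 1).
by case: b e => /= e; [congr cons; apply: IH; lra|exfalso; lra].
Qed.

Lemma rotation_power w n : exists g, [/\ fixes_base g,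
  carry g (w ++ zeros n.+1) (w ++ [:: false]),
  carry g (w ++ [:: true]) (w ++ ones n.+1) & carry_off carry w g].
Proof.
elim: n => [|n [g [g0 gz go gw]]].
  by exists 1%g; split=> // *; exact: carryT1 || exact: fixes_base1.
have [x [x0 xz _ xo xw]] := rotationT w.
exists (g * x)%g; split.
- exact: fixes_baseM.
- have {}xz := carryT_cat (zeros n) xz; rewrite -!catA in xz.
  exact: carryTM xz gz.
- have {}go := carryT_cat [:: true] go.
  have e : ones n.+1 ++ [:: true] = ones n.+2 by rewrite -(nseqD n.+1 1) addn1.
  by apply: carryTM xo _; move: go; rewrite -!catA e.
- by move=> v wv; apply: carryTM (xw v wv) (gw v wv).
Qed.

(** According to its first two letters, a rotation shortens the word or makes it
    start with [10]; in the latter case a rotation of the cell [1] helps. *)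
Lemma interior_to_10 w : true \in w -> false \in w -> exists g,
  fixes_base g /\ carry g w [:: true; false].
Proof.
have [n] := ubnP (size w); elim: n w => // n IH w wn tw fw.
have [x [x0 x00 x01 x1 _]] := rotationT [::].
have [y [y0 y00 y01 y1 _]] := rotationT [:: true].
have step g u : fixes_base g -> carry g w u -> (size u < size w)%N ->
    true \in u -> false \in u ->
    exists g, fixes_base g /\ carry g w [:: true; false].
  move=> g0 gwu uw tu fu; have [|h [h0 hu]] := IH u _ tu fu.
    by apply: leq_trans uw _.
  exists (h * g)%g; split; first exact: fixes_baseM.
  exact: carryTM gwu hu.
have step10 g v : fixes_base g -> carry g w [:: true, false & v] ->
    size w = (size v).+2 -> exists g, fixes_base g /\ carry g w [:: true; false].
  move=> g0 gw sw; case: v gw sw => [|[] v] gw sw; first by exists g.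
    have s1 := carryTM gw (carryT_cat v y01).
    have s2 := carryTM s1 (carryT_cat (false :: v) (carryTV x1)).
    apply: (step _ _ _ s2) => //; last by rewrite sw.
    by do !apply: fixes_baseM => //; exact: fixes_baseV.
  have s1 := carryTM gw (carryT_cat v y00).
  by apply: (step _ _ _ s1) => //; [exact: fixes_baseM|rewrite sw].
case: w wn tw fw step step10 => [//|[] [|[] v]] // wn tw fw step step10.
- apply: (step x^-1%g (true :: v)) => //; first exact: fixes_baseV.
  exact: carryT_cat v (carryTV x1).
- exact: (step10 1%g v fixes_base1 (carryT1 _)).
- exact: (step10 x v x0 (carryT_cat v x01)).
- apply: (step x (false :: v)) => //.
  exact: carryT_cat v x00.
Qed.

(** The germs at the base point are corrected by powers of rotations of the cells
    [00] and [11], which do not touch the cell [10]. *)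
Lemma interior_to_10_loctriv w : true \in w -> false \in w -> exists g,
  loctriv g /\ carry g w [:: true; false].
Proof.
move=> tw fw; have [g [g0 gw]] := interior_to_10 tw fw.
have [[N [M gz]] [N' [M' go]]] := fixes_base_germs g0.
have [a [_ az _ aw]] := rotation_power [:: false; false] M.
have [b [_ bz _ bw]] := rotation_power [:: false; false] N.
have [c [_ _ co cw]] := rotation_power [:: true; true] M'.
have [d [_ _ do_ dw]] := rotation_power [:: true; true] N'.
have zE n : zeros n ++ zeros 3 = [:: false; false] ++ zeros n.+1.
  by rewrite -nseqD -(nseqD 2); congr nseq; lia.
have oE n : ones n ++ ones 3 = [:: true; true] ++ ones n.+1.
  by rewrite -nseqD -(nseqD 2); congr nseq; lia.
have {}gz := carryT_cat (zeros 3) gz; rewrite !zE in gz.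
have {}go := carryT_cat (ones 3) go; rewrite !oE in go.
have ab := carryTM az (carryTV bz).
have cd := carryTM (carryTV co) do_.
have ab_off v : incomparable [:: false; false] v -> carry (b^-1 * a)%g v v.
  by move=> vi; apply: carryTM (aw v vi) (carryTV (bw v vi)).
have cd_off v : incomparable [:: true; true] v -> carry (d * c^-1)%g v v.
  by move=> vi; apply: carryTM (carryTV (cw v vi)) (dw v vi).
exists ((d * c^-1) * ((b^-1 * a) * g))%g; split.
  apply: (@loctriv_cells _ N.+3 N'.+3).
    exact: carryTM (carryTM gz ab) (cd_off _ _).
  exact: carryTM (carryTM go (ab_off _ _)) cd.
exact: carryTM (carryTM gw (ab_off _ _)) (cd_off _ _).
Qed.

Lemma interior_transitive w z : true \in w -> false \in w -> true \in z ->
  false \in z -> exists g, loctriv g /\ carry g w z.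
Proof.
move=> tw fw tz fz; have [g [lg gw]] := interior_to_10_loctriv tw fw.
have [h [lh hz]] := interior_to_10_loctriv tz fz.
exists (h^-1 * g)%g; split; last exact: carryTM gw (carryTV hz).
have := locally_trivialV lh; apply: filterS2 lg => p gp hp.
by rewrite actM gp hp.
Qed.

(** Powers of two rotations expand small cells on both sides of the base point, so
    that what is left is contained in the cell [10]. *)
Lemma gather_outside k : exists h, [/\ fixes_base h,
  carry h (zeros k.+1) [:: false] & carry h (ones k.+2) [:: true; true]].
Proof.
have [a [a0 az ao _]] := rotation_power [::] k.
have [b [b0 _ bo bw]] := rotation_power [:: true] (k + k).
exists (b^-1 * a)%g; split.
- exact: fixes_baseM (fixes_baseV b0) a0.
- by apply: carryTM az (carryTV (bw _ _)).
- have {}ao := carryT_cat (ones k.+1) ao.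
  have e : ones k.+1 ++ ones k.+1 = [:: true] ++ ones (k + k).+1.
    by rewrite -nseqD -(nseqD 1); congr nseq; lia.
  by rewrite /= -[_ :: _ ++ _]/(ones k.+1 ++ ones k.+1) e in ao; apply: carryTM ao (carryTV bo).
Qed.

Lemma open_contains_cell (O : set (circle R)) : open O -> O !=set0 ->
  exists z, [/\ true \in z, false \in z &
    forall s, 0 <= s <= 1 -> O (pi (cell z s))].
Proof.
move=> oO [p Op]; have [x [x0 x1 px]] := circle_pi_repr p; rewrite {}px in Op.
have : nbhs x (pi @^-1` O) by apply/nbhs_circleP; exact: open_nbhs_nbhs.
move=> /nbhs_ballP[e /= e0 eO]; have [n ne] := half_power_small e0.
have [w [t [sw t0 t1 xw]]] := cell_cover n x0 (ltW x1).
exists (w ++ [:: true; false]); split; rewrite ?mem_cat ?orbT//.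
move=> s s01; rewrite cell_cat.
have /andP[r0 r1] := cell_unit [:: true; false] s01.
apply: eO; rewrite /ball /= xw [cell w t]cell_affine [cell w (_ / 2)]cell_affine.
set r := cell [:: true; false] s in r0 r1; rewrite -/r opprD addrACA subrr add0r -mulrBl normrM.
have p2 : 0 < 2 ^+ size w :> R by rewrite exprn_gt0.
rewrite [X in _ * X]gtr0_norm ?invr_gt0//.
apply: le_lt_trans (ne n (leqnn n)); rewrite sw ler_piMl ?invr_ge0 ?exprn_ge0//.
by rewrite ler_norml; apply/andP; split; lra.
Qed.

(** The complement of a neighbourhood is gathered into the cell [10], and this
    cell is moved to a small cell of the image of [O]. *)
Lemma thompsonT_expand : expanding act (pi 0).
Proof.
move=> N O /nbhs_base_cells[k kN] oO [q Oq].
have [h [h0 hz ho]] := gather_outside k.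
have hO : open (act h^-1%g @^-1` O).
  by move/continuousP : (@act_continuous _ _ act h^-1%g); exact.
have [|z [tz fz zO]] := open_contains_cell hO.
  by exists (act h q); rewrite -[_ (act h q)]/(O (act h^-1%g (act h q))) actK.
have [||r [lr r10]] := @interior_transitive [:: true; false] z _ _ tz fz => //.
exists (r ^ h)%g; first exact: loctriv_conj.
move=> p Np; rewrite conjgE actM (actM _ r).
have [u [s [su s01 hp]]] := circle_cell 2 (act h p).
case: u su hp => [|b [|c [|? ?]]] // _ hp.
have back v : carry h v [:: b; c] -> p = pi (cell v s).
  by move=> hv; apply: (@act_inj _ _ act h); rewrite hp hv.
case: b c hp back => [] [] hp back; first last.
- have pE := back _ (carryT_cat [:: false] hz); case: Np; rewrite pE -(nseqD k.+1 1).
  by apply: (kN _ _ s s01).1; lia.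
- have pE := back _ (carryT_cat [:: true] hz); case: Np; rewrite pE cell_cat.
  by apply: (kN _ _ _ (cell_unit _ s01)).1; lia.
- by rewrite hp r10//; exact: zO.
- have pE := back _ ho; case: Np; rewrite pE.
  by apply: (kN _ _ s s01).2; lia.
Qed.

Lemma open_cell_interior w : open (pi @` [set` `](cell w 0 : R), cell w 1[]).
Proof. exact/open_circle_pi/interval_open. Qed.

Lemma cell_interiorP w x : cell w 0 <= x <= cell w 1 ->
  exists2 s, 0 <= s <= 1 & x = cell w s.
Proof.
have p2 : 0 < 2 ^+ size w :> R by rewrite exprn_gt0.
rewrite [cell w 1]cell_affine => /andP[x0 x1].
exists ((x - cell w 0) * 2 ^+ size w).
  rewrite mulr_ge0 ?subr_ge0 ?(ltW p2)//=.
  by rewrite -ler_pdivlMr// lerBlDl.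
by rewrite [RHS]cell_affine mulfK ?gt_eqF// addrC subrK.
Qed.

Lemma carryT_somewhere_trivial g w : carry g w w -> somewhere_trivial act g.
Proof.
move=> gw; exists (pi @` [set` `](cell w 0 : R), cell w 1[]).
  exact: open_cell_interior.
have w01 : cell w 0 < cell w 1 :> R.
  by rewrite [cell w 1]cell_affine ltrDl divr_gt0// exprn_gt0.
split=> [|p [x /= + <-]].
  exists (pi ((cell w 0 + cell w 1) / 2)), ((cell w 0 + cell w 1) / 2) => //.
  by rewrite /= in_itv /=; apply/andP; split; lra.
rewrite in_itv /= => /andP[x0 x1].
have [|s s01 ->] := @cell_interiorP w x; first by rewrite !ltW.
exact: gw.
Qed.

(** [f] agrees with [g] on one cell and is trivial near the base point. *)
Lemma thompsonT_fragment : fragmented act.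
Proof.
move=> g; have [N gN] := carryT_depth g.
have [z gz] := gN (zeros N) (size_nseq _ _).
have {}gz := carryT_cat [:: true; false] gz.
have [||||f [lf fw]] := @interior_transitive
    (zeros N ++ [:: true; false]) (z ++ [:: true; false]).
- by rewrite mem_cat orbT.
- by rewrite mem_cat orbT.
- by rewrite mem_cat orbT.
- by rewrite mem_cat orbT.
exists f, (f^-1 * g)%g; rewrite mulVKg; split=> //.
  exists ([set p | act f p = p]^°); first exact: open_interior.
  by split=> [|p]; [exists (pi 0)|exact: interior_subset].
exact: carryT_somewhere_trivial (carryTM gz (carryTV fw)).
Qed.

Lemma thompsonT_moves_base : exists k, act k (pi 0) <> pi 0.
Proof.
have [k kE] := half_turn R; exists k; rewrite kE add0r => /circle_pi_inj.
have h1 : -1 < 1 / 2 - 0 :> R by lra.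
have h2 : 1 / 2 - 0 < 1 :> R by lra.
by move=> /(_ h1 h2); lra.
Qed.

End ThompsonTDynamics.

(** * A continuity point of the stabilizer map on the circle *)

Section IrrationalPoint.
Local Open Scope ring_scope.
Variable R : realType.
Implicit Types (u v w z : word) (x y s t c : R).
Local Notation pi := (@circle_pi R).
Local Notation act := (thompsonT_act R).
Local Notation carry := (@carryT R).

(** An irrational point is not fixed by an affine map with rational
    coefficients other than the identity. *)
Lemma thompsonT_free_point : exists p, forall g,
  act g p = p -> locally_trivial act p g.
Proof.
pose a : R := trigo.pi - (Num.floor (trigo.pi : R))%:~R.
have ratn (n : nat) : rational (n%:R : R) by exists n%:R; rewrite // ratr_nat.
have ratD (p q : R) : rational p -> rational q -> rational (p + q).
  by move=> [p' _ <-] [q' _ <-]; exists (p' + q'); rewrite // rmorphD.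
have ratN (q : R) : rational q -> rational (- q).
  by move=> [q' _ <-]; exists (- q'); rewrite // rmorphN.
have ratM (p q : R) : rational p -> rational q -> rational (p * q).
  by move=> [p' _ <-] [q' _ <-]; exists (p' * q'); rewrite // rmorphM.
have ratV (q : R) : rational q -> rational q^-1.
  by move=> [q' _ <-]; exists q'^-1; rewrite // fmorphV.
have rat2 (n : nat) : rational (2 ^+ n : R) by rewrite -natrX.
have ia : ~ rational a.
  move=> ra; apply: (@pi_irrationnal R); 
  rewrite -[X in rational X](subrK (Num.floor (trigo.pi : R))%:~R).
  by apply: ratD ra _; exists (Num.floor (trigo.pi : R))%:~R; rewrite // ratr_int.
have [a0 a1] : 0 <= a /\ a <= 1.
  by have /andP[? /ltW ?] := frac_itv (trigo.pi : R).
exists (pi a) => g ga; have [N gN] := carryT_depth g.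
have [w [s [sw s0 s1 aw]]] := cell_cover N a0 a1.
have [z gz] := gN w sw.
have s01 : 0 <= s <= 1 by rewrite s0.
have [i _ iE] := @nat_of_cell R w; have [j _ jE] := @nat_of_cell R z.
have e2 := pow2_neq0 R.
have is_ : ~ rational s.
  by move=> rs; apply: ia; rewrite aw iE; apply/ratM/ratV => //; exact/ratD.
have s00 : 0 < s.
  by rewrite lt_def s0 andbT; apply/eqP => sz; apply: is_; rewrite sz; exact: (ratn 0%N).
have s11 : s < 1.
  by rewrite lt_def s1 andbT; apply/eqP => sz; apply: is_; rewrite -sz; exact: (ratn 1%N).
have e : cell w s = cell z s.
  apply: cell_interior_inj => //; first by rewrite s00.
  by rewrite -aw -[LHS]ga {1}aw gz.
have swz : size w = size z.
  apply: contrapT => /eqP ne; apply: is_.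
  have ne' : (2 ^+ size z - 2 ^+ size w : R) != 0.
    rewrite subr_eq0 -!natrX eqr_nat; apply: contra ne => /eqP E.
    by apply/eqP/esym/(expnI (ltnSn 1)).
  have sE : s * (2 ^+ size z - 2 ^+ size w) =
      j%:R * 2 ^+ size w - i%:R * 2 ^+ size z.
    have /eqP := e; rewrite iE jE eqr_div ?e2// => /eqP E.
    apply: (@addIr _ (i%:R * 2 ^+ size z + s * 2 ^+ size w)).
    by transitivity ((i%:R + s) * 2 ^+ size z); [ring|rewrite E; ring].
  rewrite -[s](mulfK ne') sE.
  by apply/ratM/ratV/ratD/ratN => //; apply/ratD/ratN/ratM => //; exact/ratM.
have ij : i%:R = j%:R :> R.
  by move: e; rewrite iE jE swz => /(mulIf _)/addIr; apply; rewrite invr_eq0.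
have gww : carry g w w by move=> t t01; rewrite gz// jE iE swz ij.
have [x01] : cell w 0 < a < cell w 1.
  have p2 : 0 < 2 ^+ size w :> R by rewrite exprn_gt0.
  rewrite aw [cell w s]cell_affine [cell w 1]cell_affine ltrDl divr_gt0//=.
  by rewrite ltrD2l ltr_pM2r ?invr_gt0.
have : nbhs (pi a) (pi @` [set` `](cell w 0 : R), cell w 1[]).
  apply: open_nbhs_nbhs; split; first exact: open_cell_interior.
  by exists a => //; rewrite /= in_itv.
apply: filterS => _ [x /= + <-]; rewrite in_itv /= => /andP[x0 x1].
have [|t t01 ->] := @cell_interiorP R w x; first by rewrite !ltW.
exact: gww.
Qed.

End IrrationalPoint.

(** * Perfectness of the elements of T trivial near the base point *)

Section MonotoneLeaves.
Local Open Scope ring_scope.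
Variable R : realType.
Implicit Types (g h : thompsonT R) (u v w z : word).
Local Notation pi := (@circle_pi R).
Local Notation act := (thompsonT_act R).
Local Notation carry := (@carryT R).

Lemma half_unit : 0 < (1 / 2 : R) < 1.
Proof. by apply/andP; split; lra. Qed.

Definition left_of : rel word := fun u v => cell u (1 / 2) < cell v (1 / 2) :> R.

Lemma left_of_trans : transitive left_of.
Proof. by move=> v u w; exact: lt_trans. Qed.

Lemma left_of_irr : irreflexive left_of.
Proof. by move=> u; rewrite /left_of ltxx. Qed.

Lemma leaves_sorted w (t : tree) : pairwise left_of (leaves w t).
Proof.
elim: t w => //= l IHl r IHr w; rewrite pairwise_cat IHl IHr !andbT.
apply/allrelP => u v /leaves_prefix/prefixP[a ->] /leaves_prefix/prefixP[b ->].
rewrite /left_of !cell_cat [ltLHS]cell_affine [ltRHS]cell_affine ltrD2l.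
rewrite ltr_pM2r ?invr_gt0 ?exprn_gt0//=.
have /andP[h0 h1] := half_unit.
by have := @cell_lt1 R a _ h1; have := @cell_gt0 R b _ h0; lra.
Qed.

(** The lift normalised at the base point is an increasing bijection of the
    unit interval, so the image cells come in the same order. *)
Lemma carry_left_of g u v u' v' : fixes_base g ->
  carry g u u' -> carry g v v' -> left_of u v -> left_of u' v'.
Proof.
move=> g0 gu gv uv; have [f [finc fE]] := thompsonT_lift g.
have p1 : pi 1 = pi 0 by rewrite -[1]add0r -[X in _ + X]/(1%:~R) circle_piD.
have flt x y : f x < f y -> x < y.
  rewrite ltNge => fxy; rewrite ltNge; apply: contra fxy.
  by rewrite le_eqVlt => /predU1P[->//|/finc/ltW].
have f1 : f 1 <= f 0 + 1.
  have fx := homeoVK f (f 0 + 1); set x := homeo_inv f _ in fx.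
  have x0 : 0 < x by apply: flt; rewrite fx ltrDl.
  have px : pi x = pi 0.
    apply: (@act_inj _ _ act g); rewrite !fE fx.
    by rewrite -[X in _ + X]/(1%:~R) circle_piD.
  have [n xn] := circle_pi_eq px.
  have x1 : 1 <= x.
    move: x0; rewrite xn add0r -[1]/(1%:~R) ltr0z ler_int.
    by lia.
  rewrite -fx; move: x1; rewrite le_eqVlt => /predU1P[->//|/finc/ltW].
  by [].
have [m fm] : exists m, f 0 = m%:~R.
  have : pi (f 0) = pi 0 by rewrite -fE.
  by move=> /circle_pi_eq[m ->]; exists m; rewrite add0r.
have /andP[h0 h1] := half_unit.
have h01 : 0 <= (1 / 2 : R) <= 1 by rewrite !ltW.
have img w z : carry g w z -> cell z (1 / 2) = f (cell w (1 / 2)) - m%:~R.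
  move=> gw; have w0 := @cell_gt0 R w _ h0; have w1 := @cell_lt1 R w _ h1.
  have z0 := @cell_gt0 R z _ h0; have z1 := @cell_lt1 R z _ h1.
  have fw0 := finc _ _ w0; have fw1 := finc _ _ w1.
  rewrite fm in fw0 f1.
  apply: circle_pi_inj; [lra|lra|].
  by rewrite -mulrNz circle_piD -fE gw.
by move: uv; rewrite /left_of (img _ _ gu) (img _ _ gv) ltrD2r; exact: finc.
Qed.

End MonotoneLeaves.

Section LocallyTrivialPerfect.
Local Open Scope ring_scope.
Variable R : realType.
Implicit Types (g h : thompsonT R) (u v w z : word).
Local Notation pi := (@circle_pi R).
Local Notation act := (thompsonT_act R).
Local Notation carry := (@carryT R).
Local Notation zeros n := (nseq n false).
Local Notation ones n := (nseq n true).
Local Notation loctriv := (locally_trivial act (pi 0)).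

Definition loctriv_commutators : SubG (thompsonT R) :=
  generated [set [~ a, b]%g | a in loctriv & b in loctriv].

Local Notation K := (mem_sub loctriv_commutators).

Lemma commutator_in a b : loctriv a -> loctriv b -> [~ a, b]%g \in K.
Proof.
move=> la lb; rewrite mem_mkSub; apply/asboolP => H; apply.
by exists a => //; exists b.
Qed.

Lemma loctriv_commutators_normal g h : fixes_base h -> g \in K -> (g ^ h)%g \in K.
Proof.
move=> h0; rewrite -mem_conj_sub mem_mkSub => /asboolP; apply => _ [a la [b lb <-]].
by rewrite mem_conj_sub conjRg commutator_in//; exact: loctriv_conj.
Qed.

Lemma carry_refine g v N :
  (forall s, size s = N -> carry g (v ++ s) (v ++ s)) -> carry g v v.
Proof.
move=> gv s /andP[s0 s1]; have [u [t [su t0 t1 ->]]] := cell_cover N s0 s1.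
by rewrite -cell_cat gv// t0.
Qed.

(** The inverse of [a] need not be a canonical identification on the cell [v]
    itself, but it is one on all its small subcells. *)
Lemma carry_off_conj a g w z : carry a w z -> carry_off carry w g ->
  carry_off carry z (a * g * a^-1)%g.
Proof.
move=> aw gw v zv; have [N aN] := carryT_depth a^-1%g.
apply: (@carry_refine _ _ N) => s sN.
have [y ay] : exists y, carry a^-1%g (v ++ s) y.
  by apply: (carry_deeper (@carryT_cat R) aN); rewrite size_cat sN leq_addl.
apply: (carryTM ay); have {}ay := carryTV ay; rewrite invgK in ay.
apply: (carryTM _ ay); apply: gw.
have zvs : incomparable z (v ++ s).
  by rewrite incomparableC; apply: incomparable_ext (prefix_prefix _ _);
    rewrite incomparableC.
apply/andP; split; apply/negP => /prefixP[r e].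
  have := carry_fun (@carryTM R) (@carryTV R) (@carryT1_eq R) ay.
  rewrite e => /(_ _ (carryT_cat r aw)) e'.
  by move: zvs; rewrite e' /incomparable prefix_prefix.
have := carry_fun (@carryTM R) (@carryTV R) (@carryT1_eq R) aw.
rewrite e => /(_ _ (carryT_cat r ay)) e'.
by move: zvs; rewrite e' /incomparable prefix_prefix andbF.
Qed.

Lemma carry_conj a g w z p q : carry a w z -> carry g (w ++ p) (w ++ q) ->
  carry (a * g * a^-1)%g (z ++ p) (z ++ q).
Proof.
move=> aw gw; apply: carryTM (carryT_cat p (carryTV aw)) _.
exact: carryTM gw (carryT_cat q aw).
Qed.

(** The pentagon relation [x * x = x1 * x * x0] between the rotation [x] of a
    cell and the rotations [x0], [x1] of its halves makes [x] a product of
    commutators, as [x0] and [x1] are conjugate to [x]. *)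
Lemma rotation_commutator w : prefix [:: true; false] w -> exists g,
  [/\ g \in K, carry g (w ++ [:: false; false]) (w ++ [:: false]),
  carry g (w ++ [:: false; true]) (w ++ [:: true; false]),
  carry g (w ++ [:: true]) (w ++ [:: true; true]) &
  carry_off carry w g].
Proof.
move=> pw; have [x [x0 x00 x01 x1 xo]] := rotationT R w.
exists x; split=> //.
have off0 u : incomparable [:: true; false] u -> carry x u u.
  by move=> iu; apply: xo; exact: incomparable_ext iu pw.
have lx : loctriv x by apply: (@loctriv_cells _ _ 1 2); exact: off0.
have [tw fw] : true \in w /\ false \in w.
  by have /prefixP[s ->] := pw; rewrite !inE.
have sub b : exists a, loctriv a /\ carry a w (w ++ [:: b]).
  by apply: interior_transitive; rewrite // mem_cat ?tw ?fw.
have [a [la aw]] := sub false; have [b [lb bw]] := sub true.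
have ao := carry_off_conj aw xo; have bo := carry_off_conj bw xo.
have a00 := carry_conj aw x00; have a01 := carry_conj aw x01.
have a1 := carry_conj aw x1.
have b00 := carry_conj bw x00; have b01 := carry_conj bw x01.
have b1 := carry_conj bw x1.
rewrite -!catA /= in a00 a01 a1 b00 b01 b1.
set y := (a * x * a^-1)%g in ao a00 a01 a1.
set z := (b * x * b^-1)%g in bo b00 b01 b1.
have incT u : incomparable (w ++ [:: true]) (w ++ false :: u).
  rewrite -(cat1s false u) catA incomparableC.
  by apply: incomparable_ext (prefix_prefix _ _); exact: (incomparable_sib w false).
have incF u : incomparable (w ++ [:: false]) (w ++ true :: u).
  rewrite -(cat1s true u) catA incomparableC.
  by apply: incomparable_ext (prefix_prefix _ _); exact: (incomparable_sib w true).
have same u v : carry (x * x)%g u v -> carry (z * x * y)%g u v ->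
    carry ((x * x)^-1 * (z * x * y))%g u u.
  by move=> xu zu; apply: carryTM zu (carryTV xu).
have pentagon : ((x * x)^-1 * (z * x * y))%g = 1%g.
  apply: (@eq1_of_leaves _ _ (@carryT_cat R) (@carryT_sep R) _ w
    (Node (Node (Node Leaf Leaf) Leaf) Leaf)) => [u wu|u].
    have au : incomparable (w ++ [:: false]) u.
      exact: incomparable_ext wu (prefix_prefix _ _).
    have bu : incomparable (w ++ [:: true]) u.
      exact: incomparable_ext wu (prefix_prefix _ _).
    apply: (same u u); first exact: carryTM (xo u wu) (xo u wu).
    exact: carryTM (ao u au) (carryTM (xo u wu) (bo u bu)).
  rewrite /= -!catA /= !inE => /or4P[] /eqP ->.
  - apply: (same _ (w ++ [:: false])).
      by apply: (carryTM _ x00); have := carryT_cat [:: false] x00; rewrite -!catA.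
    exact: carryTM a00 (carryTM x00 (bo _ (incT _))).
  - apply: (same _ (w ++ [:: true; false])).
      by apply: (carryTM _ x01); have := carryT_cat [:: true] x00; rewrite -!catA.
    apply: (carryTM a01 _); apply: (carryTM _ b00).
    by have := carryT_cat [:: false] x01; rewrite -!catA.
  - apply: (same _ (w ++ [:: true; true; false])).
      apply: (carryTM x01 _).
      by have := carryT_cat [:: false] x1; rewrite -!catA.
    apply: (carryTM a1 _); apply: (carryTM _ b01).
    by have := carryT_cat [:: true] x01; rewrite -!catA.
  - apply: (same _ (w ++ [:: true; true; true])).
      by apply: (carryTM x1 _); have := carryT_cat [:: true] x1; rewrite -!catA.
    exact: carryTM (ao _ (incF _)) (carryTM x1 b1).
have c1 : [~ x, b^-1]%g \in K by apply: commutator_in => //; exact: locally_trivialV.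
have c2 : [~ x, a^-1]%g \in K by apply: commutator_in => //; exact: locally_trivialV.
have xE : (x * (([~ x, b^-1] ^ x) * x * [~ x, a^-1]))%g = x.
  apply: (@mulgI _ x); rewrite mulgA.
  have -> : (x * x * (([~ x, b^-1] ^ x) * x * [~ x, a^-1]))%g = (z * x * y)%g.
    rewrite /z /y !commgEl !conjgE !invgK -!mulgA.
    by rewrite !mulVKg.
  by apply: (@mulgI _ (x * x)^-1%g); rewrite pentagon mulVg.
have e1 : (([~ x, b^-1] ^ x) * x * [~ x, a^-1])%g = 1%g.
  by apply: (@mulgI _ x); rewrite xE mulg1.
have -> : x = (([~ x, b^-1] ^ x)^-1 * [~ x, a^-1]^-1)%g.
  apply: (@mulgI _ ([~ x, b^-1] ^ x)%g); rewrite mulVKg.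
  by apply: (@mulIg _ [~ x, a^-1]%g); rewrite mulVg.
by rewrite mem_subM// mem_subV// loctriv_commutators_normal.
Qed.

(** An element supported on the cell [10] maps the leaves of a tree to the
    leaves of another one in order; reducing both trees to a comb expresses it
    with rotations. *)
Lemma supported_commutator g : fixes_base g ->
  carry_off carry [:: true; false] g -> g \in K.
Proof.
move=> g0 go; set p := [:: true; false] in go.
have [N1 gN1] := carryT_depth g; have [N2 gN2] := carryT_depth g^-1%g.
have [t [t' [f [gf _ tt']]]] :=
  carry_trees (@carryTM R) (@carryTV R) (@carryT_cat R) (@carryT1_eq R) go gN1 gN2.
have tf : map f (leaves p t) = leaves p t'.
  apply: (irr_sorted_eq (@left_of_trans R) (@left_of_irr R)) => //.
    rewrite (sorted_pairwise (@left_of_trans R)) pairwise_map.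
    apply: (@sub_in_pairwise _ (mem (leaves p t)) (left_of R)); last exact: leaves_sorted.
      by move=> u v ut vt; apply: carry_left_of g0 _ _; apply: gf.
    exact/allP.
  by rewrite (sorted_pairwise (@left_of_trans R)) leaves_sorted.
have gtt' : carries carry g (leaves p t) (leaves p t').
  by rewrite -tf; exact: carries_map.
have K1 : 1%g \in K by case: (mem_sub_closed loctriv_commutators).
have KM a b : a \in K -> b \in K -> (a * b)%g \in K by exact: mem_subM.
have comb_of s := carries_to_comb (@carryT1 R) (@carryTM R) (@carryT_cat R)
  (N := fun g => g \in K) K1 KM rotation_commutator s (prefix_refl p).
have [r [rK rt ro]] := comb_of t; have [r' [rK' rt' ro']] := comb_of t'.
have nt : nodes t = nodes t'.
  by apply: succn_inj; rewrite -!(size_leaves p) -tf size_map.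
rewrite -{}nt in rt'.
have q1 : (r' * g * r^-1)%g = 1%g.
  apply: (@eq1_of_leaves _ _ (@carryT_cat R) (@carryT_sep R) _ p (comb (nodes t))).
    move=> v pv; apply: carryTM (carryTV (ro v pv)) _.
    exact: carryTM (go v pv) (ro' v pv).
  move=> u; apply: carries_refl.
  apply: carriesM (@carryTM R) _ _ _ _ _ (carriesV (@carryTV R) rt) _.
  exact: carriesM (@carryTM R) _ _ _ _ _ gtt' rt'.
have -> : g = (r'^-1 * r)%g.
  by apply: (@mulgI _ r'); apply: (@mulIg _ r^-1%g); rewrite q1 mulVKg mulgV.
by rewrite mem_subM// mem_subV.
Qed.

(** Conjugation by [gather_outside] moves the support of [g] into the cell [10]. *)
Lemma loctriv_commutatorsP g : loctriv g -> g \in K.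
Proof.
move=> /[dup] lg /loctrivP[k [gz go]].
have [h [h0 hz ho]] := gather_outside R k.
have {}gz := carryT_cat [:: false] gz; rewrite -(nseqD k 1) addn1 in gz.
have {}go := carryT_cat [:: true; true] go; rewrite -(nseqD k 2) addn2 in go.
rewrite -[g](conjgK h^-1%g) invgK.
apply: loctriv_commutators_normal => //; apply: supported_commutator.
  by apply: loctriv_fixes_base; apply: loctriv_conj lg; exact: fixes_baseV.
rewrite conjgE invgK mulgA.
have hgz : carry (h * g * h^-1)%g [:: false] [:: false].
  exact: carryTM (carryTV hz) (carryTM gz hz).
have hgo : carry (h * g * h^-1)%g [:: true; true] [:: true; true].
  exact: carryTM (carryTV ho) (carryTM go ho).
case=> [|[] [|[] v]] //= pv.
- exact: (carryT_cat v hgo).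
- by move: pv; rewrite /incomparable (prefix_prefix [:: true; false] v).
- exact: (carryT_cat (true :: v) hgz).
- exact: (carryT_cat (false :: v) hgz).
Qed.

Lemma loctriv_perfect : locally_perfect act (pi 0).
Proof.
move=> H HH g /loctriv_commutatorsP; rewrite mem_mkSub => /asboolP; apply.
by move=> _ [a la [b lb <-]]; exact: HH.
Qed.

End LocallyTrivialPerfect.

(** * The groups T, F and its derived subgroup *)

Section ThompsonURS.
Variable R : realType.
Local Notation pi := (@circle_pi R).
Local Notation act := (thompsonT_act R).
Local Notation carry := (@carryT R).

Theorem thompsonT_URS (U : set (SubG (thompsonT R))) :
  is_URS U <-> [\/ U = [set trivial_sub (thompsonT R)],
                   U = [set whole_sub (thompsonT R)] |
                   U = stabilizer_URS act].
Proof.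
apply: (@URS_classification _ _ act (pi 0%R)).
- exact: circle_hausdorff.
- exact: circle_compact.
- exact: circle_no_isolated_point.
- exact: act_T_inj.
- exact: thompsonT_expand.
- exact: loctriv_perfect.
- exact: thompsonT_fragment.
- exact: thompsonT_moves_base.
- exact: thompsonT_free_point.
Qed.

(** Near the base point, elements that fix it shift the index of the first
    cells, and such shifts commute. *)
Lemma carry_shift_commutator (c : bool) (a b : thompsonT R) n m n' m' :
  carry a (nseq n c) (nseq m c) -> carry b (nseq n' c) (nseq m' c) ->
  exists l, carry [~ a, b] (nseq l c) (nseq l c).
Proof.
move=> ac bc.
have shift g i j k : carry g (nseq i c) (nseq j c) ->
    carry g (nseq (i + k) c) (nseq (j + k) c).
  by rewrite !nseqD; exact: carryT_cat.
have aV := carryTV ac; have bV := carryTV bc.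
exists (n' + (n + m))%N; rewrite commgEl conjgE.
have s1 := shift _ _ _ (n + m)%N bc.
have s2 := shift _ _ _ (m' + m)%N ac.
have s3 := shift _ _ _ (m + m)%N bV.
have s4 := shift _ _ _ (n' + n)%N aV.
have e1 : (m' + (n + m) = n + (m' + m))%N by lia.
have e2 : (m + (m' + m) = m' + (m + m))%N by lia.
have e3 : (n' + (m + m) = m + (n' + m))%N by lia.
rewrite e1 in s1; rewrite e2 in s2; rewrite e3 in s3.
have {}s4 := shift _ _ _ (n' + m)%N aV.
have e4 : (n + (n' + m) = n' + (n + m))%N by lia.
rewrite e4 in s4.
exact: carryTM (carryTM (carryTM s1 s2) s3) s4.
Qed.

Lemma fixes_base_commutator (a b : thompsonT R) : fixes_base a -> fixes_base b ->
  locally_trivial act (pi 0%R) [~ a, b].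
Proof.
move=> /fixes_base_germs[[n [m az]] [n' [m' ao]]].
move=> /fixes_base_germs[[i [j bz]] [i' [j' bo]]].
have [k kz] := carry_shift_commutator az bz.
have [l lo] := carry_shift_commutator ao bo.
exact: loctriv_cells kz lo.
Qed.

Local Notation stab := (stabilizer act (pi 0%R)).

Definition thompsonF_act : {multiplicative thompsonF R -> homeo (circle R)} :=
  restricted_act act stab.

Lemma loctriv_in_F g : locally_trivial act (pi 0%R) g -> g \in mem_sub stab.
Proof. by move=> lg; rewrite mem_stabilizer; apply/asboolP/locally_trivial_fix. Qed.

Lemma thompsonF_commutator (a b : thompsonF R) :
  locally_trivial thompsonF_act (pi 0%R) [~ a, b].
Proof.
rewrite restricted_locally_trivial (gmulfR (subg_incl stab)).
apply: fixes_base_commutator.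
  by have := valP a; rewrite mem_stabilizer => /asboolP.
by have := valP b; rewrite mem_stabilizer => /asboolP.
Qed.

Lemma thompsonF_act_inj : injective thompsonF_act.
Proof. exact/restricted_act_inj/act_T_inj. Qed.

Lemma thompsonF_expand : expanding thompsonF_act (pi 0%R).
Proof. exact: (restricted_expand loctriv_in_F (@thompsonT_expand R)). Qed.

Lemma thompsonF_perfect : locally_perfect thompsonF_act (pi 0%R).
Proof. exact: (restricted_perfect loctriv_in_F (@loctriv_perfect R)). Qed.

Theorem thompsonF_URS (U : set (SubG (thompsonF R))) :
  is_URS U <-> exists N : SubG (thompsonF R), normal_sub N /\ U = [set N].
Proof.
apply: (@URS_are_normal_subgroups _ _ thompsonF_act (pi 0%R)).
- exact: circle_hausdorff.
- exact: circle_no_isolated_point.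
- exact: thompsonF_act_inj.
- exact: thompsonF_expand.
- exact: thompsonF_perfect.
- exact: thompsonF_commutator.
Qed.

(** Perfectness puts the elements that are trivial near the base point into the
    derived subgroup. *)
Lemma loctriv_in_derived g : locally_trivial thompsonF_act (pi 0%R) g ->
  g \in mem_sub (derived_sub (thompsonF R)).
Proof.
apply: thompsonF_perfect => a b _ _; rewrite mem_mkSub; apply/asboolP => H; apply.
by exists a => //; exists b.
Qed.

(** Commutators of elements fixing the base point are trivial near it, and so are
    products of such elements. *)
Lemma derived_loctriv g : g \in mem_sub (derived_sub (thompsonF R)) ->
  locally_trivial thompsonF_act (pi 0%R) g.
Proof.
have cl : group_closed [pred g |
    `[< [set g | locally_trivial thompsonF_act (pi 0%R) g] g >]].
  apply: set_group_closed => [|x y lx /locally_trivialV ly].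
    by apply: filterE => p; rewrite act1.
  by apply: filterS2 lx ly => p xp yp; rewrite actM yp xp.
rewrite mem_mkSub => /asboolP/(_ (mk_subG cl)); rewrite mem_mkSub.
move=> /(_ _)/asboolP; apply => _ [a _ [b _ <-]].
by rewrite mem_mkSub; apply/asboolP/thompsonF_commutator.
Qed.

Theorem derivedF_URS (U : set (SubG (derivedF R))) :
  is_URS U <-> U = [set trivial_sub (derivedF R)] \/
               U = [set whole_sub (derivedF R)].
Proof.
apply: (@URS_trivial_or_whole _ _
  (restricted_act thompsonF_act (derived_sub (thompsonF R))) (pi 0%R)).
- exact: circle_hausdorff.
- exact: circle_no_isolated_point.
- exact/restricted_act_inj/thompsonF_act_inj.
- exact: (restricted_expand loctriv_in_derived thompsonF_expand).
- exact: (restricted_perfect loctriv_in_derived thompsonF_perfect).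
- by move=> g; apply: derived_loctriv (valP g).
Qed.

End ThompsonURS.

(** * Classification *)

Theorem theorem1p7 (R : realType) :
  (forall U : set (SubG (thompsonF R)),
     is_URS U <-> exists N : SubG (thompsonF R), normal_sub N /\ U = [set N]) /\
  (forall U : set (SubG (derivedF R)),
     is_URS U <-> U = [set trivial_sub (derivedF R)] \/
                  U = [set whole_sub (derivedF R)]) /\
  (forall U : set (SubG (thompsonT R)),
     is_URS U <-> [\/ U = [set trivial_sub (thompsonT R)],
                      U = [set whole_sub (thompsonT R)] |
                      U = stabilizer_URS (thompsonT_act R)]) /\
  (forall U : set (SubG thompsonV),
     is_URS U <-> [\/ U = [set trivial_sub thompsonV],
                      U = [set whole_sub thompsonV] |
                      U = stabilizer_URS thompsonV_act]).
Proof.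
split; first exact: thompsonF_URS.
split; first exact: derivedF_URS.
split; first exact: thompsonT_URS.
exact: thompsonV_URS.
Qed.
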